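(* Let $l\ge1$, $\mathbf v=(v_1,\dots,v_l)\in\mathbb Z^l$ with $v_1\ge\dots\ge v_l$, and let $S=(\beta^1,\dots,\beta^l)$ be a standard symbol of multicharge $\mathbf v$ such that $$\psi_{k,i}=\psi_{j,i}\circ\psi_{k,j}\qquad\text{for all }1\le i<j<k\le l,$$ where $\psi_{j,i}:\beta^j\to\beta^i$ are the Leclerc--Miyachi injections. Then the canonical basis element associated to $S$ is $$G(S)=\sum_{\sigma\in\mathfrak S^{\heartsuit}(S)}q^{\ell(\sigma)}S^\sigma ,$$ where $\mathfrak S^{\heartsuit}(S)$ is the set of $\heartsuit$-admissible spine permutations for $S$. Moreover $G(S)$ is monomial.
   Context: Symbols. For $s\in\mathbb Z$, $\mathfrak B_s$ is the set of strictly increasing integer sequences $\beta=(\beta_j)_{j\le s}$ with $\beta_j=j$ for all sufficiently negative $j$; such a sequence is also viewed as the set of its values. A symbol of multicharge $\mathbf v$ is a tuple $S=(\beta^1,\dots,\beta^l)$ with $\beta^i=(\beta^i_j)_{j\le v_i}\in\mathfrak B_{v_i}$; $\beta^i$ is the $i$-th row (row 1 on top). Its size is $\sum_i\sum_{j\le v_i}(\beta^i_j-j)$. $\mathcal S_{\mathbf v}$ is the set of symbols of multicharge $\mathbf v$ and $\emptyset_{\mathbf v}$ the symbol of size $0$. $S$ is standard if $\beta^i_j\le\beta^{i+1}_j$ for all $1\le i<l$ and $j\le v_{i+1}$. Injections. Let $\gamma\in\mathfrak B_t$, $\beta\in\mathfrak B_s$ with $t\ge s$ and $\gamma_j\le\beta_j$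 for all $j\le s$. Define $\Psi:\beta\to\gamma$ as follows: choose $j_0$ with $\beta_k=\gamma_k=k$ for all $k\le j_0$, put $\Psi(\beta_k)=\gamma_k$ for $k\le j_0$, and inductively for $k>j_0$ put $\Psi(\beta_k)=\max\{\gamma_m : \gamma_m\le\beta_k \text{ and }\gamma_m\ne\Psi(\beta_r)\text{ for all }r<k\}$. For a standard symbol $S$ and $1\le i<j\le l$, $\psi_{j,i}:\beta^j\to\beta^i$ denotes this map with $\beta=\beta^j$, $\gamma=\beta^i$. Spines. Let $S$ be standard with $\psi_{k,i}=\psi_{j,i}\circ\psi_{k,j}$ for all $i<j<k$. On the set of entries of $S$ (each taken with its row) consider the equivalence relation generated by relating $x\in\beta^i$ and $y\in\beta^j$, $i<j$, whenever $\psi_{j,i}(y)=x$. The classes are the spines; each has the form $(\psi_{k,1}(x),\dots,\psi_{k,k-1}(x),x)$ with $x\in\beta^k$, one entry in each of the rows $1,\dots,k$, and $k$ is its length. For $j\le v_1$ let $h_j=r$ iff $v_{r+1}<j\le v_r$ (with $v_{l+1}=-\infty$). The spines are indexed as $(Y_j)_{j\le v_1}$ so that $Y_j$ has length $h_j$ and $Y_j=(j,\dots,j)$ for all sufficiently negative $j$. Let $\mathfrak S_{\mathbf v}=\prod_{j\le v_1}\mathfrak S_{h_j}$, where $\mathfrak S_r$ has Coxeter generators $(k,k+1)$ and length function $\ell$, and put $\ell(\sigma)=\sum_j\ell(\sigma_j)$ for $\sigma=(\sigma_j)_j$. If $Y_j=(a_1,\dots,a_{h_j})$, put $Y_j^{\sigma_j}=(a_{\sigma_j(1)},\dots,a_{\sigma_j(h_j)})$.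 $\sigma$ is $\heartsuit$-admissible for $S$ if (i) for each $i$, the $i$-th entries of the permuted spines of length $\ge i$ have no repetition, so that sorted increasingly they form $\gamma^i\in\mathfrak B_{v_i}$; then $S^\sigma:=(\gamma^1,\dots,\gamma^l)$; and (ii) $\sigma$ has minimal length among all $w\in\mathfrak S_{\mathbf v}$ with $S^w=S^\sigma$. Such $\sigma$ have finite length. Fock space. $\mathcal F_{\mathbf v}$ is the $\mathbb Q(q)$-vector space with basis $\mathcal S_{\mathbf v}$. It is a $U_q(\mathfrak{gl}_\infty)$-module (the tensor product of the level-one modules $V(\Lambda_{v_1})\otimes\dots\otimes V(\Lambda_{v_l})$), in which, for $i\in\mathbb Z$, $$F_i\cdot S=\sum_{S'}q^{\#\{k>j\,:\,i\in\beta^k\}-\#\{k>j\,:\,i+1\in\beta^k\}}S',$$ the sum being over all symbols $S'$ obtained from $S=(\beta^1,\dots,\beta^l)$ by replacing, in a single row $j$, an entry $i$ by $i+1$ (this requires $i\in\beta^j$, $i+1\notin\beta^j$). For $a\ge 0$, $F_i^{(a)}=F_i^a/[a]!$ with $[r]=(q^r-q^{-r})/(q-q^{-1})$ and $[a]!=[a][a-1]\cdots[1]$. Canonical basis. $V_{\mathbf v}\subset\mathcal F_{\mathbf v}$ is the $U_q(\mathfrak{gl}_\infty)$-submodule generated by $\emptyset_{\mathbf v}$, i.e. the $\mathbb Q(q)$-span of all $F_{i_1}\cdots F_{i_m}\cdot\emptyset_{\mathbf v}$. The bar involution $u\mapsto\overline u$ of $V_{\mathbf v}$ is the unique $\mathbb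 Q$-linear map with $\overline{f(q)u}=f(q^{-1})\overline u$ for $f(q)\in\mathbb Q(q)$, $\overline{F_i u}=F_i\overline u$ and $\overline{\emptyset_{\mathbf v}}=\emptyset_{\mathbf v}$. Let $V_{\mathbf v}^{\mathbb Z}$ be the $\mathbb Z[q,q^{-1}]$-span of all $F_{i_1}^{(a_1)}\cdots F_{i_m}^{(a_m)}\cdot\emptyset_{\mathbf v}$, let $R\subset\mathbb Q(q)$ be the ring of rational functions regular at $q=0$, and $\mathcal F_{\mathbf v,R}$ the $R$-span of the symbols. For each standard symbol $S\in\mathcal S_{\mathbf v}$, $G(S)$ is the unique element of $V_{\mathbf v}^{\mathbb Z}$ with $\overline{G(S)}=G(S)$ and $G(S)\equiv S \bmod q\mathcal F_{\mathbf v,R}$ (existence and uniqueness are known); the $G(S)$ form the canonical basis of $V_{\mathbf v}$. $G(S)$ is monomial if $G(S)=F_{i_1}^{(a_1)}\cdots F_{i_r}^{(a_r)}\cdot\emptyset_{\mathbf v}$ for some integers $i_1,\dots,i_r$ with $i_j\ne i_{j+1}$ and some $a_1,\dots,a_r\in\mathbb N$. *)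

(* Defs.v *)
From HB Require Import structures.
From mathcomp Require Import all_boot all_order all_fingroup all_algebra.
From mathcomp Require Import finmap generic_quotient.
From mathcomp Require Import boolp classical_sets functions cardinality fsbigop.
From mathcomp.multinomials Require Import monalg.
From Stdlib Require Import Relation_Operators.

Set Implicit Arguments.
Unset Strict Implicit.
Unset Printing Implicit Defensive.

Import Order.TTheory GRing.Theory Num.Theory.
Local Open Scope classical_set_scope.
Local Open Scope ring_scope.

(* The l rows are indexed by 'I_l, so that row i of the text is index i - 1.  *)

(** Symbols *)

(* A sequence (b_j)_{j <= s} is a total function int -> int; the last clause  *)
(* fixes the meaningless values b_j, j > s, so that equality of rows is       *)
(* equality of sequences.                                                     *)
Definition is_row (s : int) (b : int -> int) : Prop :=
  [/\ forall j k, j < k -> k <= s -> b j < b k,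
      exists N, forall j, j <= N -> b j = j
    & forall j, s < j -> b j = 0].

Record row (s : int) := Row { row_seq :> int -> int; rowP : is_row s row_seq }.

Definition row_set (s : int) (b : row s) : set int :=
  [set x | exists2 j, j <= s & b j = x].

Lemma is_row_id (s : int) : is_row s (fun j => if j <= s then j else 0).
Proof.
split=> [j k jk ks||j sj].
- by rewrite ks (ltW (lt_le_trans jk ks)).
- by exists s => j ->.
- by rewrite leNgt sj.
Qed.

Definition symbol (l : nat) (v : 'I_l -> int) : Type := forall i : 'I_l, row (v i).

HB.instance Definition _ (l : nat) (v : 'I_l -> int) := gen_eqMixin (symbol v).
HB.instance Definition _ (l : nat) (v : 'I_l -> int) :=
  gen_choiceMixin (symbol v).

Definition empty_symbol (l : nat) (v : 'I_l -> int) : symbol v :=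
  fun i => Row (is_row_id (v i)).

Definition standard (l : nat) (v : 'I_l -> int) (S : symbol v) : Prop :=
  forall i i' : 'I_l, i' = i.+1 :> nat -> forall j, j <= v i' -> S i j <= S i' j.

(** Leclerc--Miyachi injections *)

(* Psi is total on int; only its values on the set of values of b matter.     *)
Definition is_injection (s t : int) (b : row s) (c : row t) (Psi : int -> int) :
    Prop :=
  exists j0 : int, [/\ j0 <= s /\ j0 <= t,
    forall k, k <= j0 -> [/\ b k = k, c k = k & Psi (b k) = c k]
  & forall k, j0 < k -> k <= s ->
      let A := [set y | [/\ row_set c y, y <= b k
                          & forall r, r < k -> y <> Psi (b r)]] in
      A (Psi (b k)) /\ ubound A (Psi (b k))].

Definition injection (s t : int) (b : row s) (c : row t) : int -> int :=
  @xget (classicType (int -> int)) idfun [set Psi | is_injection b c Psi].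

Definition psi (l : nat) (v : 'I_l -> int) (S : symbol v) (j i : 'I_l) :
    int -> int :=
  injection (S j) (S i).

Definition compatible (l : nat) (v : 'I_l -> int) (S : symbol v) : Prop :=
  forall i j k : 'I_l, (i < j)%N -> (j < k)%N ->
  forall x, row_set (S k) x -> psi S k i x = psi S j i (psi S k j x).

(** Spines *)

Definition entries (l : nat) (v : 'I_l -> int) (S : symbol v) :
    set ('I_l * int) :=
  [set p | row_set (S p.1) p.2].

Definition spine_step (l : nat) (v : 'I_l -> int) (S : symbol v)
    (p r : 'I_l * int) : Prop :=
  [/\ entries S p, entries S r, (p.1 < r.1)%N & psi S r.1 p.1 r.2 = p.2].

Definition spine_equiv (l : nat) (v : 'I_l -> int) (S : symbol v) :
    'I_l * int -> 'I_l * int -> Prop :=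
  clos_refl_sym_trans _ (spine_step S).

Definition spines (l : nat) (v : 'I_l -> int) (S : symbol v) :
    set (set ('I_l * int)) :=
  [set C | exists2 p, entries S p
                    & C = [set r | entries S r /\ spine_equiv S p r]].

(* As v is nonincreasing, {i | j <= v_i} = {1, ..., h_j}, where h_j = r iff   *)
(* v_{r+1} < j <= v_r; moreover h_j = 0 for j > v_1, which makes the families *)
(* (Y_j)_j and (sigma_j)_j below trivial at such j.                           *)
Definition height (l : nat) (v : 'I_l -> int) (j : int) : nat :=
  #|[pred i : 'I_l | j <= v i]|.

Lemma height_le (l : nat) (v : 'I_l -> int) (j : int) : (height v j <= l)%N.
Proof. by rewrite -[leqRHS]card_ord max_card. Qed.

Definition height_row (l : nat) (v : 'I_l -> int) (j : int)
    (k : 'I_(height v j)) : 'I_l :=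
  widen_ord (height_le v j) k.

Definition tuple_entries (l : nat) (v : 'I_l -> int)
    (Y : forall j : int, 'I_(height v j) -> int) (j : int) : set ('I_l * int) :=
  [set p | exists k : 'I_(height v j), p = (height_row k, Y j k)].

Definition spine_indexing (l : nat) (v : 'I_l -> int) (S : symbol v)
    (Y : forall j : int, 'I_(height v j) -> int) : Prop :=
  set_bij [set j | (0 < height v j)%N] (spines S) (tuple_entries Y) /\
  exists N, forall j, j <= N -> forall k, Y j k = j.

(** Spine permutations *)

Definition simple_transposition (r : nat) (s : 'S_r) : bool :=
  [exists i : 'I_r, exists j : 'I_r, (j == i.+1 :> nat) && (s == tperm i j)].

Definition simple_product (r : nat) (s : 'S_r) (n : nat) : bool :=
  [exists c : {ffun 'I_n -> 'S_r},
    [forall i, simple_transposition (c i)] && (s == (\prod_i c i)%g)].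

Lemma simple_product_ex (r : nat) (s : 'S_r) : exists n, simple_product s n.
Proof.
pose A := finset (@simple_transposition r).
suff /gen_prodgP[n [c Ac ->]] : s \in generated A.
  exists n; apply/existsP; exists (finfun c); apply/andP; split.
    by apply/forallP => i; rewrite ffunE; have := Ac i; rewrite inE.
  by apply/eqP; apply: eq_bigr => i _; rewrite ffunE.
have Atp n (i j : 'I_r) : j = (i + n.+1)%N :> nat -> tperm i j \in generated A.
  elim: n i j => [|n IHn] i j jE.
    rewrite mem_gen// inE; apply/existsP; exists i; apply/existsP; exists j.
    by rewrite eqxx jE addn1 eqxx.
  have ltkr : (i + n.+1 < r)%N by rewrite -addnS -ltnS -jE ltnS ltnW ?ltn_ord.
  pose k := Ordinal ltkr.
  have Akj : tperm k j \in generated A.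
    rewrite mem_gen// inE; apply/existsP; exists k; apply/existsP; exists j.
    by rewrite eqxx /= jE addnS eqxx.
  have Aik : tperm i k \in generated A by apply: IHn.
  have -> : tperm i j = (tperm i k ^ tperm k j)%g.
    rewrite tpermJ tpermL tpermD //; apply/eqP => /(congr1 val) /=.
      by move=> /eqP; rewrite -[X in _ == X]addn0 eqn_add2l.
    by rewrite jE => /eqP; rewrite -[X in _ == X]addn0 eqn_add2l.
  exact: groupJ.
have [ts -> _] := prod_tpermP s.
apply: group_prod => -[i j] _ /=.
have [lij|lji|/val_inj ->] := ltngtP i j; last by rewrite tperm1 group1.
- by apply: (Atp (j - i.+1)%N); rewrite addnS -addSn subnKC.
- by rewrite tpermC; apply: (Atp (i - j.+1)%N); rewrite addnS -addSn subnKC.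
Qed.

Definition coxeter_length (r : nat) (s : 'S_r) : nat :=
  ex_minn (simple_product_ex s).

Definition spine_perm (l : nat) (v : 'I_l -> int) : Type :=
  forall j : int, 'S_(height v j).

HB.instance Definition _ (l : nat) (v : 'I_l -> int) :=
  gen_eqMixin (spine_perm v).
HB.instance Definition _ (l : nat) (v : 'I_l -> int) :=
  gen_choiceMixin (spine_perm v).

Definition finite_length (l : nat) (v : 'I_l -> int) (sigma : spine_perm v) :
    Prop :=
  finite_set [set j | sigma j != 1%g].

(* Meaningful only when finite_length sigma; an infinite sum evaluates to 0.  *)
Definition spine_length (l : nat) (v : 'I_l -> int) (sigma : spine_perm v) :
    nat :=
  \big[addn/0%N]_(j \in [set: int]) coxeter_length (sigma j).

Definition permuted_entry (l : nat) (v : 'I_l -> int)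
    (Y : forall j : int, 'I_(height v j) -> int) (sigma : spine_perm v)
    (j : int) (k : 'I_(height v j)) : int :=
  Y j (sigma j k).

Definition no_repetition (l : nat) (v : 'I_l -> int)
    (Y : forall j : int, 'I_(height v j) -> int) (sigma : spine_perm v) : Prop :=
  forall (j j' : int) (k : 'I_(height v j)) (k' : 'I_(height v j')),
    height_row k = height_row k' ->
    permuted_entry Y sigma k = permuted_entry Y sigma k' -> j = j'.

Definition permuted_row (l : nat) (v : 'I_l -> int)
    (Y : forall j : int, 'I_(height v j) -> int) (sigma : spine_perm v)
    (i : 'I_l) : set int :=
  [set x | exists (j : int) (k : 'I_(height v j)),
             height_row k = i /\ x = permuted_entry Y sigma k].

(* An element of B_s is determined by its set of values, so there is at most  *)
(* one such symbol; it exists under no_repetition.                            *)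
Definition permuted_symbol (l : nat) (v : 'I_l -> int)
    (Y : forall j : int, 'I_(height v j) -> int) (sigma : spine_perm v) :
    symbol v :=
  xget (empty_symbol v)
    [set T : symbol v | forall i, row_set (T i) = permuted_row Y sigma i].

(* Minimality is tested on the w of finite length, the others having infinite *)
(* length.                                                                    *)
Definition heart_admissible (l : nat) (v : 'I_l -> int)
    (Y : forall j : int, 'I_(height v j) -> int) (sigma : spine_perm v) : Prop :=
  [/\ no_repetition Y sigma, finite_length sigma
    & forall w : spine_perm v, no_repetition Y w -> finite_length w ->
        permuted_symbol Y w = permuted_symbol Y sigma ->
        (spine_length sigma <= spine_length w)%N].

(** Scalars *)

Notation Qq := {fraction {poly rat}}.

Definition q : Qq := tofrac ('X : {poly rat}).

Definition at_qinv (p : {poly rat}) : Qq := (map_poly ratr p).[q^-1].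

(* f(q) |-> f(q^-1)                                                           *)
Definition subst_qinv (f : Qq) : Qq :=
  let f' : {ratio {poly rat}} := repr f in
  at_qinv \n_f' / at_qinv \d_f'.

Definition regular_at0 : set Qq :=
  [set f | exists a b : {poly rat}, b.[0] != 0 /\ f = tofrac a / tofrac b].

Definition int_laurent : set Qq :=
  [set f | exists (a : {poly int}) (n : nat),
             f = tofrac (map_poly intr a : {poly rat}) / q ^+ n].

Definition qint (r : nat) : Qq := (q ^+ r - q ^- r) / (q - q^-1).
Definition qfact (a : nat) : Qq := \prod_(1 <= r < a.+1) qint r.

(** Fock space *)

Notation fock v := {malg Qq[symbol v]}.

Definition basis_vector (l : nat) (v : 'I_l -> int) (S : symbol v) : fock v :=
  << S >>.

Definition span_over (M : lmodType Qq) (A : set Qq) (B : set M) : set M :=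
  [set u | exists (n : nat) (c : 'I_n -> Qq) (b : 'I_n -> M),
             (forall i, A (c i) /\ B (b i)) /\ u = \sum_i c i *: b i].

Definition replaces (l : nat) (v : 'I_l -> int) (x : int) (j : 'I_l)
    (S S' : symbol v) : Prop :=
  [/\ row_set (S j) x, ~ row_set (S j) (x + 1),
      forall k, k <= v j -> S' j k = if S j k == x then x + 1 else S j k
    & forall i, i != j -> S' i = S i].

Definition rows_below_with (l : nat) (v : 'I_l -> int) (S : symbol v)
    (j : 'I_l) (x : int) : nat :=
  #|[pred k : 'I_l | (j < k)%N && `[< row_set (S k) x >]]|.

Definition F_symbol (l : nat) (v : 'I_l -> int) (x : int) (S : symbol v) :
    fock v :=
  \sum_(j < l) \sum_(S' \in [set S' | replaces x j S S'])
    q ^ ((rows_below_with S j x)%:Z - (rows_below_with S j (x + 1))%:Z)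
      *: basis_vector S'.

Definition Fop (l : nat) (v : 'I_l -> int) (x : int) (u : fock v) : fock v :=
  \sum_(S <- msupp u) u@_S *: F_symbol x S.

Definition Fdiv (l : nat) (v : 'I_l -> int) (x : int) (a : nat) (u : fock v) :
    fock v :=
  (qfact a)^-1 *: iter a (Fop x) u.

Definition F_word (l : nat) (v : 'I_l -> int) (w : seq int) : fock v :=
  foldr (@Fop l v) (basis_vector (empty_symbol v)) w.

Definition Fdiv_word (l : nat) (v : 'I_l -> int) (w : seq (int * nat)) : fock v :=
  foldr (fun p => @Fdiv l v p.1 p.2) (basis_vector (empty_symbol v)) w.

Definition V_module (l : nat) (v : 'I_l -> int) : set (fock v) :=
  span_over [set: Qq] (range (@F_word l v)).

Definition V_integral (l : nat) (v : 'I_l -> int) : set (fock v) :=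
  span_over int_laurent (range (@Fdiv_word l v)).

Definition fock_regular (l : nat) (v : 'I_l -> int) : set (fock v) :=
  span_over regular_at0 (range (@basis_vector l v)).

(** Canonical basis *)

(* The values of bar outside V_module are irrelevant.                         *)
Definition bar_involution (l : nat) (v : 'I_l -> int) (bar : fock v -> fock v) :
    Prop :=
  [/\ forall u, V_module u -> V_module (bar u),
      forall u w, V_module u -> V_module w -> bar (u + w) = bar u + bar w,
      forall (f : Qq) u, V_module u -> bar (f *: u) = subst_qinv f *: bar u,
      forall (x : int) u, V_module u -> bar (Fop x u) = Fop x (bar u)
    & bar (basis_vector (empty_symbol v)) = basis_vector (empty_symbol v)].

Definition canonical_element (l : nat) (v : 'I_l -> int)
    (bar : fock v -> fock v) (S : symbol v) (G : fock v) : Prop :=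
  [/\ V_integral G, bar G = G
    & exists2 u, fock_regular u & G = basis_vector S + q *: u].

Definition monomial (l : nat) (v : 'I_l -> int) (G : fock v) : Prop :=
  exists w : seq (int * nat),
    sorted (fun p r => p.1 != r.1) w /\ G = Fdiv_word v w.

Definition spine_sum (l : nat) (v : 'I_l -> int)
    (Y : forall j : int, 'I_(height v j) -> int) : fock v :=
  \sum_(sigma \in [set sigma : spine_perm v | heart_admissible Y sigma])
    q ^+ spine_length sigma *: basis_vector (permuted_symbol Y sigma).

(* Main.v *)
(**
A spine is a weakly increasing tuple, and the compatible injections make the
spines non-crossing. Unless the symbol is empty, there is a column x such that
replacing x + 1 by x in every row containing x + 1 but not x either merges the
values x and x + 1 of a single spine, or exchanges x + 1, the only value of one
spine, with the value x of another spine. The result is again a non-crossing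
family, and the sums of q^inversions over the rearrangements of the two families
are related by F_x^(a), where a is the number of rows changed. By induction, such
a sum is a monomial applied to the empty symbol. A permutation of a spine is of
minimal length among those with the same effect iff it does not invert equal
entries, and then its length is the number of inversions of the permuted spine;
so the sum over all rearrangements is the sum over admissible permutations.

For uniqueness, the vectors of V are annihilated by operators raising one entry
to the previous row with a coefficient +-q^m, which commute with the F_x. Hence
the leading symbol of a vector of V is standard. Every standard symbol is the
leading symbol of a monomial vector with leading coefficient 1, so the bar
involution is triangular, with f(q) |-> f(1/q) on leading coefficients. An
element of q F_R in the integral form that is invariant under the bar involution
has its leading coefficient in Z[q, 1/q], divisible by q in R and invariant under
q |-> 1/q; so it is 0.
*)
From HB Require Import structures.
From mathcomp Require Import all_boot all_order all_fingroup all_algebra.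
From mathcomp Require Import finmap generic_quotient.
From mathcomp Require Import boolp classical_sets functions cardinality fsbigop.
From mathcomp.multinomials Require Import monalg.
From Stdlib Require Import Relation_Operators.
From mathcomp Require Import fintype finset zify ring.
Require Import Defs.

Set Implicit Arguments.
Unset Strict Implicit.
Unset Printing Implicit Defensive.

Import Order.TTheory GRing.Theory Num.Theory.

(** * Rows and symbols *)

(** A column to lower is found by minimality. Among all steps by which a spine climbs from one row
    to the next, take a smallest one. A spine with a value strictly inside this step cannot climb
    without crossing it, so it is constant, and the first occupied column above the start of the
    step then yields one of the two allowed situations. After the lowering no row contains x + 1
    without x, in any rearrangement; this leaves a single term in each coefficient of F_x^(a),
    namely the one in which all possible rows are changed at once.

    The leading symbol is standard because of an injectivity. On the columns where exactly one of
    two adjacent rows is occupied, the raising operator deforms the map that sums a function on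
    k-subsets over one-element extensions, and that map is injective when k exceeds half of the
    columns. The sign of -q is forced by commutation with F_x, so the undeformed map sits at q = -1.

    Two orders cooperate. The total order [key] singles out a leading symbol; the partial order by
    [tail_sum], which implies it, is the one that can be followed along a monomial. All supports lie
    in a finite window of columns, where the orders admit induction. *)

Section Transposition.
Local Open Scope ring_scope.

Definition tau (x y : int) : int :=
  if y == x then x + 1 else if y == x + 1 then x else y.

Variant tau_spec (x y : int) : int -> Prop :=
| TauL of y = x : tau_spec x y (x + 1)
| TauR of y = x + 1 : tau_spec x y x
| TauN of y != x & y != x + 1 : tau_spec x y y.

Lemma tauP (x y : int) : tau_spec x y (tau x y).
Proof.
rewrite /tau; case: eqP => [yx|/eqP yx]; first exact: TauL.
by case: eqP => [yx1|/eqP yx1]; [exact: TauR|exact: TauN].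
Qed.

End Transposition.

Ltac taulia :=
  repeat match goal with
  | |- context [tau ?x ?y] =>
    lazymatch y with context [tau] => fail | _ => case: (tauP x y) => * end
  end; lia.

Section TranspositionTheory.
Local Open Scope ring_scope.

Lemma tauK (x : int) : involutive (tau x).
Proof. by move=> y; taulia. Qed.

Lemma tau_neq (x y : int) : y != x -> y != x + 1 -> tau x y = y.
Proof. by taulia. Qed.

Lemma tauL (x : int) : tau x x = x + 1. Proof. by taulia. Qed.

Lemma tauR (x : int) : tau x (x + 1) = x. Proof. by taulia. Qed.

End TranspositionTheory.

Section Rows.
Local Open Scope ring_scope.

Lemma row_lt (s : int) (b : row s) (j k : int) : j < k -> k <= s -> b j < b k.
Proof. by case: b => b [H _ _] /=; exact: H. Qed.

Lemma row_ltE (s : int) (b : row s) (j k : int) :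
  j <= s -> k <= s -> (b j < b k) = (j < k).
Proof.
move=> js ks; have [jk|kj|->] := ltgtP j k; last by rewrite ltxx.
- by rewrite row_lt.
- by apply/negbTE; rewrite -leNgt ltW // row_lt.
Qed.

(** Indices are unbounded to the left, so the induction starts from the whole stretch on which a row
    is the identity. *)
Lemma row_ind (N : int) (P : int -> Prop) :
  (forall j, j <= N -> P j) -> (forall j, (forall k, k < j -> P k) -> P j) ->
  forall j, P j.
Proof.
move=> P0 PS j; have [jN|Nj] := leP j N; first exact: P0.
have [n] : exists n, (`|j - N| < n)%N by exists `|j - N|.+1.
elim: n j Nj => // n IH j Nj jn.
apply: PS => k kj; have [kN|Nk] := leP k N; first exact: P0.
by apply: IH => //; lia.
Qed.

(** At the first index where the rows differ, the smaller of the two values would occur in the other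
    row at an earlier index, where the rows agree. *)
Lemma row_set_inj (s : int) (b c : row s) :
  (forall x, row_set b x <-> row_set c x) -> b = c.
Proof.
move=> bc.
have E j : j <= s -> b j = c j.
  case: (rowP b) => _ [N1 b1] _; case: (rowP c) => _ [N2 c2] _.
  elim/(@row_ind (Num.min N1 N2)): j => [j|j IH js].
    by rewrite le_min => /andP[j1 j2] _; rewrite b1 ?c2.
  have [lt|gt|//] := ltgtP (b j) (c j).
  - have [m ms cm] : row_set c (b j) by apply/bc; exists j.
    have mj : m < j by rewrite -(row_ltE c) // cm.
    by move: (row_lt b mj js); rewrite (IH m mj ms) cm ltxx.
  - have [m ms bm] : row_set b (c j) by apply/bc; exists j.
    have mj : m < j by rewrite -(row_ltE b) // bm.
    by move: (row_lt c mj js); rewrite -(IH m mj ms) bm ltxx.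
case: b c E {bc} => b bP [c cP] /= E.
have bcE : b = c.
  apply: funext => j; have [js|sj] := leP j s; first exact: E.
  by case: bP => _ _ ->; case: cP => // _ _ ->.
by move: bP; rewrite bcE => bP; rewrite (Prop_irrelevance bP cP).
Qed.

Definition has_one (s : int) (b : row s) (x : int) : bool :=
  `[< row_set b x >] (+) `[< row_set b (x + 1) >].

Lemma is_row_tau (s : int) (b : row s) (x : int) : has_one b x ->
  is_row s (fun j => if j <= s then tau x (b j) else 0).
Proof.
move=> b1; split=> [j k jk ks||j sj]; last by rewrite leNgt sj.
- have js := ltW (lt_le_trans jk ks); rewrite js ks.
  move: (row_lt b jk ks).
  have : ~~ ((b j == x) && (b k == x + 1)).
    apply: contraL b1 => /andP[/eqP bj /eqP bk]; rewrite /has_one.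
    have -> : `[< row_set b x >] by apply/asboolP; exists j.
    by have -> : `[< row_set b (x + 1) >] by apply/asboolP; exists k.
  taulia.
- case: (rowP b) => _ [N bN] _.
  exists (Num.min (Num.min N s) (x - 1)) => j.
  rewrite !le_min => /andP[/andP[jN js] jx]; rewrite js bN //; taulia.
Qed.

(** A row with both or neither of [x] and [x + 1] has a value set invariant under [tau x]. Leaving
    it unchanged therefore makes [row_set_swap] hold without hypothesis. *)
Definition row_swap (s : int) (x : int) (b : row s) : row s :=
  match pselect (has_one b x) with
  | left h => Row (is_row_tau h)
  | right _ => b
  end.

Lemma row_set_swap (s : int) (x : int) (b : row s) (y : int) :
  row_set (row_swap x b) y <-> row_set b (tau x y).
Proof.
rewrite /row_swap; case: pselect => h; split.
- by move=> [j js]; rewrite /= js => <-; exists j; rewrite ?tauK.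
- by move=> [j js bj]; exists j => //=; rewrite js bj tauK.
- move/negP: h; rewrite /has_one negb_add => /eqP e.
  have H := propext (asbool_eq_equiv e).
  by case: tauP => [->|->|//]; rewrite H.
- move/negP: h; rewrite /has_one negb_add => /eqP e.
  have H := propext (asbool_eq_equiv e).
  by case: tauP => [->|->|//]; rewrite H.
Qed.

End Rows.

Section Symbols.
Local Open Scope ring_scope.
Variables (l : nat) (v : 'I_l -> int).
Implicit Types (T : symbol v) (x y : int) (A B : {set 'I_l}).

Definition ent T (i : 'I_l) x : bool := `[< row_set (T i) x >].

Lemma entP T i x : reflect (row_set (T i) x) (ent T i x).
Proof. exact: asboolP. Qed.

Lemma ent_inj T T' : (forall i x, ent T i x = ent T' i x) -> T = T'.
Proof.
move=> H; apply: functional_extensionality_dep => i; apply: row_set_inj => x.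
by split=> /(asboolP _); [rewrite -/(ent T i x) H|rewrite -/(ent T' i x) -H];
  move=> /entP.
Qed.

Definition swapS x A T : symbol v :=
  fun i => if i \in A then row_swap x (T i) else T i.

Lemma ent_swap x A T i y :
  ent (swapS x A T) i y = if i \in A then ent T i (tau x y) else ent T i y.
Proof.
rewrite /ent /swapS; case: ifP => // _.
by apply/asboolP/asboolP => /row_set_swap.
Qed.

Lemma swapSK x A : involutive (swapS x A).
Proof.
by move=> T; apply: ent_inj => i y; rewrite !ent_swap; case: (i \in A); rewrite ?tauK.
Qed.

Lemma swapSU x A B T : [disjoint A & B] ->
  swapS x A (swapS x B T) = swapS x (A :|: B) T.
Proof.
move=> dAB; apply: ent_inj => i y; rewrite !ent_swap inE.
case: (boolP (i \in A)) => //= iA.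
by rewrite (disjointFr dAB iA).
Qed.

Definition Dset T x : {set 'I_l} := [set i | ent T i (x + 1) && ~~ ent T i x].
Definition Uset T x : {set 'I_l} := [set i | ent T i x && ~~ ent T i (x + 1)].

Lemma replacesE x (j : 'I_l) T T' :
  replaces x j T T' <-> j \in Uset T x /\ T' = swapS x [set j] T.
Proof.
split=> [[Tx Tx1 TE TE']|[]].
  have jU : j \in Uset T x.
    by rewrite inE; apply/andP; split; [apply/entP|apply/negP => /entP].
  split=> //; apply: ent_inj => i y; rewrite ent_swap inE.
  case: eqP => [->|/eqP ij]; last by rewrite /ent TE'.
  apply/entP/entP => -[k kv].
  - rewrite TE // => <-; exists k => //; case: eqP => [->|bk]; first by rewrite tauR.
    rewrite tau_neq //; first exact/eqP.
    by apply/eqP => bk1; apply: Tx1; exists k.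
  - move=> Tk; exists k => //; rewrite TE // Tk.
    move: Tk; case: (tauP x y) => [->|->|yx yx1] Tk.
    + by case: Tx1; exists k.
    + by rewrite eqxx.
    + by rewrite (negbTE yx).
move=> jU ->; move: (jU); rewrite inE => /andP[/entP Tx /entP Tx1]; split => //.
- move=> k kv; rewrite /swapS inE eqxx /row_swap; case: pselect => [h|nh] /=.
    rewrite kv /tau; case: eqP => // _; case: eqP => // e.
    by case: Tx1; exists k.
  by case: nh; rewrite /has_one asboolT // asboolF.
- by move=> i ij; rewrite /swapS inE (negbTE ij).
Qed.

Lemma in_Dswap x A T i : (i \in Dset (swapS x A T) x) =
  if i \in A then i \in Uset T x else i \in Dset T x.
Proof. by rewrite !inE !ent_swap; case: ifP => // _; rewrite tauL tauR. Qed.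

Lemma in_Uswap x A T i : (i \in Uset (swapS x A T) x) =
  if i \in A then i \in Dset T x else i \in Uset T x.
Proof. by rewrite !inE !ent_swap; case: ifP => // _; rewrite tauL tauR. Qed.

End Symbols.

(** * Divided powers *)

Section QIntegers.
Local Open Scope ring_scope.

Lemma q_neq0 : q != 0.
Proof. by rewrite tofrac_eq0 polyX_eq0. Qed.

Lemma qX_inj : injective (fun n : nat => q ^+ n).
Proof.
move=> m n /eqP; rewrite /q -!rmorphXn /= tofrac_eq => /eqP/(congr1 (fun p : {poly rat} => size p)).
by rewrite !size_polyXn => -[].
Qed.

Lemma q2_neq1 : q - q^-1 != 0.
Proof.
rewrite subr_eq0; apply/eqP => /(congr1 (fun z => z * q)).
rewrite mulVf ?q_neq0 // -expr2 -(expr0 q) => /qX_inj //.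
Qed.

Lemma quantum_succ (F : fieldType) (t : F) (n : nat) : t != 0 -> t - t^-1 != 0 ->
  (t ^+ n.+1 - t ^- n.+1) / (t - t^-1) =
  t ^+ n + t^-1 * ((t ^+ n - t ^- n) / (t - t^-1)).
Proof.
move=> t0 t2; set d := t - t^-1; have tn : t ^+ n != 0 by rewrite expf_neq0.
rewrite mulrA -[X in _ = X + _](mulfK t2) -/d -mulrDl; congr (_ / _).
by rewrite /d exprS; field; rewrite tn t0.
Qed.

Lemma qintS (n : nat) : qint n.+1 = q ^+ n + q^-1 * qint n.
Proof. exact: quantum_succ q_neq0 q2_neq1. Qed.

Lemma qint0 : qint 0 = 0.
Proof. by rewrite /qint !expr0 invr1 subrr mul0r. Qed.

Lemma quantum_neq0 (F : fieldType) (t : F) (n : nat) :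
  t != 0 -> t - t^-1 != 0 -> t ^+ (n + n) != 1 ->
  (t ^+ n - t ^- n) / (t - t^-1) != 0.
Proof.
move=> t0 t2 tn; rewrite mulf_neq0 ?invr_eq0 // subr_eq0; apply: contra tn => /eqP e.
by rewrite exprD {1}e mulVf // expf_neq0.
Qed.

Lemma qint_neq0 (n : nat) : qint n.+1 != 0.
Proof.
apply: quantum_neq0 q_neq0 q2_neq1 _; apply/eqP; rewrite -(expr0 q).
by move=> /qX_inj.
Qed.

Lemma qfact0 : qfact 0 = 1.
Proof. by rewrite /qfact big_geq. Qed.

Lemma qfactS (a : nat) : qfact a.+1 = qfact a * qint a.+1.
Proof. by rewrite /qfact big_nat_recr. Qed.

Lemma qfact_neq0 (a : nat) : qfact a != 0.
Proof.
elim: a => [|a IH]; first by rewrite qfact0 oner_eq0.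
rewrite qfactS; exact: mulf_neq0 IH (qint_neq0 a).
Qed.

Opaque q qint qfact.

(* The terms are the powers q ^ (n - 1), q ^ (n - 3), ..., q ^ (1 - n). *)
Lemma sum_rank_qint (l : nat) (B : {set 'I_l}) :
  \sum_(j in B) q ^ ((#|[set i in B | (i < j)%N]|)%:Z
                   - (#|[set i in B | (j < i)%N]|)%:Z) = qint #|B|.
Proof.
have [n] : exists n, #|B| = n by exists #|B|.
elim: n B => [|n IH] B Bn.
  move/eqP: Bn; rewrite cards_eq0 => /eqP ->; rewrite big_set0 cards0.
  by rewrite qint0.
have /card_gt0P[j0 j0B] : (0 < #|B|)%N by rewrite Bn.
case: (arg_maxnP (fun i : 'I_l => val i) j0B) => m /= mB mmax.
have {}mB : m \in B by exact: mB.
have Bm : #|B :\ m| = n by have := cardsD1 m B; rewrite Bn mB => -[].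
rewrite (big_setD1 m) //= Bn qintS; congr (_ + _).
  have -> : [set i in B | (m < i)%N] = set0.
    apply/setP => i; rewrite !inE; apply/negbTE/negP => /andP[iB].
    by rewrite ltnNge; have := mmax i iB => /= ->.
  have -> : [set i in B | (i < m)%N] = B :\ m.
    apply/setP => i; rewrite !inE andbC; case: (boolP (i \in B)) => [iB|]; last by rewrite !andbF.
    have := mmax i iB => /= le; rewrite !andbT ltn_neqAle le andbT.
    by apply/idP/idP; apply: contra => /eqP; [move=> ->|move=> /val_inj ->].
  by rewrite cards0 subr0 Bm.
rewrite -Bm -IH // big_distrr /=; apply: eq_bigr => j; rewrite !inE => /andP[jm jB].
have jltm : (j < m)%N by rewrite ltn_neqAle; apply/andP; split; [exact: jm|exact: (mmax j jB)].
rewrite -[q^-1]/(q ^ (-1)) -expfzDr ?q_neq0 //; congr (_ ^ _).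
have -> : [set i in B :\ m | (i < j)%N] = [set i in B | (i < j)%N].
  apply/setP => i; rewrite !inE; case: eqP => [->|//] /=.
  by rewrite mB /=; apply/esym/negbTE; rewrite -leqNgt ltnW.
have -> : [set i in B :\ m | (j < i)%N] = [set i in B | (j < i)%N] :\ m.
  by apply/setP => i; rewrite !inE andbA.
have := cardsD1 m [set i in B | (j < i)%N]; rewrite inE mB jltm /= => ->.
by rewrite addnC PoszD; ring.
Qed.

End QIntegers.

(** * The operators F_x and their divided powers, coefficient by coefficient *)

Section ChevalleyAction.
Local Open Scope ring_scope.
Variables (l : nat) (v : 'I_l -> int).
Implicit Types (T S : symbol v) (x y : int) (A B : {set 'I_l}) (u : fock v).

Definition ent_diff T x (k : 'I_l) : int := (ent T k x : nat)%:Z - (ent T k (x + 1) : nat)%:Z.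

Definition kap T x (j : 'I_l) : int := \sum_(k < l | (j < k)%N) ent_diff T x k.

Lemma rows_below_kap T x j :
  (rows_below_with T j x)%:Z - (rows_below_with T j (x + 1))%:Z = kap T x j.
Proof.
have E y : (rows_below_with T j y)%:Z = \sum_(k < l | (j < k)%N) (ent T k y : nat)%:Z.
  rewrite /rows_below_with -sum1_card -natz natr_sum big_mkcond [RHS]big_mkcond /=.
  by apply: eq_bigr => k _; rewrite inE /ent; case: ltnP => //= _; case: `[< _ >].
by rewrite !E -sumrB.
Qed.

Lemma kap_swap T x j : kap (swapS x [set j] T) x j = kap T x j.
Proof.
apply: eq_bigr => k jk; rewrite /ent_diff !ent_swap inE.
by case: eqP => // kj; rewrite kj ltnn in jk.
Qed.

Lemma F_symbolE x S :
  F_symbol x S = \sum_(j in Uset S x) q ^ kap S x j *: basis_vector (swapS x [set j] S).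
Proof.
rewrite /F_symbol [RHS]big_mkcond /=; apply: eq_bigr => j _.
case: ifP => [jU|jU].
  rewrite (_ : mkset _ = classical_sets.set1 (swapS x [set j] S)); last first.
    by apply/seteqP; split=> T /=; rewrite replacesE; [case|move=> ->].
  by rewrite fsbig_set1 rows_below_kap.
rewrite (_ : mkset _ = classical_sets.set0) ?fsbig_set0 //.
by apply/seteqP; split=> T //=; rewrite replacesE jU => -[].
Qed.

(** F_x is read backwards: the symbols that contribute to [T] come from lowering one row of [T]. The
    exponent may be taken at [T] because it involves only the rows below row [j], which do not
    change. *)
Lemma mcoeff_Fop x u T :
  (Fop x u)@_T = \sum_(j in Dset T x) q ^ kap T x j * u@_(swapS x [set j] T).
Proof.
rewrite /Fop raddf_sum /=.
have E S : (u@_S *: F_symbol x S)@_T =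
    \sum_(j in Dset T x) q ^ kap T x j * (u@_S *+ (S == swapS x [set j] T)).
  rewrite mcoeffZ F_symbolE raddf_sum big_distrr /= big_mkcond [RHS]big_mkcond /=.
  apply: eq_bigr => j _; rewrite mcoeffZ /basis_vector mcoeffU.
  have [<-|nT] := eqVneq (swapS x [set j] S) T.
    rewrite swapSK eqxx in_Dswap in_set1 eqxx kap_swap.
    by case: ifP => //; rewrite !mulr1n mulr1 mulrC.
  case: eqP => [ST|]; first by move: nT; rewrite ST swapSK eqxx.
  by rewrite !mulr0n !mulr0; case: ifP; case: ifP.
rewrite (eq_bigr _ (fun S _ => E S)) exchange_big /=; apply: eq_bigr => j jD.
rewrite -big_distrr /=; congr (_ * _).
have [Su|Su] := boolP (swapS x [set j] T \in msupp u).
  rewrite (big_rem _ Su) /= eqxx big1_seq ?addr0 // => S /= SS.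
  case: eqP => // SE; move: SS; rewrite SE.
  by rewrite (rem_filter _ (fset_uniq _)) mem_filter /= eqxx.
rewrite (mcoeff_outdom Su) big1_seq // => S /= SS.
by case: eqP => // SE; move: Su; rewrite -SE SS.
Qed.

End ChevalleyAction.
Transparent q qint qfact.

Section DividedPowers.
Local Open Scope ring_scope.
Variables (l : nat) (v : 'I_l -> int).
Implicit Types (T S : symbol v) (x y : int) (A B : {set 'I_l}) (u : fock v).

Lemma Fop_linear x (c : Qq) u w : Fop x (c *: u + w) = c *: Fop x u + Fop x w.
Proof.
apply/malgP => T; rewrite (mcoeffD T (c *: Fop x u)) (mcoeffZ c (Fop x u)).
rewrite [LHS]mcoeff_Fop [X in _ = c * X + _]mcoeff_Fop [X in _ = _ + X]mcoeff_Fop.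
rewrite big_distrr -big_split /=.
by apply: eq_bigr => j _; rewrite mcoeffD mcoeffZ mulrDr mulrCA.
Qed.

(** The exponent for raising all rows of [A] together: only rows outside [A] count, since the
    interaction inside [A] is absorbed by the quantum factorial. *)
Definition swap_exp T x A : int :=
  \sum_(j in A) \sum_(k < l | (j < k)%N && (k \notin A)) ent_diff T x k.

Lemma ent_diff_D T x k : k \in Dset T x -> ent_diff T x k = -1.
Proof. by rewrite inE /ent_diff => /andP[-> /negbTE ->]. Qed.

(** Row [j] is raised last. It sees each row of [A] below it already at [x + 1], which counts -1,
    while each row of [A] above it has seen row [j] still at [x], which counts +1. *)
Lemma swap_expU1 T x (j : 'I_l) A : j \notin A -> j |: A \subset Dset T x ->
  kap T x j + swap_exp (swapS x [set j] T) x A =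
  swap_exp T x (j |: A) + ((#|[set i in j |: A | (i < j)%N]|)%:Z
                         - (#|[set i in j |: A | (j < i)%N]|)%:Z).
Proof.
move=> jA /subsetP sD.
have jD := sD j (setU11 _ _).
have E1 : kap T x j = \sum_(k < l | (j < k)%N && (k \notin j |: A)) ent_diff T x k
    - (#|[set i in j |: A | (j < i)%N]|)%:Z.
  rewrite /kap (bigID (fun k => k \notin j |: A)) /=; congr (_ + _).
  rewrite (eq_bigr (fun=> -1)); last first.
    by move=> k /andP[_]; rewrite negbK => /sD; exact: ent_diff_D.
  rewrite sumr_const mulNrn; congr (- _); rewrite -natz; congr (_%:R).
  by apply: eq_card => k; rewrite !inE unfold_in /= !inE negbK andbC.
rewrite E1 /swap_exp (big_setU1 j jA) /= -!addrA; congr (_ + _).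
rewrite [RHS]addrA [LHS]addrC; congr (_ + _).
have -> : #|[set i in j |: A | (i < j)%N]|%:Z = \sum_(i in A) (i < j)%N%:Z.
  rewrite (eq_bigr (fun i : 'I_l => ((i < j)%N : nat)%:R)); last by move=> i _; rewrite natz.
  rewrite -natr_sum natz; congr (_%:Z); rewrite -big_mkcondr /= sum1dep_card.
  by apply: eq_card => i; rewrite !inE; case: eqP => [->|//]; rewrite ltnn (negbTE jA).
rewrite -big_split /=; apply: eq_bigr => i iA.
rewrite (bigID (fun k => k == j)) /= addrC; congr (_ + _).
  apply: eq_big => k; first by rewrite !inE negb_or -andbA; congr andb; rewrite andbC.
  by move=> /andP[_ kj]; rewrite /ent_diff !ent_swap inE (negbTE kj).
case: (ltnP i j) => ij /=; last first.
  by rewrite big_pred0 // => k; case: eqP => [->|_]; rewrite ?andbF // ltnNge ij.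
rewrite (big_pred1 j) => [|k /=]; last first.
  by case: eqP => [->|_]; rewrite ?andbF // andbT ij jA.
rewrite /ent_diff !ent_swap set11 tauL tauR.
by move: jD; rewrite inE => /andP[-> /negbTE ->].
Qed.

(** A set of a + 1 rows is reached through the choice of the row raised last. By [sum_rank_qint] the
    resulting powers of q add up to [qint a.+1], the factor by which [qfact] grows. *)
Lemma mcoeff_Fdiv x a u T : (Fdiv x a u)@_T =
  \sum_(A : {set 'I_l} | (A \subset Dset T x) && (#|A| == a))
     q ^ swap_exp T x A * u@_(swapS x A T).
Proof.
rewrite /Fdiv mcoeffZ; apply: (canLR (mulKf (qfact_neq0 a))).
elim: a T => [|a IH] T.
  rewrite [RHS](_ : _ = u@_T); last first.
    rewrite qfact0 mul1r (big_pred1 set0) => [|A /=]; last first.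
      by rewrite cards_eq0; case: eqP => [->|]; rewrite ?sub0set ?andbF.
    rewrite /swap_exp big_set0 expr0z mul1r; congr (_@__).
    by apply: ent_inj => i y; rewrite ent_swap inE.
  by [].
rewrite /= mcoeff_Fop.
rewrite (eq_bigr (fun j => qfact a * \sum_(A : {set 'I_l} |
   (A \subset Dset T x :\ j) && (#|A| == a))
   q ^ (kap T x j + swap_exp (swapS x [set j] T) x A) * u@_(swapS x (j |: A) T))); last first.
  move=> j jD; rewrite IH mulrCA; congr (_ * _).
  have -> : Dset (swapS x [set j] T) x = Dset T x :\ j.
    apply/setP => i; rewrite in_Dswap in_set1 !in_setD1; case: eqP => //= ->.
    by move: jD; rewrite !inE => /andP[-> _]; rewrite andbF.
  rewrite big_distrr /=; apply: eq_bigr => A /andP[sA _].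
  rewrite mulrA -expfzDr ?q_neq0 //; congr (_ * _@__).
  rewrite swapSU 1?setUC // disjoint_sym disjoints1.
  by apply/negP => /(subsetP sA); rewrite !inE eqxx.
rewrite -big_distrr /= qfactS -mulrA; congr (_ * _).
rewrite pair_big_dep /= big_distrr /=.
pose h (p : 'I_l * {set 'I_l}) := (p.1 |: p.2, p.1).
pose h' (p : {set 'I_l} * 'I_l) := (p.2, p.1 :\ p.2).
transitivity (\sum_(A : {set 'I_l} | (A \subset Dset T x) && (#|A| == a.+1))
  \sum_(j in A) q ^ ((#|[set i in A | (i < j)%N]|)%:Z
                   - (#|[set i in A | (j < i)%N]|)%:Z) *
     (q ^ swap_exp T x A * u@_(swapS x A T))); last first.
  by apply: eq_bigr => A /andP[_ /eqP Aa]; rewrite -big_distrl /= sum_rank_qint Aa.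
rewrite pair_big_dep /= (reindex_onto h h') /=; last first.
  by move=> [A j] /= /andP[_ jA]; rewrite /h /h' /= setD1K.
apply: eq_big => [[j A]|[j A]] /=.
  rewrite /h /h' /= setU11 andbT xpair_eqE eqxx /=.
  case: (boolP (j \in A)) => [jA|jA].
    have -> : (A \subset Dset T x :\ j) = false.
      by apply/negP => /subsetP/(_ j jA); rewrite !inE eqxx.
    rewrite !andbF; apply/esym/negbTE; rewrite !negb_and; apply/orP; right.
    by apply/eqP => /setP/(_ j); rewrite !inE eqxx jA.
  by rewrite setU1K // eqxx andbT subUset sub1set subsetD1 jA andbT cardsU1 jA add1n eqSS andbA.
move=> /andP[jD /andP[sA _]].
have jA : j \notin A by apply/negP => /(subsetP sA); rewrite !inE eqxx.
rewrite swap_expU1 //; last first.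
  by rewrite subUset sub1set jD (subset_trans sA) ?subsetDl.
by rewrite addrC expfzDr ?q_neq0 // mulrA.
Qed.
End DividedPowers.

(** * Spine families and their rearrangements *)

Section SpineFamilies.
Local Open Scope ring_scope.
Variables (l : nat) (v : 'I_l -> int).
Hypothesis hv : forall i j : 'I_l, (i <= j)%N -> v j <= v i.
Implicit Types (T S : symbol v) (x y : int) (A B : {set 'I_l}) (Z b : int -> 'I_l -> int).

(* Row i meets spine j exactly when j <= v i, and then Z j i is the entry. The
   third clause says that the spine of Z j k meets row i in the largest entry
   that is at most Z j k and is not used by a smaller entry of row k. *)
Definition spine_family (N : int) Z : Prop :=
  [/\ forall j (i k : 'I_l), (i <= k)%N -> j <= v k -> Z j i <= Z j k,
      forall j j' (i : 'I_l), j <= v i -> j' <= v i -> Z j i = Z j' i -> j = j',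
      forall j j' (i k : 'I_l), (i < k)%N -> j <= v k -> j' <= v i -> j != j' ->
        Z j i < Z j' i -> Z j' i <= Z j k -> j' <= v k /\ Z j' k < Z j k
    & forall j i, j < N -> Z j i = j].

(** Suppose that spine [j] in row [i] equals spine [j'] in a lower row [k]. In row [i], spine [j']
    lies below spine [j], so non-crossing makes [j] reach row [k] with a value smaller than the one
    it had in row [i], against monotonicity. *)
Lemma spine_disjoint N Z j j' (i k : 'I_l) : spine_family N Z ->
  j <= v i -> j' <= v k -> Z j i = Z j' k -> j = j'.
Proof.
move=> [mono inj nc _].
wlog ik : j j' i k / (i <= k)%N.
  move=> H; have [ik|/ltnW ki] := leqP i k; first exact: H.
  by move=> ji jk e; apply/esym; apply: (H _ _ k i).
move=> ji jk e; have j'i : j' <= v i := le_trans jk (hv ik).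
have [ik_eq|ik_neq] := eqVneq i k.
  by subst k; apply: inj e.
have {}ik : (i < k)%N by rewrite ltn_neqAle ik andbT; exact: ik_neq.
have [//|jj'] := eqVneq j j'.
have le1 := mono j' i k (ltnW ik) jk.
have ne1 : Z j' i != Z j i by apply/eqP => e'; move: jj'; rewrite (inj _ _ _ j'i ji e') eqxx.
have lt1 : Z j' i < Z j i by rewrite lt_neqAle ne1 e.
have j'j : j' != j by rewrite eq_sym.
have le2 : Z j i <= Z j' k by rewrite e.
have [jk' lt2] := nc _ _ _ _ ik jk ji j'j lt1 le2.
by have := mono j i k (ltnW ik) jk'; rewrite e leNgt lt2.
Qed.

Definition merge x y : int := if y == x + 1 then x else y.

Variant merge_spec x y : int -> Prop :=
| MergeR of y = x + 1 : merge_spec x y x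
| MergeN of y != x + 1 : merge_spec x y y.

Lemma mergeP x y : merge_spec x y (merge x y).
Proof. by rewrite /merge; case: eqP => [|/eqP] ?; constructor. Qed.

(** Both values belong to the spine [p] alone, so the identification affects no comparison between
    different spines. *)
Lemma merge_family N Z x p : spine_family N Z -> N <= x ->
  (forall j i, j <= v i -> Z j i = x \/ Z j i = x + 1 -> j = p) ->
  spine_family N (fun j i => merge x (Z j i)).
Proof.
move=> [mono inj nc fr] Nx hp; split.
- move=> j i k ik jk; have := mono j i k ik jk.
  by case: (mergeP x (Z j i)); case: (mergeP x (Z j k)); lia.
- move=> j j' i ji j'i; have hj := hp j i ji; have hj' := hp j' i j'i.
  case: (mergeP x (Z j i)) => e1; case: (mergeP x (Z j' i)) => e2 e.
  + by apply: inj ji j'i _; rewrite e1 e2.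
  + by rewrite (hj (or_intror e1)) (hj' (or_introl (esym e))).
  + by rewrite (hj (or_introl e)) (hj' (or_intror e2)).
  + exact: inj ji j'i e.
- move=> j j' i k ik jk j'i jj' lt le.
  have ji : j <= v i by rewrite (le_trans jk) // hv // ltnW.
  have lt1 : Z j i < Z j' i.
    by move: lt; case: (mergeP x (Z j i)); case: (mergeP x (Z j' i)); lia.
  have le1 : Z j' i <= Z j k.
    move: le; case: (mergeP x (Z j' i)) => e1; case: (mergeP x (Z j k)) => e2; try lia.
    move=> le; have [e3|?] := eqVneq (Z j k) x; last by lia.
    by move: jj'; rewrite (hp j k jk (or_introl e3)) (hp j' i j'i (or_intror e1)) eqxx.
  have [j'k lt2] := nc _ _ _ _ ik jk j'i jj' lt1 le1; split=> //.
  case: (mergeP x (Z j' k)) => e1; case: (mergeP x (Z j k)) => e2; try lia.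
  have [e3|?] := eqVneq (Z j' k) x; last by lia.
  by move: jj'; rewrite (hp j k jk (or_intror e2)) (hp j' k j'k (or_introl e3)) eqxx.
- by move=> j i jN; rewrite fr //; case: mergeP => //; lia.
Qed.

(** After the exchange, an entry [x + 1] of [r] lies above the constant value [x] of [p].
    Non-crossing then requires [p] to meet each row that [r] meets, whence the hypothesis comparing
    their lengths. *)
Lemma tau_family N Z x p r : spine_family N Z -> N <= x -> p != r ->
  (forall i, p <= v i -> Z p i = x + 1) ->
  (forall i : 'I_l, r <= v i -> p <= v i) ->
  (forall j i, j <= v i -> Z j i = x -> j = r) ->
  (exists i, p <= v i) ->
  spine_family N (fun j i => tau x (Z j i)).
Proof.
move=> ZF Nx pr hp hrp hr [i0 pi0].
have hp' j i : j <= v i -> Z j i = x + 1 -> j = p.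
  by move=> ji e; apply: (spine_disjoint ZF ji pi0); rewrite e hp.
move: ZF => [mono inj nc fr]; split.
- move=> j i k ik jk; have ji : j <= v i := le_trans jk (hv ik).
  have := mono j i k ik jk.
  case: (tauP x (Z j i)) => [e1|e1|n1 n1']; case: (tauP x (Z j k)) => [e2|e2|n2 n2'];
    try lia.
  move=> _; move: pr; rewrite -(hp' j k jk e2) -(hr j i ji e1) eqxx.
  by [].
- by move=> j j' i ji j'i /(can_inj (tauK x)); apply: inj.
- move=> j j' i k ik jk j'i jj' lt le.
  have ji : j <= v i by rewrite (le_trans jk) // hv // ltnW.
  have [e1|n1] := eqVneq (Z j' i) (x + 1).
    have j'p := hp' _ _ j'i e1; subst j'.
    have [e2|n2] := eqVneq (Z j k) x.
      have jr := hr _ _ jk e2; subst j.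
      have pk := hrp _ jk; split=> //; rewrite (hp k pk) e2; taulia.
    move: lt le; rewrite e1 tauR => lt le.
    have lt1 : Z j i < Z p i.
      by rewrite e1; move: lt; taulia.
    have le1 : Z p i <= Z j k by rewrite e1; move: le n2; taulia.
    have [pk lt2] := nc _ _ _ _ ik jk j'i jj' lt1 le1; split=> //.
    move: lt2; rewrite (hp k pk) tauR; taulia.
  have [e1|n1'] := eqVneq (Z j' i) x.
    have j'r := hr _ _ j'i e1; subst j'.
    have pi := hrp _ j'i.
    have [jp|jp] := eqVneq j p.
      by move: le; rewrite jp (hp k) ?e1 -?jp // tauL tauR; lia.
    have jk1 : Z j k != x + 1 by apply: contra_neq jp; exact: hp'.
    have ji1 : Z j i != x + 1 by apply: contra_neq jp; exact: hp'.
    have jk2 : Z j k != x by apply: contra_neq jj'; exact: hr.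
    have ji2 : Z j i != x by apply: contra_neq jj'; exact: hr.
    move: lt le; rewrite e1 tauL (tau_neq ji2 ji1) (tau_neq jk2 jk1) => lt le.
    have lt1 : Z j i < Z r i by rewrite e1; lia.
    have le1 : Z r i <= Z j k by rewrite e1; lia.
    have [rk lt2] := nc _ _ _ _ ik jk j'i jj' lt1 le1; split=> //.
    by move: lt2 jk1 jk2; taulia.
  move: lt le; rewrite (tau_neq n1' n1) => lt le.
  have lt1 : Z j i < Z j' i by move: lt n1 n1'; taulia.
  have le1 : Z j' i <= Z j k by move: le n1 n1'; taulia.
  have [rk lt2] := nc _ _ _ _ ik jk j'i jj' lt1 le1; split=> //.
  case: (tauP x (Z j k)) => [e2|e2|n2 n2']; case: (tauP x (Z j' k)) => [e3|e3|n3 n3'];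
    try lia.
  have j'r := hr _ _ rk e3; have jp := hp' _ _ jk e2; subst j j'.
  by move: lt1 le1; rewrite (hp i ji) e2; lia.
- by move=> j i jN; rewrite fr // tau_neq //; lia.
Qed.

End SpineFamilies.

Lemma card_disjointU (T : finType) (A B : {set T}) :
  (forall x, x \in A -> x \in B -> False) -> (#|A| + #|B|)%N = #|A :|: B|.
Proof.
move=> dAB; rewrite cardsU (_ : A :&: B = set0) ?cards0 ?subn0 //.
by apply/setP => x; rewrite !inE; apply/negbTE/negP => /andP[/dAB].
Qed.

(** * Rearrangements of a spine family and their inversions *)

Section Rearrangements.
Local Open Scope ring_scope.
Variables (l : nat) (v : 'I_l -> int).
Hypothesis hv : forall i j : 'I_l, (i <= j)%N -> v j <= v i.
Variables (N : int) (n : nat).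
Hypothesis vN : forall i, v i < N + n%:Z.
Implicit Types (T S : symbol v) (x y : int) (A B : {set 'I_l}) (Z b : int -> 'I_l -> int).

Definition spine_count b j x : nat := #|[set i : 'I_l | (j <= v i) && (b j i == x)]|.

(** Multiplicities are used instead of permutations: permutations that differ only on equal values
    give the same [b], and equality of counts passes directly to a lowered family. *)
Definition rearranges Z T b : Prop :=
  [/\ forall i j, j <= v i -> ent T i (b j i),
      forall i x, ent T i x -> exists2 j, j <= v i & b j i = x
    & forall j x, spine_count b j x = spine_count Z j x].

Definition spine_inv b j : nat :=
  #|[set p : 'I_l * 'I_l | [&& (p.1 < p.2)%N, j <= v p.2 & b j p.2 < b j p.1]]|.

Definition total_inv b : nat := (\sum_(d < n) spine_inv b (N + d%:Z)%R)%N.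

Lemma spine_countP b j x :
  reflect (exists2 i, j <= v i & b j i = x) (0 < spine_count b j x)%N.
Proof.
apply: (iffP card_gt0P) => [[i]|[i ji e]].
  by rewrite inE => /andP[ji /eqP e]; exists i.
by exists i; rewrite inE ji e eqxx.
Qed.

Lemma rearranges_val Z T b j i : rearranges Z T b -> j <= v i ->
  exists2 k, j <= v k & Z j k = b j i.
Proof.
move=> [_ _ R3] ji; apply/spine_countP; rewrite -R3.
by apply/spine_countP; exists i.
Qed.

Lemma total_inv_eq b b' : (forall j, spine_inv b j = spine_inv b' j) ->
  total_inv b = total_inv b'.
Proof. by move=> H; apply: eq_bigr => d _; rewrite H. Qed.

Lemma total_inv_change b b' p e : N <= p -> (exists i, p <= v i) ->
  (forall j, j != p -> spine_inv b j = spine_inv b' j) ->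
  spine_inv b p = (spine_inv b' p + e)%N ->
  total_inv b = (total_inv b' + e)%N.
Proof.
move=> Np [i pi] H He.
have pn : (`|(p - N)|%N < n)%N by have := vN i; lia.
pose d0 := Ordinal pn.
have pE : N + d0%:Z = p by rewrite /=; lia.
rewrite /total_inv (bigD1 d0) //= [in RHS](bigD1 d0) //= pE He.
rewrite addnAC; congr (_ + _ + _)%N; apply: eq_bigr => d dd0; rewrite H //.
by apply: contra dd0 => /eqP e'; apply/eqP/val_inj => /=; lia.
Qed.

Lemma merge_count x b j y : spine_count (fun j i => merge x (b j i)) j y =
  if y == x then (spine_count b j x + spine_count b j (x + 1))%N
  else if y == x + 1 then 0%N else spine_count b j y.
Proof.
rewrite /spine_count; case: eqP => [->|/eqP yx].
  rewrite card_disjointU => [|i]; last by rewrite !inE; lia.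
  apply: eq_card => i; rewrite !inE -andb_orr; congr andb.
  by case: mergeP; lia.
case: eqP => [->|/eqP yx1].
  apply/eqP; rewrite cards_eq0; apply/eqP/setP => i; rewrite !inE.
  by case: (j <= v i) => //=; case: mergeP; lia.
apply: eq_card => i; rewrite !inE; congr andb.
by case: mergeP; lia.
Qed.

Lemma tau_count x b j y :
  spine_count (fun j i => tau x (b j i)) j y = spine_count b j (tau x y).
Proof.
apply: eq_card => i; rewrite !inE; congr andb.
by apply/eqP/eqP => [<-|->]; rewrite tauK.
Qed.

Section Merge.
Variables (Z : int -> 'I_l -> int) (x p : int).
Hypothesis ZF : spine_family v N Z.
Hypothesis hp : forall j i, j <= v i -> Z j i = x \/ Z j i = x + 1 -> j = p.

Let mZ := fun j i => merge x (Z j i).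

Lemma rearranges_xp T b j i : rearranges Z T b -> j <= v i ->
  b j i = x \/ b j i = x + 1 -> j = p.
Proof. by move=> R ji; have [k jk <-] := rearranges_val R ji; exact: hp. Qed.

Lemma merge_DE T b i : rearranges Z T b ->
  (i \in Dset T x) = (p <= v i) && (b p i == x + 1).
Proof.
move=> R; have hb := rearranges_xp R; have [R1 R2 _] := R; rewrite inE.
apply/andP/andP => [[/R2[j ji e] _]|[pi /eqP e]].
  by have jp := hb j i ji (or_intror e); subst j; rewrite ji e.
have := R1 i p pi; rewrite e => ->; split=> //; apply/negP => /R2[j ji e'].
by have jp := hb j i ji (or_introl e'); move: e'; rewrite jp e; lia.
Qed.

Lemma merge_UE T b i : rearranges Z T b ->
  (i \in Uset T x) = (p <= v i) && (b p i == x).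
Proof.
move=> R; have hb := rearranges_xp R; have [R1 R2 _] := R; rewrite inE.
apply/andP/andP => [[/R2[j ji e] _]|[pi /eqP e]].
  by have jp := hb j i ji (or_introl e); subst j; rewrite ji e.
have := R1 i p pi; rewrite e => ->; split=> //; apply/negP => /R2[j ji e'].
by have jp := hb j i ji (or_intror e'); move: e'; rewrite jp e; lia.
Qed.

Lemma merge_cardD T b : rearranges Z T b -> #|Dset T x| = spine_count Z p (x + 1).
Proof.
move=> R; have [_ _ <-] := R; apply: eq_card => i.
by rewrite (merge_DE i R) inE.
Qed.

Lemma merge_rearranges T b : rearranges Z T b ->
  rearranges mZ (swapS x (Dset T x) T) (fun j i => merge x (b j i)).
Proof.
move=> R; have hb := rearranges_xp R; have [R1 R2 R3] := R; split.
- move=> i j ji; rewrite ent_swap (merge_DE i R); have := R1 i j ji.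
  case: ifP => [/andP[pi /eqP e]|].
    case: mergeP => [-> |n1]; first by rewrite tauL.
    rewrite tau_neq //; apply/eqP => e'.
    by have jp := hb j i ji (or_introl e'); move: e'; rewrite jp e; lia.
  case: mergeP => // e; have jp := hb j i ji (or_intror e).
  by rewrite jp in ji e; rewrite ji e eqxx.
- move=> i y; rewrite ent_swap; case: ifP => [iD|iD].
    move: (iD); rewrite inE => /andP[_ nx] /R2[j ji e]; exists j => //.
    rewrite e; case: (tauP x y) e => [->|->|y1 y2] e; first by rewrite /merge eqxx.
    + by move: nx; have := R1 i j ji; rewrite e => ->.
    + by rewrite /merge (negbTE y2).
  move=> /R2[j ji e]; exists j => //; rewrite e; case: mergeP => // e'.
  have jp := hb j i ji; rewrite e in jp; have {}jp := jp (or_intror e').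
  by move: iD; rewrite (merge_DE i R) -jp ji e e' eqxx.
- by move=> j y; rewrite !merge_count !R3.
Qed.

Lemma merge_no_x1 T b i : rearranges mZ T b -> ent T i (x + 1) = false.
Proof.
move=> [_ R2 R3]; apply/negP => /R2[j ji e].
have : (0 < spine_count b j (x + 1))%N by apply/spine_countP; exists i.
rewrite R3 merge_count; case: eqP; first by lia.
by rewrite eqxx.
Qed.

(** The inversions lost by merging are the pairs of rows with [x + 1] above [x] in the spine [p].
    The exponent counts the same pairs, because a row outside [Dset T x] contributes 1 if it has [x]
    without [x + 1], and 0 otherwise. *)
Lemma merge_inv_p T b : (exists i, p <= v i) -> N <= p -> rearranges Z T b -> exists2 e : nat,
  swap_exp T x (Dset T x) = e%:Z &
  total_inv b = (total_inv (fun j i => (merge x (b j i))) + e)%N.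
Proof.
move=> pv Np R; have hb := rearranges_xp R.
pose E := [set q : 'I_l * 'I_l | [&& (q.1 < q.2)%N, q.1 \in Dset T x & q.2 \in Uset T x]].
exists #|E|.
  have -> : #|E| = (\sum_(i in Dset T x) \sum_(k < l | (i < k)%N && (k \in Uset T x)) 1)%N.
    rewrite pair_big_dep /= -sum1dep_card; apply: eq_bigl => q; exact: andbCA.
  rewrite /swap_exp -natz natr_sum; apply: eq_bigr => i iD.
  rewrite natr_sum big_mkcond [RHS]big_mkcond /=; apply: eq_bigr => k _.
  case: (i < k)%N => //=; rewrite /ent_diff !inE.
  by case: (ent T k x); case: (ent T k (x + 1)).
apply: (@total_inv_change _ _ p) => //.
  move=> j jp; apply: eq_card => -[i k]; rewrite !inE /=; case: ltnP => //= ik.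
  case: (boolP (j <= v k)) => //= jk; have ji : j <= v i by rewrite (le_trans jk) // hv // ltnW.
  have h1 := hb j i ji; have h2 := hb j k jk.
  have n1 : b j i != x + 1 by apply: contra jp => /eqP e; apply/eqP; auto.
  have n2 : b j k != x + 1 by apply: contra jp => /eqP e; apply/eqP; auto.
  by rewrite /merge (negbTE n1) (negbTE n2).
rewrite /spine_inv card_disjointU => [|[i k]]; last first.
  rewrite in_set /= => /and3P[_ _ h].
  rewrite in_set /= (merge_DE i R) (merge_UE k R) => /and3P[_ /andP[_ /eqP e1] /andP[_ /eqP e2]].
  by move: h; rewrite e1 e2; do 2 case: mergeP; lia.
apply: eq_card => -[i k].
rewrite [in LHS]in_set in_setU [in X in X || _]in_set [in X in _ || X]in_set /=.
rewrite (merge_DE i R) (merge_UE k R); case: ltnP => //= ik.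
case: (boolP (p <= v k)) => //= pk; last by rewrite !andbF.
have -> : p <= v i by rewrite (le_trans pk) // hv // ltnW.
by case: (mergeP x (b p i)); case: (mergeP x (b p k)); lia.
Qed.

(** The entries to be restored to [x + 1] are those of spine [p] in the rows of [Dset T x]; the
    cardinality hypothesis gives both values their right multiplicities. *)
Lemma merge_rearranges_inv T b' : #|Dset T x| = spine_count Z p (x + 1) ->
  rearranges mZ (swapS x (Dset T x) T) b' -> exists b, rearranges Z T b.
Proof.
move=> cD R; have [R1 R2 R3] := R.
have nox1 j i : j <= v i -> b' j i != x + 1.
  by move=> ji; apply/eqP => e; have := R1 i j ji; rewrite e (merge_no_x1 i R).
have hb j i : j <= v i -> b' j i = x -> j = p.
  move=> ji e; have : (0 < spine_count b' j x)%N by apply/spine_countP; exists i.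
  rewrite R3 merge_count eqxx addn_gt0 => /orP[]/spine_countP[k jk e'];
  by apply: (hp jk); auto.
have bD i : i \in Dset T x -> p <= v i /\ b' p i = x.
  move=> iD; have : ent (swapS x (Dset T x) T) i x.
    by rewrite ent_swap iD tauL; move: iD; rewrite inE => /andP[].
  by move=> /R2[j ji e]; have jp := hb j i ji e; rewrite -jp.
exists (fun j i => if (j == p) && (i \in Dset T x) then x + 1 else b' j i); split.
- move=> i j ji; case: ifP => [/andP[_ iD]|]; first by move: iD; rewrite inE => /andP[].
  have := R1 i j ji; rewrite ent_swap; case: ifP => // iD.
  rewrite andbT => + /negbT jp; rewrite tau_neq ?nox1 //.
  by apply: contra jp => /eqP/(hb _ _ ji)/eqP.
- move=> i y Ty; case: (boolP (i \in Dset T x)) => iD; last first.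
    have : ent (swapS x (Dset T x) T) i y by rewrite ent_swap (negbTE iD).
    by move=> /R2[j ji e]; exists j; rewrite ?andbF.
  have [pi e] := bD i iD; move: (iD); rewrite inE => /andP[_ nx].
  have [->|yx1] := eqVneq y (x + 1); first by exists p; rewrite ?eqxx.
  have yx : y != x by apply: contraNneq nx => <-.
  have : ent (swapS x (Dset T x) T) i y by rewrite ent_swap iD tau_neq.
  move=> /R2[j ji e']; exists j => //; rewrite andbT ifN //; apply/eqP => jp.
  by move: yx; rewrite -e' jp e eqxx.
- move=> j y.
  have [->|jp] := eqVneq j p; last first.
    rewrite [LHS](_ : _ = spine_count b' j y); last first.
      by apply: eq_card => i; rewrite !inE (negbTE jp).
    have e0 z : z = x \/ z = x + 1 -> spine_count Z j z = 0%N.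
      move=> hz; apply/eqP; rewrite -leqn0 leqNgt; apply/spine_countP => -[i ji e].
      by move: jp; rewrite (hp ji) ?eqxx // e.
    rewrite R3 merge_count; case: eqP => [->|_]; first by rewrite !e0 //; auto.
    by case: eqP => [->|//]; rewrite e0 //; auto.
  rewrite /spine_count.
  have [->|yx1] := eqVneq y (x + 1).
    rewrite -[RHS]cD; apply: eq_card => i; rewrite in_set eqxx /=.
    case: (boolP (i \in Dset T x)) => iD; first by rewrite eqxx andbT; have [-> _] := bD i iD.
    by apply/negbTE/negP => /andP[pi]; apply/negP; exact: nox1.
  have := R3 p y; rewrite merge_count (negbTE yx1); case: eqP => [->|/eqP yx].
    rewrite -cD => e; apply/eqP; rewrite -(eqn_add2r #|Dset T x|); apply/eqP.
    rewrite -[RHS]e card_disjointU => [|i]; last first.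
      by rewrite in_set => + iD; rewrite iD eqxx /=; lia.
    apply: eq_card => i; rewrite in_setU in_set [in RHS]in_set eqxx /=.
    case: (boolP (i \in Dset T x)) => iD; last by rewrite orbF.
    by have [-> ->] := bD i iD; rewrite orbT eqxx.
  rewrite -/(spine_count Z p y) => <-; apply: eq_card => i; rewrite [in LHS]in_set [in RHS]in_set eqxx /=; case: (boolP (i \in Dset T x)) => // iD.
  by have [_ ->] := bD i iD; rewrite /= ![_ == y]eq_sym (negbTE yx1) (negbTE yx).
Qed.

End Merge.

Section Swap.
Variables (Z : int -> 'I_l -> int) (x p r : int).
Hypothesis ZF : spine_family v N Z.
Hypothesis pr : p != r.
Hypothesis hp : forall i, p <= v i -> Z p i = x + 1.
Hypothesis hrp : forall i : 'I_l, r <= v i -> p <= v i.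
Hypothesis hr : forall j i, j <= v i -> Z j i = x -> j = r.
Hypothesis pv : exists i, p <= v i.

Let tZ := fun j i => tau x (Z j i).

Lemma tau_rearranges Z0 T b A : rearranges Z0 T b ->
  (forall i, i \notin A -> ent T i x = ent T i (x + 1)) ->
  rearranges (fun j i => tau x (Z0 j i)) (swapS x A T) (fun j i => tau x (b j i)).
Proof.
move=> [R1 R2 R3] hA.
have hA' i y : i \notin A -> ent T i (tau x y) = ent T i y.
  by move=> iA; case: (tauP x y) => [->|->|//]; rewrite hA.
split.
- move=> i j ji; rewrite ent_swap tauK; case: ifP => iA; first exact: R1.
  by rewrite hA' ?iA //; exact: R1.
- move=> i y; rewrite ent_swap; case: ifP => iA.
    by move=> /R2[j ji e]; exists j; rewrite // e tauK.
  by rewrite -hA' ?iA // => /R2[j ji e]; exists j; rewrite // e tauK.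
- by move=> j y; rewrite !tau_count.
Qed.

Lemma swap_val_p j i : j <= v i -> Z j i = x + 1 -> j = p.
Proof.
by case: pv => i0 pi0 ji e; apply: (spine_disjoint hv ZF ji pi0); rewrite e hp.
Qed.

Lemma swap_ent_x1 T b i : rearranges Z T b -> ent T i (x + 1) = (p <= v i).
Proof.
move=> R; have [R1 R2 _] := R; apply/idP/idP => [/R2[j ji e]|pi].
  have [k jk e'] := rearranges_val R ji.
  by rewrite -(swap_val_p jk) // e' e.
have := R1 i p pi; have [k pk <-] := rearranges_val R pi.
by rewrite hp.
Qed.

Lemma swap_ent_x T b i : rearranges Z T b ->
  ent T i x = (r <= v i) && (b r i == x).
Proof.
move=> R; have [R1 R2 _] := R; apply/idP/andP => [/R2[j ji e]|[ri /eqP e]].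
  have [k jk e'] := rearranges_val R ji.
  by rewrite -(hr jk) ?e' // e ji.
by have := R1 i r ri; rewrite e.
Qed.

Lemma swap_both T b i : rearranges Z T b -> i \notin Dset T x ->
  ent T i x = ent T i (x + 1).
Proof.
move=> R; rewrite inE (swap_ent_x1 i R) (swap_ent_x i R) => h.
apply/idP/idP => [/andP[/hrp//]|pi].
by move: h; rewrite pi /= negbK.
Qed.

(** Every row met by [p] contains [x + 1], and those that also contain [x] are the ones where [r]
    has this value. Their number is fixed by the multiplicity of [x] in [r], so it is the same for
    all rearrangements. *)
Lemma swap_cardD T b : rearranges Z T b ->
  #|Dset T x| = (#|[set i : 'I_l | (p <= v i)%R]| - spine_count Z r x)%N.
Proof.
move=> R; have [_ _ <-] := R; rewrite -cardsDS; last first.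
  by apply/subsetP => i; rewrite !inE => /andP[/hrp].
by apply: eq_card => i; rewrite !inE (swap_ent_x1 i R) (swap_ent_x i R) andbC.
Qed.

Lemma swap_rearranges T b : rearranges Z T b ->
  rearranges tZ (swapS x (Dset T x) T) (fun j i => tau x (b j i)).
Proof. by move=> R; apply: tau_rearranges => // i; exact: swap_both R. Qed.

Lemma swap_exp0 T b : rearranges Z T b -> swap_exp T x (Dset T x) = 0.
Proof.
move=> R; apply: big1 => j _; apply: big1 => k /andP[_ kD].
by rewrite /ent_diff (swap_both R kD) subrr.
Qed.

(** No spine has both values [x] and [x + 1], so exchanging these neighbours preserves all
    comparisons inside a spine. *)
Lemma swap_total_inv T b : rearranges Z T b ->
  total_inv (fun j i => tau x (b j i)) = total_inv b.
Proof.
move=> R; apply: total_inv_eq => j; apply: eq_card => -[i k].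
rewrite !inE /=; case: ltnP => //= ik; case: (boolP (j <= v k)) => //= jk.
have ji : j <= v i by rewrite (le_trans jk) // hv // ltnW.
have [i' ji' ei] := rearranges_val R ji; have [k' jk' ek] := rearranges_val R jk.
have no i1 k1 : j <= v i1 -> j <= v k1 -> Z j i1 = x -> Z j k1 = x + 1 -> False.
  move=> ji1 jk1 e1 e2; move: pr.
  by rewrite -(hr ji1 e1) -(swap_val_p jk1 e2) eqxx.
rewrite -ei -ek; have := no _ _ ji' jk'; have := no _ _ jk' ji'.
case: (tauP x (Z j i')); case: (tauP x (Z j k')) => //; try lia.
all: by move=> e1 e2 h1 h2; exfalso; auto.
Qed.

Lemma swap_no_D T b : rearranges tZ T b -> Dset T x = set0.
Proof.
move=> R; apply/setP => i; rewrite in_set0 inE; apply/negbTE/negP => /andP[].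
have [R1 R2 R3] := R; move=> /R2[j ji e] /negP; apply.
have [k jk] := rearranges_val R ji; rewrite e /tZ => e'.
have {}e' : Z j k = x by rewrite -[LHS](tauK x) e' tauR.
have jr := hr jk e'; have pi : p <= v i by apply: hrp; rewrite -jr.
have [k' pk' e2] := rearranges_val R pi.
by have := R1 i p pi; rewrite -e2 /tZ hp // tauR.
Qed.

(** The rows of [T'] having [x] without [x + 1] include [Dset T x], and the cardinality makes the
    two sets equal. Hence all other rows contain both values or neither, and undoing the exchange on
    the spines amounts to undoing it in the rows of [Dset T x]. *)
Lemma swap_rearranges_inv T b' :
  #|Dset T x| = (#|[set i : 'I_l | (p <= v i)%R]| - spine_count Z r x)%N ->
  rearranges tZ (swapS x (Dset T x) T) b' -> exists b, rearranges Z T b.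
Proof.
move=> cD R; set T' := swapS x (Dset T x) T in R *.
have [R1 R2 R3] := R.
have TE : T = swapS x (Dset T x) T' by rewrite swapSK.
have cU : #|Uset T' x| = #|Dset T x|.
  rewrite cD -[spine_count Z r x](_ : spine_count b' r (x + 1) = _); last first.
    by rewrite R3 tau_count tauR.
  rewrite -cardsDS; last by apply/subsetP => i; rewrite !inE => /andP[/hrp].
  apply: eq_card => i; rewrite in_setD in_set [in LHS]andbC ![in RHS]in_set. congr (~~ _ && _).
     apply/idP/andP => [/R2[j ji e]|[ri /eqP <-]]; last exact: R1.
    have [k jk] := rearranges_val R ji; rewrite e /tZ => e'.
    have {}e' : Z j k = x by rewrite -[LHS](tauK x) e' tauR.
    by rewrite -(hr jk e') ji e.
  apply/idP/idP => [/R2[j ji e]|pi].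
    have [k jk] := rearranges_val R ji; rewrite e /tZ => e'.
    have {}e' : Z j k = x + 1 by rewrite -[LHS](tauK x) e' tauL.
    by rewrite -(swap_val_p jk e').
  have [k pk e] := rearranges_val R pi; have := R1 i p pi.
  by rewrite -e /tZ hp // tauR.
have U0 : Uset T x = set0.
  have sDU : Dset T x \subset Uset T' x.
    by apply/subsetP => i iD; rewrite in_Uswap iD.
  have /eqP E : Dset T x == Uset T' x by rewrite eqEcard sDU cU leqnn.
  apply/setP => i; rewrite in_set0; apply/negbTE/negP => iU.
  have : i \in Uset T' x.
    rewrite in_Uswap iU; case: ifP => // iD.
  by rewrite -E; move: iU; rewrite !inE => /andP[-> /negbTE ->].
exists (fun j i => tau x (b' j i)); rewrite TE.
have := @tau_rearranges tZ T' b' (Dset T x) R; rewrite [X in rearranges X](_ : _ = Z); last first.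
  by apply: funext => j; apply: funext => i; rewrite /tZ tauK.
apply=> i iD; rewrite !ent_swap (negbTE iD).
move: (in_set0 i) iD; rewrite -U0 !inE.
by case: (ent T i x); case: (ent T i (x + 1)).
Qed.

End Swap.

End Rearrangements.

(** * Existence of a column that can be lowered *)

Section GoodLowerings.
Local Open Scope ring_scope.
Variables (l : nat) (v : 'I_l -> int).
Hypothesis hv : forall i j : 'I_l, (i <= j)%N -> v j <= v i.
Variables (N : int) (Z : int -> 'I_l -> int).
Hypothesis ZF : spine_family v N Z.

Definition has_value (i : 'I_l) (x : int) : Prop := exists2 j, j <= v i & Z j i = x.

Definition merge_case (x p : int) : Prop :=
  (exists i, p <= v i) /\
  forall j i, j <= v i -> Z j i = x \/ Z j i = x + 1 -> j = p.

Definition swap_case (x p r : int) : Prop :=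
  [/\ p != r, forall i, p <= v i -> Z p i = x + 1,
      forall i : 'I_l, r <= v i -> p <= v i,
      forall j i, j <= v i -> Z j i = x -> j = r
    & exists i, p <= v i].

(* Lowering x + 1 to x identifies two values of the spine p in the first case. In
   the second case it exchanges the values x + 1 of p and x of r, which changes no
   inversion within a spine. *)
Definition good_lowering (x : int) : Prop :=
  (exists2 i, has_value i (x + 1) & ~ has_value i x) /\
  ((exists p, merge_case x p) \/ exists p r, swap_case x p r).

Lemma value_disjoint j j' i i' x : j <= v i -> j' <= v i' ->
  Z j i = x -> Z j' i' = x -> j = j'.
Proof. by move=> ji ji' <- /esym; apply: (spine_disjoint hv ZF). Qed.

Section MinimalArc.
Variables (p : int) (i0 k0 : 'I_l).
Hypothesis ik0 : k0 = i0.+1 :> nat.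
Hypothesis pk0 : p <= v k0.
Hypothesis arc0 : Z p i0 < Z p k0.
Hypothesis arc_min : forall j (i k : 'I_l), k = i.+1 :> nat -> j <= v k ->
  Z j i < Z j k -> Z p k0 - Z p i0 <= Z j k - Z j i.

Let mono j (i k : 'I_l) : (i <= k)%N -> j <= v k -> Z j i <= Z j k.
Proof. by case: ZF => H _ _ _; exact: H. Qed.

Let nc j j' (i k : 'I_l) : (i < k)%N -> j <= v k -> j' <= v i -> j != j' ->
  Z j i < Z j' i -> Z j' i <= Z j k -> j' <= v k /\ Z j' k < Z j k.
Proof. by case: ZF => _ _ H _; exact: H. Qed.

(** If the two values differ, some step between consecutive rows is nonzero, hence at least as high
    as the minimal one. *)
Lemma arc_gap j (i k : 'I_l) : (i <= k)%N -> j <= v k ->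
  Z j i = Z j k \/ Z j i + (Z p k0 - Z p i0) <= Z j k.
Proof.
case: k => k kl; elim: k kl => [|k IH] kl ik jk.
  by left; congr Z; apply: val_inj => /=; move: ik; rewrite leqn0 => /eqP.
have [ik'|ik'] := leqP i k; last first.
  by left; congr Z; apply: val_inj => /=; apply/eqP; rewrite eqn_leq ik.
have kl' : (k < l)%N by apply: ltnW.
pose k' := Ordinal kl'; have jk' : j <= v k' by rewrite (le_trans jk) // hv /=.
have := IH kl' ik' jk'; rewrite -/k'; set K := Ordinal kl in jk *.
have := @mono j k' K (leqnSn _) jk; have := @arc_min j k' K erefl jk.
have := arc0; lia.
Qed.

(** Non-crossing traps the spine [j] inside the arc in the rows [i0] and [k0]. A climb of [j] would
    be at least as high as the arc, so it would carry [j] across [p]. For the same reason [p] cannot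
    go on to rows that [j] does not reach. *)
Lemma inside_arc j (i1 : 'I_l) y : j <= v i1 -> Z j i1 = y -> Z p i0 < y -> y < Z p k0 ->
  [/\ p != j, forall i, j <= v i -> Z j i = y & forall i : 'I_l, p <= v i -> j <= v i].
Proof.
move=> ji1 e1 ay yb.
have ik : (i0 < k0)%N by rewrite ik0.
have pi0 : p <= v i0 := le_trans pk0 (hv (ltnW ik)).
have jp : j != p.
  apply/eqP => jp; move: ji1 e1; rewrite jp => pi1 e1.
  have [le|lt] := leqP i1 i0; first by have := mono le pi0; lia.
  have le : (k0 <= i1)%N by rewrite ik0.
  by have := mono le pi1; lia.
have pj : p != j by rewrite eq_sym.
have [jk0 [ei0 ek0]] : j <= v k0 /\ Z j i0 = y /\ Z j k0 = y.
  have [le|lt] := leqP i1 i0.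
    have lt : (i1 < k0)%N by rewrite ik0.
    have h1 := mono le pi0.
    have [jk0 h2] : j <= v k0 /\ Z j k0 < Z p k0 by apply: (@nc p j i1 k0) => //; lia.
    have ek : Z j k0 = y by have := arc_gap (ltnW lt) jk0; have := mono (ltnW lt) jk0; lia.
    split=> //; split=> //.
    have ji0 : j <= v i0 := le_trans jk0 (hv (ltnW ik)).
    by have := mono le ji0; have := mono (ltnW ik) jk0; lia.
  have le : (k0 <= i1)%N by rewrite ik0.
  have jk0 : j <= v k0 := le_trans ji1 (hv le).
  have ji0 : j <= v i0 := le_trans jk0 (hv (ltnW ik)).
  split=> //.
  have ek : Z j k0 = y.
    have [|h] := arc_gap le ji1; first by lia.
    have h2 := mono (ltnW ik) jk0.
    have [pi1 h3] : p <= v i1 /\ Z p i1 < Z j i1 by apply: (@nc j p i0 i1) => //; lia.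
    by have := mono le pi1; lia.
  split=> //.
  have [|h] := arc_gap (ltnW ik) jk0; first by lia.
  have [_ h3] : p <= v k0 /\ Z p k0 < Z j k0 by apply: (@nc j p i0 k0) => //; lia.
  by lia.
have ji0 : j <= v i0 := le_trans jk0 (hv (ltnW ik)).
split=> //.
- move=> i ji; have [le|lt] := leqP i i0.
    have [le'|lt'] := leqP i0 i.
      by have -> : i = i0 by apply: val_inj => /=; apply/eqP; rewrite eqn_leq le.
    have [|h] := arc_gap le ji0; first by lia.
    have pi := le_trans pi0 (hv le).
    have h1 := mono le pi0.
    have [lt1|lt1|e] := ltgtP (Z j i) (Z p i).
    + have [_ h3] : p <= v k0 /\ Z p k0 < Z j k0.
        by apply: (@nc j p i k0) => //; rewrite ?ik0 //; lia.
      by lia.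
    + have [_ h3] : j <= v i0 /\ Z j i0 < Z p i0 by apply: (@nc p j i i0) => //; lia.
      by lia.
    + by move: jp; rewrite (spine_disjoint hv ZF ji pi e) eqxx.
  have le : (k0 <= i)%N by rewrite ik0.
  have [|h] := arc_gap le ji; first by lia.
  have [ki|ki] := eqVneq k0 i; first by rewrite -ki.
  have ltk : (k0 < i)%N by rewrite ltn_neqAle le andbT; exact: ki.
  have [pi h2] : p <= v i /\ Z p i < Z j i by apply: (@nc j p k0 i) => //; lia.
  have h3 := mono le pi.
  have [_ h4] : j <= v i /\ Z j i < Z p i by apply: (@nc p j i0 i) => //; lia.
  by lia.
- move=> i pi; have [le|lt] := leqP i i0; first exact: le_trans ji0 (hv le).
  have le : (k0 <= i)%N by rewrite ik0.
  have h3 := mono le pi.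
  by have [//] : j <= v i /\ Z j i < Z p i by apply: (@nc p j i0 i) => //; lia.
Qed.

Lemma min_arc_good : exists x, good_lowering x.
Proof.
have ik : (i0 < k0)%N by rewrite ik0.
have pi0 : p <= v i0 := le_trans pk0 (hv (ltnW ik)).
pose P (m : nat) := `[< exists i, has_value i (Z p i0 + 1 + m%:Z) >].
have exP : exists m, P m.
  exists (absz (Z p k0 - Z p i0 - 1)%R); apply/asboolP; exists k0, p => //.
  by have := arc0; lia.
case: (ex_minnP exP) => m /asboolP[i [j ji e]] mmin.
(* For positive [m] the column just before the first occupied one is empty in all rows, so [x + 1]
   meets a single spine and may be merged down. *)
have [hm|hm] := posnP m; last first.
  exists (Z p i0 + m%:Z); split.
    exists i; first by exists j => //; rewrite e; lia.
    move=> [j' ji' e']; suff : (m <= m.-1)%N by lia.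
    by apply: mmin; apply/asboolP; exists i, j' => //; lia.
  left; exists j; split; first by exists i.
  move=> j' i' ji' [e'|e'].
    suff : (m <= m.-1)%N by lia.
    by apply: mmin; apply/asboolP; exists i', j' => //; lia.
  by apply: (value_disjoint ji' ji e'); rewrite e; lia.
(* The column next to the start of the arc is occupied. Either it is the end of the arc, and two
   values of [p] merge, or it lies inside the arc and belongs to a constant spine, which is
   exchanged with the value of [p]. *)
have eb : Z p i0 + 1 = Z p k0 \/ Z p i0 + 1 < Z p k0 by have := arc0; lia.
have k0a : ~ has_value k0 (Z p i0).
  move=> [j' jk e']; have jp := value_disjoint jk pi0 e' erefl.
  by move: e' arc0; rewrite jp => ->; rewrite ltxx.
exists (Z p i0); case: eb => eb; split.
- by exists k0 => //; exists p.
- left; exists p; split; first by exists i0.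
  by move=> j' i' ji' [e'|e']; [apply: (value_disjoint ji' pi0 e')|apply: (value_disjoint ji' pk0 e')].
- have [pj hj hpj] := inside_arc ji (y := Z p i0 + 1) ltac:(lia) ltac:(lia) eb.
  exists k0 => //; exists j; first exact: hpj.
  by apply: hj; exact: hpj.
- have [pj hj hpj] := inside_arc ji (y := Z p i0 + 1) ltac:(lia) ltac:(lia) eb.
  right; exists j, p; split=> //; first by rewrite eq_sym.
    by move=> j' i' ji' e'; apply: (value_disjoint ji' pi0 e').
  by exists i.
Qed.

End MinimalArc.

Definition constant_family : Prop := forall j (i k : 'I_l), j <= v i -> j <= v k -> Z j i = Z j k.

Lemma nonconstant_good : ~ constant_family -> exists x, good_lowering x.
Proof.
move=> nC.
pose P (m : nat) := `[< exists j (i k : 'I_l),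
  [/\ k = i.+1 :> nat, j <= v k, Z j i < Z j k & Z j k - Z j i = m%:Z] >].
case: (pselect (exists m, P m)) => [exP|nP]; last first.
  exfalso; apply: nC.
  have H j (i : 'I_l) k : forall kl : (k < l)%N, (i <= k)%N -> j <= v (Ordinal kl) ->
      Z j i = Z j (Ordinal kl).
    elim: k => [|k IH] kl ik jk.
      by congr Z; apply: val_inj => /=; move: ik; rewrite leqn0 => /eqP.
    have [ik'|ik'] := leqP i k; last first.
      by congr Z; apply: val_inj => /=; apply/eqP; rewrite eqn_leq ik.
    have kl' : (k < l)%N by apply: ltnW.
    have jk' : j <= v (Ordinal kl') by rewrite (le_trans jk) // hv /=.
    rewrite (IH kl' ik' jk'); case: ZF => mono _ _ _.
    have := mono j (Ordinal kl') (Ordinal kl) (leqnSn _) jk.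
    rewrite le_eqVlt => /orP[/eqP//|lt]; case: nP.
    exists (absz (Z j (Ordinal kl) - Z j (Ordinal kl'))%R); apply/asboolP.
    by exists j, (Ordinal kl'), (Ordinal kl); split=> //; lia.
  move=> j i k ji jk; have [ik|ki] := leqP i k.
    by case: k jk ik => k kl jk ik; exact: H.
  by case: i ji ki => i il ji /ltnW ki; apply/esym; exact: H.
case: (ex_minnP exP) => m /asboolP[p [i0 [k0 [ik pk lt e]]]] mmin.
apply: (@min_arc_good p i0 k0) => // j i k ki jk ltj.
have : (m <= absz (Z j k - Z j i)%R)%N.
  by apply: mmin; apply/asboolP; exists j, i, k; split=> //; lia.
lia.
Qed.

(** A constant spine through column [x] must end above row [i], which lacks [x]; so it is shorter
    than the spine through [x + 1], as the swap case requires. *)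
Lemma constant_good i x : constant_family -> has_value i (x + 1) -> ~ has_value i x ->
  good_lowering x.
Proof.
move=> C [p pi ep] nx; split; first by exists i => //; exists p.
case: (pselect (exists i', has_value i' x)) => [[i' [r ri er]]|nox].
  right; exists p, r; split.
  - by apply/eqP => pr; move: nx; apply; exists p => //; rewrite pr -(C _ i') // -pr.
  - by move=> k pk; rewrite -ep; exact: C.
  - move=> k rk; have [ik|/ltnW ki] := leqP i k; last exact: le_trans pi (hv ki).
    case: nx; exists r; first exact: le_trans rk (hv ik).
    by rewrite -er; apply: C => //; exact: le_trans rk (hv ik).
  - by move=> j k jk e; apply: (value_disjoint jk ri e).
  - by exists i.
left; exists p; split; first by exists i.
move=> j k jk [e|e]; first by case: nox; exists k, j.
exact: (value_disjoint jk pi e).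
Qed.

End GoodLowerings.

(** * Finite windows and induction by lowering *)

Section Windows.
Local Open Scope ring_scope.
Variables (l : nat) (v : 'I_l -> int) (N : int) (n : nat).
Implicit Types (T S : symbol v) (x y : int) (A B : {set 'I_l}).

Definition windowed T : Prop :=
  (forall i y, y < N -> ent T i y) /\ (forall i y, N + n%:Z <= y -> ~~ ent T i y).

Definition weight_sum (w : 'I_l -> nat -> nat) T : nat :=
  (\sum_(i < l) \sum_(d < n) w i d * ent T i (N + d%:Z)%R)%N.

Lemma Dset_window T x i : windowed T -> i \in Dset T x -> N <= x /\ x + 1 < N + n%:Z.
Proof.
move=> [w1 w2]; rewrite inE => /andP[e1 e2]; split.
  by rewrite leNgt; apply: contra e2 => xN; exact: w1.
by rewrite ltNge; apply: contraL e1 => xN; exact: w2.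
Qed.

Lemma windowed_swap T x A : windowed T -> N <= x -> x + 1 < N + n%:Z ->
  windowed (swapS x A T).
Proof.
move=> [w1 w2] Nx xn; split=> i y yN; rewrite ent_swap; case: ifP => _; rewrite ?tau_neq;
  by [exact: w1|exact: w2|lia].
Qed.

Lemma weight_sum_swap w T d A : (d.+1 < n)%N -> A \subset Dset T (N + d%:Z) ->
  (weight_sum w T + \sum_(i in A) w i d =
   weight_sum w (swapS (N + d%:Z)%R A T) + \sum_(i in A) w i d.+1)%N.
Proof.
move=> dn sA; rewrite /weight_sum [X in (_ + X)%N = _]big_mkcond [X in _ = (_ + X)%N]big_mkcond -!big_split /=.
apply: eq_bigr => i _; case: ifP => iA; last first.
  by congr (_ + _)%N; apply: eq_bigr => e _; rewrite ent_swap iA.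
have dn' : (d < n)%N by apply: ltnW.
rewrite (bigD1 (Ordinal dn')) // (bigD1 (Ordinal dn)) /=; last first.
  by rewrite -val_eqE /= gtn_eqF.
rewrite [in RHS](bigD1 (Ordinal dn')) // [in RHS](bigD1 (Ordinal dn)) /=; last first.
  by rewrite -val_eqE /= gtn_eqF.
rewrite !ent_swap iA /= (_ : N + d.+1%:Z = N + d%:Z + 1); last by lia.
rewrite tauL tauR; move: (subsetP sA i iA); rewrite inE => /andP[-> /negbTE ->].
set s1 := (\sum_(_ < _ | _) _)%N; set s2 := (\sum_(_ < _ | _) _)%N.
suff -> : s1 = s2 by lia.
apply: eq_bigr => e; rewrite -!val_eqE /= => /andP[e1 e2].
by rewrite ent_swap iA tau_neq //; lia.
Qed.

(** Lowering stays in the window and decreases the sum of the column positions of the entries. *)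
Lemma lowering_ind (P : symbol v -> Prop) :
  (forall T, windowed T ->
     (forall x, Dset T x != set0 -> P (swapS x (Dset T x) T)) -> P T) ->
  forall T, windowed T -> P T.
Proof.
move=> H T; have [m] : exists m, (weight_sum (fun _ d => d) T < m)%N by eexists; exact: ltnSn.
elim: m T => // m IH T Tm wT; apply: (H) => // x /set0Pn[i iD].
have [Nx xn] := Dset_window wT iD.
have dn : ((absz (x - N)%R).+1 < n)%N by lia.
have xE : x = N + (absz (x - N)%R)%:Z by lia.
apply: IH; last exact: windowed_swap.
have sA : Dset T x \subset Dset T (N + (absz (x - N)%R)%:Z) by rewrite -xE.
have := weight_sum_swap (fun _ d => d) dn sA; rewrite -xE.
have : (\sum_(i in Dset T x) (absz (x - N)%R) < \sum_(i in Dset T x) (absz (x - N)%R).+1)%N.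
  rewrite !sum_nat_const ltn_pmul2l //.
  by apply/card_gt0P; exists i.
lia.
Qed.


End Windows.

(** * The sum over rearrangements as a monomial *)

Section Monomials.
Local Open Scope ring_scope.
Variables (l : nat) (v : 'I_l -> int).
Hypothesis hv : forall i j : 'I_l, (i <= j)%N -> v j <= v i.
Variables (N : int) (n : nat).
Hypothesis Nv : forall i, N <= v i.
Hypothesis vN : forall i, v i < N + n%:Z.
Implicit Types (T S : symbol v) (x y : int) (A B : {set 'I_l}) (Z b : int -> 'I_l -> int).

(** Quantifying over every [b] spares the choice of a rearrangement for each symbol. *)
Definition spine_coefs Z (G : fock v) : Prop := forall T,
  (forall b, rearranges Z T b -> G@_T = q ^+ total_inv v N n b) /\
  ((forall b, ~ rearranges Z T b) -> G@_T = 0).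

(** Lowering only some rows of [Dset T x] leaves a row with [x + 1] and without [x], and [u]
    vanishes on such symbols. *)
Lemma mcoeff_Fdiv_full x a (u : fock v) T :
  (forall T', Dset T' x != set0 -> u@_T' = 0) ->
  (Fdiv x a u)@_T = if #|Dset T x| == a
    then q ^ swap_exp T x (Dset T x) * u@_(swapS x (Dset T x) T) else 0.
Proof.
move=> u0; rewrite mcoeff_Fdiv.
have E A : A \subset Dset T x -> A != Dset T x ->
    q ^ swap_exp T x A * u@_(swapS x A T) = 0.
  move=> sA nA; rewrite u0 ?mulr0 //.
  have : A \proper Dset T x by rewrite properEneq nA sA.
  case/properP => _ [i iD iA]; apply/set0Pn; exists i.
  by rewrite in_Dswap (negbTE iA).
case: eqP => [ca|ca].
  rewrite (bigD1 (Dset T x)) /=; last by rewrite subxx ca eqxx.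
  by rewrite big1 ?addr0 // => A /andP[/andP[sA _] nA]; apply: E.
apply: big1 => A /andP[sA /eqP cA]; apply: E => //.
by apply/eqP => e; apply: ca; rewrite -e.
Qed.

Lemma spine_coefs_step x a Z Z' (G : fock v) :
  (forall T b, rearranges Z' T b -> Dset T x = set0) ->
  (forall T b, rearranges Z T b -> #|Dset T x| = a /\
     exists2 b', rearranges Z' (swapS x (Dset T x) T) b' &
     exists2 e : nat, swap_exp T x (Dset T x) = e%:Z &
                      total_inv v N n b = (total_inv v N n b' + e)%N) ->
  (forall T b', #|Dset T x| = a -> rearranges Z' (swapS x (Dset T x) T) b' ->
     exists b, rearranges Z T b) ->
  spine_coefs Z' G -> spine_coefs Z (Fdiv x a G).
Proof.
move=> H1 H2 H3 HG T.
have G0 T' : Dset T' x != set0 -> G@_T' = 0.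
  move=> D0; apply (HG T').2 => b R.
  by move: D0; rewrite (H1 _ _ R) eqxx.
split.
  move=> b R; have [ca [b' R' [e eE iE]]] := H2 T b R.
  by rewrite mcoeff_Fdiv_full // ca eqxx ((HG _).1 b' R') eE iE addnC exprD.
move=> nR; rewrite mcoeff_Fdiv_full //; case: eqP => // ca.
rewrite ((HG _).2) ?mulr0 // => b' R'; have [b R] := H3 _ _ ca R'.
exact: nR R.
Qed.

(** Each row is closed under predecessors, hence has no gap. *)
Lemma no_lowering_empty T : (forall x, Dset T x = set0) -> T = empty_symbol v.
Proof.
move=> D0; apply: functional_extensionality_dep => i.
have cl x : row_set (T i) (x + 1) -> row_set (T i) x.
  move=> /(entP T i) e; apply/entP; apply: contraT => e'.
  by have := in_set0 i; rewrite -(D0 x) inE e e'.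
apply: row_set_inj => x.
suff E j : j <= v i -> T i j = j.
  by split=> -[j js]; [rewrite E // => <-; exists j => //=; rewrite js
                      |rewrite /= js => <-; exists j => //; rewrite E].
case: (rowP (T i)) => _ [N0 h0] _.
elim/(@row_ind N0): j => [j jN _|j IH js]; first exact: h0.
have j1s : j - 1 <= v i by lia.
have lt := row_lt (T i) (_ : j - 1 < j) js.
have [m ms em] : row_set (T i) (T i j - 1).
  by apply: cl; exists j => //; rewrite subrK.
have mj : m < j by rewrite -(row_ltE (T i)) // em; lia.
have [mj1|] := eqVneq m (j - 1).
  by move: em; rewrite mj1 IH; lia.
move=> mj1; have : T i m < T i (j - 1) by apply: row_lt => //; lia.
have : j - 1 < j by lia.
by move=> /lt; lia.
Qed.

Lemma spine_coefs_empty Z T : spine_family v N Z -> rearranges Z T Z ->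
  (forall x, Dset T x = set0) -> spine_coefs Z (basis_vector (empty_symbol v)).
Proof.
move=> ZF R D0; rewrite -(no_lowering_empty D0) => T'.
have C : constant_family v Z.
  apply: contrapT => /(nonconstant_good hv ZF)[x [[i [j ji e] nx] _]].
  have [R1 R2 _] := R.
  have : i \in Dset T x.
    rewrite inE -e (R1 i j ji); apply/negP => /R2[j' ji' e'].
    by apply: nx; exists j'.
  by rewrite D0 inE.
have Cb T1 b i j : rearranges Z T1 b -> j <= v i -> b j i = Z j i.
  by move=> R' ji; have [k jk <-] := rearranges_val R' ji; apply: C.
split.
  move=> b R'; rewrite (_ : T' = T); last first.
    apply: ent_inj => i x; have [R1 R2 _] := R; have [R1' R2' _] := R'.
    apply/idP/idP => [/R2'[j ji <-]|/R2[j ji <-]].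
      by rewrite (Cb _ _ _ _ R' ji); exact: R1.
    by rewrite -(Cb _ _ _ _ R' ji); exact: R1'.
  rewrite mcoeffUU (_ : total_inv v N n b = 0%N) ?expr0 //.
  apply: big1 => d _; apply/eqP; rewrite cards_eq0; apply/eqP/setP => -[i k].
  rewrite !inE /=; apply/negbTE/negP => /and3P[ik jk].
  have ji : N + d%:Z <= v i by rewrite (le_trans jk) // hv // ltnW.
  by rewrite (Cb _ _ _ _ R' jk) (Cb _ _ _ _ R' ji) (C _ i k) // ltxx.
move=> nR; rewrite mcoeffU; case: eqP => [e|//]; case: (nR Z); by rewrite -e.
Qed.

Lemma has_valueE Z T i x : rearranges Z T Z -> ent T i x <-> has_value v Z i x.
Proof.
move=> [R1 R2 _]; split=> [/R2//|[j ji <-]]; exact: R1.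
Qed.

(** The clause on the first letter makes consecutive letters differ: once [x] has been lowered, no
    row can be lowered at [x] again. *)
Lemma spine_monomial T : windowed N n T -> forall Z, spine_family v N Z -> rearranges Z T Z ->
  exists w : seq (int * nat),
    [/\ sorted (fun p r => p.1 != r.1) w,
        forall p w', w = p :: w' -> Dset T p.1 != set0
      & spine_coefs Z (Fdiv_word v w)].
Proof.
move: T; apply: lowering_ind => T wT IH Z ZF R.
case: (pselect (forall x, Dset T x = set0)) => [D0|].
  by exists [::]; split=> //; exact: (spine_coefs_empty ZF R D0).
move=> /existsNP[x0 /eqP/set0Pn[i0 iD0]].
have [x [[i hx1 nhx] cs]] : exists x, good_lowering v Z x.
  case: (pselect (constant_family v Z)) => [C|]; last exact: (nonconstant_good hv ZF).
  exists x0; move: iD0; rewrite inE => /andP[/(has_valueE _ _ R) h1 /negP h2].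
  by apply: (constant_good hv ZF C h1) => /(has_valueE _ _ R).
have iD : i \in Dset T x.
  by rewrite inE; apply/andP; split; [apply/(has_valueE _ _ R)|apply/negP => /(has_valueE _ _ R)].
have D0 : Dset T x != set0 by apply/set0Pn; exists i.
have [Nx xn] := Dset_window wT iD.
suff [Z' [ZF' R' step]] : exists Z', [/\ spine_family v N Z',
    rearranges Z' (swapS x (Dset T x) T) Z' &
    forall G, spine_coefs Z' G -> spine_coefs Z (Fdiv x #|Dset T x| G)].
  have [w [w1 w2 w3]] := IH x D0 Z' ZF' R'.
  exists ((x, #|Dset T x|) :: w); split; last exact: step.
    case: w w1 w2 {w3} => //= p w -> /(_ p w erefl) h; rewrite andbT.
    apply: contra h => /eqP <- ; apply/eqP/setP => k; rewrite in_Dswap in_set0.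
    by case: ifP => //; rewrite !inE => /andP[-> /negbTE ->].
  by move=> p w' [<- _].
case: cs => [[p [[i1 pi1] hp]]|[p [r [pr hp hrp hr pv]]]].
  have pv : exists i, p <= v i by exists i1.
  (* A spine of index less than [N] is constant at its index, which is smaller than [x]; so [p] is
     among the spines counted by [total_inv]. *)
  have Np : N <= p.
    have [_ _ _ fr] := ZF; rewrite leNgt; apply/negP => pN.
    case: hx1 => j ji e; have jp := hp j i ji (or_intror e).
    by move: e; rewrite jp fr //; lia.
  exists (fun j i => merge x (Z j i)); split.
  - exact: (merge_family hv ZF Nx hp).
  - exact: (merge_rearranges hp R).
  move=> G; apply: spine_coefs_step => [T' b R'|T' b R'|T' b cD R'].
  - apply/setP => k; rewrite in_set0 inE.
    by rewrite (merge_no_x1 _ R').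
  - split; first by rewrite (merge_cardD hp R') (merge_cardD hp R).
    exists (fun j i => merge x (b j i)); first exact: (merge_rearranges hp R').
    exact: (merge_inv_p hv vN hp pv Np R').
  - rewrite (merge_cardD hp R) in cD.
    exact: (merge_rearranges_inv hp cD R').
exists (fun j i => tau x (Z j i)); split.
- exact: (tau_family hv ZF Nx pr hp hrp hr pv).
- exact: (swap_rearranges hv ZF hp hrp hr pv R).
move=> G; apply: spine_coefs_step => [T' b R'|T' b R'|T' b cD R'].
- exact: (swap_no_D hp hrp hr R').
- split; first by rewrite (swap_cardD hv ZF hp hrp hr pv R') (swap_cardD hv ZF hp hrp hr pv R).
  exists (fun j i => tau x (b j i)); first exact: (swap_rearranges hv ZF hp hrp hr pv R').
  exists 0%N; first exact: (swap_exp0 hv ZF hp hrp hr pv R').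
  by rewrite addn0 (swap_total_inv hv n ZF pr hp hr pv R').
- rewrite (swap_cardD hv ZF hp hrp hr pv R) in cD.
  exact: (swap_rearranges_inv hv ZF hp hrp hr pv cD R').
Qed.

End Monomials.

(** * The spines of a standard symbol *)

Section Injections.
Local Open Scope classical_set_scope.
Local Open Scope ring_scope.

Lemma int_set_max (P : int -> Prop) (M : int) :
  (exists y, P y) -> (forall y, P y -> y <= M) ->
  exists y, P y /\ forall z, P z -> z <= y.
Proof.
move=> [y0 Py0] PM.
have exP : exists m : nat, `[< P (M - m%:Z) >].
  by exists `|M - y0|%N; apply/asboolP; rewrite (_ : _ - _ = y0) //; have := PM _ Py0; lia.
case: (ex_minnP exP) => m /asboolP Pm mmin; exists (M - m%:Z); split=> // z Pz.
have zM := PM z Pz; have : (m <= `|M - z|)%N.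
  by apply: mmin; apply/asboolP; rewrite (_ : _ - _ = z) //; lia.
by lia.
Qed.

Variables (s t : int) (b : row s) (c : row t).
Hypothesis st : s <= t.
Hypothesis cb : forall j, j <= s -> c j <= b j.

(** The greedy choice never fails. The entries of [c] with index between [j0 + 1] and [k0] are at
    most [b k0] by [cb], and there is one more of them than there are values used since [j0]. *)
Lemma is_injection_ex : exists Psi, is_injection b c Psi.
Proof.
case: (rowP b) => _ [N1 b1] _; case: (rowP c) => _ [N2 c1] _.
pose j0 := Num.min (Num.min N1 N2) s.
have j0s : j0 <= s by rewrite /j0; lia.
have bj k : k <= j0 -> b k = k by move=> kj; apply: b1; move: kj; rewrite /j0; lia.
have cj k : k <= j0 -> c k = k by move=> kj; apply: c1; move: kj; rewrite /j0; lia.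
pose A (Psi : int -> int) k :=
  [set y | [/\ row_set c y, y <= b k & forall r, r < k -> y <> Psi (b r)]].
suff H m : exists Psi : int -> int, (forall x, x <= j0 -> Psi x = x) /\
    forall k, j0 < k -> k <= s -> k <= j0 + m%:Z ->
      A Psi k (Psi (b k)) /\ ubound (A Psi k) (Psi (b k)).
  have [Psi [P0 P1]] := H `|s - j0|%N; exists Psi, j0; split.
  - by split=> //; apply: le_trans st.
  - by move=> k kj; rewrite bj // cj // P0.
  - by move=> k jk ks; apply: P1 => //; lia.
elim: m => [|m [Psi [P0 P1]]]; first by exists id; split=> // k; lia.
have [ms|sm] := leP (j0 + m.+1%:Z) s; last first.
  by exists Psi; split=> // k jk ks km; apply: P1 => //; lia.
pose k0 := j0 + m.+1%:Z; rewrite -/k0 in ms *.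
have [y [Ay ymax]] : exists y, A Psi k0 y /\ forall z, A Psi k0 z -> z <= y.
  apply: (@int_set_max _ (b k0)) => [|z []//].
  apply: contrapT => nA.
  pose cs := [seq c (j0 + d.+1%:Z) | d <- iota 0 m.+1].
  pose ps := [seq Psi (b (j0 + d.+1%:Z)) | d <- iota 0 m].
  have : (size cs <= size ps)%N.
    apply: uniq_leq_size.
      rewrite map_inj_in_uniq ?iota_uniq // => d d'; rewrite !mem_iota => /andP[_ dm] /andP[_ dm'] e.
      have := @row_ltE t c (j0 + d.+1%:Z) (j0 + d'.+1%:Z).
      have := @row_ltE t c (j0 + d'.+1%:Z) (j0 + d.+1%:Z).
      by rewrite e ltxx => h1 h2; have := h1 ltac:(lia) ltac:(lia); have := h2 ltac:(lia) ltac:(lia); lia.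
    move=> y /mapP[d]; rewrite mem_iota => /andP[_ dm] ->.
    have kt : j0 + d.+1%:Z <= t by lia.
    apply: contrapT => nps; apply: nA; exists (c (j0 + d.+1%:Z)); split.
    - by exists (j0 + d.+1%:Z).
    - apply: le_trans (cb ms); have [->|ne] := eqVneq (j0 + d.+1%:Z) k0 => //.
      by apply: ltW; apply: row_lt; rewrite /k0 in ne *; lia.
    - move=> r rk e; have [rj|jr] := leP r j0.
        rewrite bj // P0 // in e.
        have : c j0 < c (j0 + d.+1%:Z) by apply: row_lt => //; lia.
        by rewrite e cj //; lia.
      apply: nps; rewrite e; apply/mapP; exists (absz (r - j0 - 1)%R).
        by rewrite mem_iota; rewrite /k0 in rk; lia.
      by congr (Psi (b _)); lia.
  by rewrite !size_map !size_iota ltnn.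
exists (fun x => if x == b k0 then y else Psi x).
have bk0 r : r < k0 -> (b r == b k0) = false.
  by move=> rk; apply/negbTE; rewrite neq_lt row_lt.
split=> [x xj|k jk ks km].
  case: eqP => [e|_]; last exact: P0.
  have : b j0 < b k0 by apply: row_lt => //; rewrite /k0; lia.
  by rewrite bj // -e; lia.
have AE : A (fun x => if x == b k0 then y else Psi x) k = A Psi k.
  apply/seteqP; split=> z [cz zb h]; split=> // r rk; have := h r rk; rewrite bk0 //; lia.
rewrite AE; have [->|ne] := eqVneq k k0; first by rewrite eqxx; split.
by rewrite bk0; [apply: P1 => //|]; rewrite /k0 in ne *; lia.
Qed.

Lemma injectionP k : k <= s ->
  [/\ row_set c (injection b c (b k)), injection b c (b k) <= b k
    & forall y, row_set c y -> y <= b k -> injection b c (b k) < y ->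
        exists2 r, r < k & y = injection b c (b r)].
Proof.
move=> ks; have /cid[Psi0 P0] := is_injection_ex.
have H := @xgetPex (classicType (int -> int)) idfun [set Psi | is_injection b c Psi]
  (ex_intro _ Psi0 P0).
have {H} : is_injection b c (injection b c) := H.
set Psi := injection b c; move=> [j0 [[js jt] Hj Hk]].
have [kj|jk] := leP k j0.
  have [bk ck Pk] := Hj k kj; rewrite Pk ck bk; split=> //; last by move=> y; lia.
  by exists k => //; lia.
have [[h1 h2 h3] h4] := Hk k jk ks; split=> // y cy yb Py.
apply: contrapT => nr; have : y <= Psi (b k).
  by apply: h4; split=> // r rk e; apply: nr; exists r.
by rewrite leNgt Py.
Qed.

End Injections.

(** * The spines of a standard symbol form a non-crossing family *)

Section AdmissibleWords.
Local Open Scope classical_set_scope.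
Local Open Scope ring_scope.
Variables (l : nat) (v : 'I_l -> int).
Hypothesis hv : forall i j : 'I_l, (i <= j)%N -> v j <= v i.
Variable S : symbol v.
Hypothesis hS : standard S.
Variable Y : forall j : int, 'I_(height v j) -> int.
Hypothesis hY : spine_indexing S Y.

Lemma card_ord_lt (m n : nat) : (m <= n)%N -> #|[pred i : 'I_n | (i < m)%N]| = m.
Proof.
move=> mn; rewrite -sum1_card (eq_bigl (fun i : 'I_n => (i < m)%N)) //.
by rewrite (big_ord_narrow mn) sum1_card card_ord.
Qed.

Lemma lt_height j (i : 'I_l) : (i < height v j)%N = (j <= v i).
Proof.
apply/idP/idP => [|ji]; last first.
  suff : (#|[pred k : 'I_l | (k < i.+1)%N]| <= height v j)%N by rewrite card_ord_lt.
  by apply: subset_leq_card; apply/fintype.subsetP => k; rewrite !inE ltnS => ki; exact: le_trans ji (hv ki).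
apply: contraTT => ji; rewrite -leqNgt -(@card_ord_lt i l) ?(ltnW (ltn_ord i)) //.
apply: subset_leq_card; apply/fintype.subsetP => k; rewrite !inE => jk.
by rewrite ltnNge; apply: contra ji => ik; exact: le_trans jk (hv ik).
Qed.

(** The default [j] makes the last clause of [spine_family] true also in the rows that the spine
    does not meet. *)
Definition spine_entry (j : int) (i : 'I_l) : int :=
  if insub (val i) is Some k then Y (j := j) k else j.

Lemma spine_entryE j (k : 'I_(height v j)) : spine_entry j (height_row k) = Y k.
Proof. by rewrite /spine_entry /= valK. Qed.

Lemma height_rowP j (i : 'I_l) : j <= v i -> exists k : 'I_(height v j), height_row k = i.
Proof. by rewrite -lt_height => ih; exists (Ordinal ih); apply: val_inj. Qed.

Lemma le_height_row j (k : 'I_(height v j)) : j <= v (height_row k).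
Proof. by rewrite -lt_height /=. Qed.

Lemma standard_le (i k : 'I_l) j : (i <= k)%N -> j <= v k -> S i j <= S k j.
Proof.
case: k => k kl; elim: k kl => [|k IH] kl ik jk.
  by rewrite (_ : i = Ordinal kl) //; apply: val_inj => /=; move: ik; rewrite leqn0 => /eqP.
have [ik'|ik'] := leqP i k; last first.
  by rewrite (_ : i = Ordinal kl) //; apply: val_inj => /=; apply/eqP; rewrite eqn_leq ik.
have kl' : (k < l)%N by apply: ltnW.
have jk' : j <= v (Ordinal kl') by rewrite (le_trans jk) // hv /=.
exact: le_trans (IH kl' ik' jk') (@hS (Ordinal kl') (Ordinal kl) erefl j jk).
Qed.

Let class p := [set r | entries S r /\ spine_equiv S p r].

Lemma class_eq p r : class p r -> class p = class r.
Proof.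
move=> [_ pr]; apply/seteqP; split=> x [ex h]; split=> //.
  exact: rst_trans (rst_sym _ _ _ _ pr) h.
exact: rst_trans pr h.
Qed.

Lemma tuple_class j p : tuple_entries Y j p -> tuple_entries Y j = class p /\ entries S p.
Proof.
move=> Yp; have j0 : (0 < height v j)%N by case: Yp => -[k kh] _; apply: leq_ltn_trans kh.
have [[Yfun _ _] _] := hY; have [p' ep' E] := Yfun j j0.
have := Yp; rewrite E => h; split; last by case: h.
exact: class_eq h.
Qed.

Lemma entry_tuple p : entries S p -> exists2 j, (0 < height v j)%N & tuple_entries Y j p.
Proof.
move=> ep; have [[_ _ Ysurj] _] := hY.
have /Ysurj[j j0 E] : spines S (class p) by exists p.
exists j => //; rewrite E; split=> //; exact: rst_refl.
Qed.

Lemma tuple_inj j j' p : tuple_entries Y j p -> tuple_entries Y j' p -> j = j'.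
Proof.
move=> h h'; have [E _] := tuple_class h; have [E' _] := tuple_class h'.
have j0 : (0 < height v j)%N by case: h => -[k kh] _; apply: leq_ltn_trans kh.
have j0' : (0 < height v j')%N by case: h' => -[k kh] _; apply: leq_ltn_trans kh.
have [[_ Yinj _] _] := hY.
by apply: Yinj; [exact: mem_set|exact: mem_set|rewrite E E'].
Qed.

Lemma spine_entry_tuple j i : j <= v i -> tuple_entries Y j (i, spine_entry j i).
Proof. by move=> /height_rowP[k <-]; exists k; rewrite spine_entryE. Qed.

Lemma spine_entry_row j i : j <= v i -> row_set (S i) (spine_entry j i).
Proof. by move=> /spine_entry_tuple/tuple_class[]. Qed.

Lemma spine_entry_psi j (i k : 'I_l) : (i < k)%N -> j <= v k ->
  spine_entry j i = psi S k i (spine_entry j k).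
Proof.
move=> ik jk; have ht := spine_entry_tuple jk; have [E _] := tuple_class ht.
have [m mk em] := spine_entry_row jk.
have [h1 _ _] := injectionP (hv (ltnW ik)) (fun j' => standard_le (ltnW ik)) mk.
have : class (k, spine_entry j k) (i, psi S k i (spine_entry j k)).
  have e1 : entries S (i, psi S k i (spine_entry j k)) by rewrite -em.
  split=> //; apply: rst_sym; apply: rst_step; split=> //.
  exact: spine_entry_row.
rewrite -E => -[k' [e1 ->]].
by rewrite e1 spine_entryE.
Qed.

(** Non-crossing is the maximality in the definition of the injections: an entry of row [i] that was
    free and larger than the chosen one must be the image of a smaller entry of row [k], which then
    lies on the same spine. The bound is left free so that a window can be chosen later. *)
Lemma spine_entry_family : exists N, forall N', N' <= N -> spine_family v N' spine_entry.
Proof.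
have [_ [N hN]] := hY; exists N => N' N'N.
have inj j j' (i : 'I_l) : j <= v i -> j' <= v i -> spine_entry j i = spine_entry j' i -> j = j'.
  move=> ji ji' e; apply: (tuple_inj (spine_entry_tuple ji)).
  by rewrite e; apply: spine_entry_tuple.
split=> //.
- move=> j i k; rewrite leq_eqVlt => /orP[/eqP/val_inj ->//|ik] jk.
  rewrite (spine_entry_psi ik jk); have [m mk <-] := spine_entry_row jk.
  by have [_ h _] := injectionP (hv (ltnW ik)) (fun j' => standard_le (ltnW ik)) mk.
- move=> j j' i k ik jk ji' jj'; rewrite (spine_entry_psi ik jk).
  have [m mk em] := spine_entry_row jk; rewrite -em => lt le.
  have [_ _ h] := injectionP (hv (ltnW ik)) (fun j' => standard_le (ltnW ik)) mk.
  have [r rm e] := h _ (spine_entry_row ji') le lt.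
  have rk : r <= v k by rewrite ltW // (lt_le_trans rm).
  have [j2 _ [k2 [e2 e3]]] : exists2 j2, (0 < height v j2)%N & tuple_entries Y j2 (k, S k r).
    by apply: entry_tuple; exists r.
  have jk2 : j2 <= v k by rewrite e2 le_height_row.
  have e4 : S k r = spine_entry j2 k by rewrite e3 e2 spine_entryE.
  have j2E : j2 = j'.
    apply: inj ji' _; first by rewrite (le_trans jk2) // hv // ltnW.
    by rewrite (spine_entry_psi ik jk2) -e4.
  by rewrite -j2E -e4 row_lt.
- move=> j i jN; rewrite /spine_entry; case: insubP => // k _ _.
  by apply: hN; rewrite ltW // (lt_le_trans jN).
Qed.

Lemma spine_entry_rearranges : rearranges spine_entry S spine_entry.
Proof.
split=> [i j ji|i x /entP Sx|//]; first exact/entP/spine_entry_row.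
have [j j0 [k [e1 e2]]] := @entry_tuple (i, x) Sx.
by exists j; rewrite e1 ?le_height_row // spine_entryE e2.
Qed.

End AdmissibleWords.

(** * Admissible permutations *)

Section CoxeterLength.
Local Open Scope ring_scope.
Variable r : nat.
Implicit Types (s t w : 'S_r) (y : 'I_r -> int).

Definition perm_inv s : nat :=
  #|[set p : 'I_r * 'I_r | (p.1 < p.2)%N && (s p.2 < s p.1)%N]|.

(** The adjacent transposition permutes the ordered pairs other than [(i, j)], so only the status of
    this pair can change. *)
Lemma perm_inv_tperm s (i j : 'I_r) : j = i.+1 :> nat ->
  (perm_inv (tperm i j * s)%g + (s j < s i)%N = perm_inv s + (s i < s j)%N)%N.
Proof.
move=> ji; set t := tperm i j.
have ij : (i < j)%N by rewrite ji.
pose E u := [set p : 'I_r * 'I_r |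
  [&& p != (i, j), (p.1 < p.2)%N & (fun_of_perm u p.2 < fun_of_perm u p.1)%N]].
have split_inv u : perm_inv u = (#|E u| + (fun_of_perm u j < fun_of_perm u i)%N)%N.
  rewrite /perm_inv (cardsD1 (i, j)) inE /= ij addnC; congr (_ + _)%N.
  by apply: eq_card => p; rewrite !inE.
rewrite !split_inv !permM tpermL tpermR -!addnA; congr (_ + _)%N; last by rewrite addnC.
pose f (p : 'I_r * 'I_r) := (t p.1, t p.2).
have fK : cancel f f by move=> [a b]; rewrite /f /= !tpermK.
rewrite -(card_preimset _ (can_inj fK)); apply: eq_card => -[a b].
rewrite !inE /f /= !permM !xpair_eqE andbA [RHS]andbA; congr andb; last by rewrite !tpermK.
rewrite /t; case: tpermP => [->|->|/eqP ai /eqP aj]; case: tpermP => [->|->|/eqP bi /eqP bj];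
  rewrite -?val_eqE /=; move: ij ji;
  try (move: ai aj; rewrite -!val_eqE /=); try (move: bi bj; rewrite -!val_eqE /=); lia.
Qed.

Lemma perm_rank s i : (s i : nat) = #|[set k | (s k < s i)%N]|.
Proof.
rewrite -[LHS](@card_ord_lt (s i) r) ?(ltnW (ltn_ord _)) //.
rewrite -[LHS]cardsE -[LHS](card_preimset _ (@perm_inj _ s)).
by apply: eq_card => k; rewrite !inE.
Qed.

Lemma perm_no_descent s : (forall i j : 'I_r, j = i.+1 :> nat -> (s i < s j)%N) -> s = 1%g.
Proof.
move=> H.
have Hlt (i j : 'I_r) : (i < j)%N -> (s i < s j)%N.
  case: j => j jl; elim: j jl => // j IH jl; rewrite ltnS => ij.
  have jl' : (j < r)%N by apply: ltnW.
  have h1 := H (Ordinal jl') (Ordinal jl) erefl.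
  have [ij'|ji] := ltnP i j; first exact: ltn_trans (IH jl' ij') h1.
  by rewrite (_ : i = Ordinal jl') //; apply: val_inj; apply/eqP; rewrite eqn_leq ij.
apply/permP => i; rewrite perm1; apply: val_inj => /=.
rewrite [LHS]perm_rank -[RHS](@card_ord_lt i r) ?(ltnW (ltn_ord _)) //.
apply: eq_card => k; rewrite !inE; apply/idP/idP => [|/Hlt//].
apply: contraTT; rewrite -!leqNgt leq_eqVlt => /orP[/eqP/val_inj->//|/Hlt/ltnW //].
Qed.

Lemma perm_inv1 : perm_inv 1%g = 0%N.
Proof.
apply/eqP; rewrite cards_eq0; apply/eqP/setP => -[a b].
by rewrite !inE !perm1 /=; apply/negbTE/negP => /andP[/ltnW]; rewrite leqNgt => /negP.
Qed.

Lemma simple_productP s n : reflect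
  (exists2 cs : seq 'S_r, size cs = n /\ all (@simple_transposition r) cs & s = (\prod_(c <- cs) c)%g)
  (simple_product s n).
Proof.
apply: (iffP existsP) => [[c /andP[/forallP hc /eqP ->]]|[cs [sz /allP hc] ->]].
  exists [seq c i | i <- enum 'I_n]; last by rewrite big_map enumT.
  by rewrite size_map size_enum_ord; split=> //; apply/allP => _ /mapP[i _ ->].
exists [ffun i : 'I_n => nth 1%g cs i]; apply/andP; split.
  by apply/forallP => i; rewrite ffunE; apply: hc; rewrite mem_nth // sz.
rewrite (big_nth 1%g) big_mkord sz; apply/eqP; apply: eq_bigr => i _.
by rewrite ffunE.
Qed.

Lemma simple_product_inv s n : simple_product s n -> (perm_inv s <= n)%N.
Proof.
move=> /simple_productP[cs [<- hc] ->] {s n}.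
elim: cs hc => [|c cs IH] /=; first by rewrite big_nil perm_inv1.
move=> /andP[/existsP[i /existsP[j /andP[/eqP ji /eqP ->]]] /IH le].
rewrite big_cons; have := perm_inv_tperm (\prod_(c <- cs) c)%g ji.
move: (perm_inv _) (perm_inv _) le => m1 m2 le.
by case: (_ < _)%N; case: (_ < _)%N => /=; rewrite ?addn0 ?addn1; lia.
Qed.

(** A generator changes the number of inversions by at most one; conversely, a permutation other
    than the identity has a descent, and removing it lowers the number by one. *)
Lemma coxeter_lengthE s : coxeter_length s = perm_inv s.
Proof.
rewrite /coxeter_length; case: ex_minnP => m sm mmin.
apply/eqP; rewrite eqn_leq (simple_product_inv sm) andbT; apply: mmin.
have [n] : exists n, perm_inv s = n by exists (perm_inv s).
move=> sn; rewrite sn; apply/simple_productP; elim: n s sn {m sm} => [|n IH] s sn.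
  exists [::]; rewrite // big_nil; apply: perm_no_descent => i j ji.
  have := perm_inv_tperm s ji; rewrite sn.
  have := @perm_inj _ s i j; case: (ltngtP (s i) (s j)) => //= [_|/val_inj e /(_ e) ij _]; first by rewrite addn1.
  by move: ji; rewrite ij; lia.
case: (pselect (exists2 i : 'I_r, exists j : 'I_r, j = i.+1 :> nat /\ (s j < s i)%N & True)).
  move=> [i [j [ji lt]] _].
  have := perm_inv_tperm s ji; rewrite sn lt (ltnNge (s i)) (ltnW lt) /= => e.
  have [|cs [sz hc] e'] := IH (tperm i j * s)%g; first by lia.
  exists (tperm i j :: cs) => /=.
    rewrite sz hc andbT; split=> //; apply/existsP; exists i; apply/existsP; exists j.
    by rewrite ji !eqxx.
  by rewrite big_cons -e' mulgA tperm2 mul1g.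
move=> nd; have s1 : s = 1%g.
  apply: perm_no_descent => i j ji; rewrite ltnNge; apply/negP; rewrite leq_eqVlt.
  case/orP => [/eqP/val_inj/perm_inj e|lt]; first by move: ji; rewrite e; lia.
  by apply: nd; exists i => //; exists j.
by move: sn; rewrite s1 perm_inv1.
Qed.

Definition tie_free y s : Prop :=
  forall a b : 'I_r, (a < b)%N -> y (s a) = y (s b) -> (s a < s b)%N.

Definition word_inv y : nat :=
  #|[set p : 'I_r * 'I_r | (p.1 < p.2)%N && (y p.2 < y p.1)]|.

Variable y : 'I_r -> int.
Hypothesis ymono : forall a b : 'I_r, (a <= b)%N -> y a <= y b.

Let ylt a b : y a < y b -> (a < b)%N.
Proof. by apply: contraTT; rewrite -leqNgt -leNgt => /ymono. Qed.

Lemma word_inv_le s : (word_inv (y \o s) <= perm_inv s)%N.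
Proof.
apply: subset_leq_card; apply/subsetP => -[a b]; rewrite !inE /= => /andP[-> /ylt].
by [].
Qed.

Lemma tie_free_inv s : tie_free y s -> perm_inv s = word_inv (y \o s).
Proof.
move=> tf; apply: eq_card => -[a b]; rewrite !inE /=; case: ltnP => //= ab.
apply/idP/idP => [lt|/ylt//]; rewrite lt_neqAle ymono ?(ltnW lt) // andbT.
by apply/eqP => e; have := tf a b ab (esym e); rewrite ltnNge (ltnW lt).
Qed.

Lemma not_tie_free_inv s : ~ tie_free y s -> (word_inv (y \o s) < perm_inv s)%N.
Proof.
move=> ntf; apply: proper_card; apply/properP; split.
  by apply/subsetP => -[a b]; rewrite !inE /= => /andP[-> /ylt].
move/existsNP: ntf => [a /existsNP[b /not_implyP[ab /not_implyP[e /negP lt]]]].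
exists (a, b); rewrite !inE /= ab ?e ?ltxx //= ltn_neqAle leqNgt lt andbT.
by apply/eqP => /val_inj/perm_inj eab; move: ab; rewrite eab ltnn.
Qed.

(** A tie-free permutation is the standardization of its word: it ranks positions by value and then
    from left to right, so the word determines it. *)
Lemma tie_free_unique s t : tie_free y s -> tie_free y t -> y \o s =1 y \o t -> s = t.
Proof.
have E u : tie_free y u -> forall k i, (u k < u i)%N =
    (y (u k) < y (u i)) || ((y (u k) == y (u i)) && (k < i)%N).
  move=> tf k i; have [lt|gt|e] := ltgtP (y (u k)) (y (u i)) => /=.
  - by rewrite (ylt lt).
  - by apply/negbTE; rewrite -leqNgt ltnW // ylt.
  - have [ki|ik|/val_inj ->] := ltngtP k i; last by rewrite ltnn.
    + by rewrite tf.
    + by apply/negbTE; rewrite -leqNgt ltnW // tf.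
move=> ts tt est; apply/permP => i; apply: val_inj => /=; rewrite [LHS]perm_rank [RHS]perm_rank.
apply: eq_card => k; rewrite !inE (E s ts) (E t tt).
by have /= -> := est k; have /= -> := est i.
Qed.

Lemma tie_free1 : tie_free y 1%g.
Proof. by move=> a b; rewrite !perm1. Qed.

(** Among the permutations with the same word, take one that maximizes the sum of the products
    [a * w a]. By the rearrangement inequality, undoing an inverted tie would increase this sum. *)
Lemma tie_free_ex s : exists2 w, tie_free y w & y \o w =1 y \o s.
Proof.
pose P w := [forall a, y (w a) == y (s a)].
have Ps : P s by apply/forallP => a.
case: (arg_maxnP (fun w : 'S_r => \sum_(a < r) a * w a)%N Ps) => w /forallP Pw wmax.
exists w; last by move=> a; apply/eqP; exact: Pw.
move=> a b ab e; rewrite ltnNge; apply/negP => le.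
have lt : (w b < w a)%N.
  rewrite ltn_neqAle le andbT; apply/eqP => /val_inj/perm_inj eab.
  by move: ab; rewrite eab ltnn.
have Pt : P (tperm a b * w)%g.
  apply/forallP => c; rewrite permM -(eqP (Pw c)).
  by case: tpermP => [->|->|//]; rewrite e.
have /= := wmax _ Pt; rewrite leqNgt => /negP; apply.
have ba : b != a by apply/eqP => eab; move: ab; rewrite eab ltnn.
rewrite (bigD1 a) // (bigD1 b) //= [in X in (_ < X)%N](bigD1 a) // [in X in (_ < X)%N](bigD1 b) //=.
rewrite !permM tpermL tpermR.
rewrite [in X in (_ < X)%N](eq_bigr (fun c : 'I_r => c * w c)%N); last first.
  by move=> c /andP[ca cb]; rewrite permM tpermD // eq_sym.
move: (\sum_(_ < _ | _) _)%N => m; nia.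
Qed.

Lemma same_counts_perm (y' : 'I_r -> int) :
  (forall x, #|[set k | y' k == x]| = #|[set k | y k == x]|) ->
  exists s : 'S_r, y' =1 y \o s.
Proof.
move=> H.
have /tuple_permP[s es] : perm_eq [tuple y' i | i < r] [tuple y i | i < r].
  apply/allP => x _; apply/eqP; rewrite /= !count_map -!enumT -!sum1_count !big_enum_cond /=.
  have := H x; rewrite -!sum1_card => e; apply: etrans (etrans e _); apply: eq_bigl => k;
  by rewrite !inE.
exists s => k; have := congr1 (fun u => tnth u k) (val_inj es).
by rewrite !tnth_mktuple.
Qed.

End CoxeterLength.

Section RowOfFunction.
Local Open Scope ring_scope.

(** The values up to [N] are taken by the identity part, so injectivity sends the remaining indices
    above [N]; sorting their finitely many values gives the rest of the row. *)
Lemma row_of_function (s N : int) (f : int -> int) : N <= s ->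
  (forall j, j <= N -> f j = j) ->
  (forall j k, j <= s -> k <= s -> f j = f k -> j = k) ->
  exists b : row s, forall x, row_set b x <-> exists2 j, j <= s & f j = x.
Proof.
move=> Ns f0 finj; pose m := `|s - N|%N.
pose r := [seq f (N + d.+1%:Z) | d <- iota 0 m]; pose L := sort <=%O r.
have fgt j : N < j -> j <= s -> N < f j.
  move=> Nj js; rewrite ltNge; apply/negP => fj.
  have := finj (f j) j (le_trans fj Ns) js (f0 _ fj); lia.
have ur : uniq r.
  rewrite map_inj_in_uniq ?iota_uniq // => d d'; rewrite !mem_iota => /andP[_ dm] /andP[_ dm'] e.
  rewrite /m in dm dm'; have := finj (N + d.+1%:Z) (N + d'.+1%:Z) _ _ e; lia.
have sL : sorted <%O L by rewrite sort_lt_sorted.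
have szL : size L = m by rewrite size_sort size_map size_iota.
have memL x : (x \in L) = (x \in r) by rewrite mem_sort.
have inL j : N < j -> j <= s -> nth 0 L `|j - N|.-1 \in r.
  by move=> Nj js; rewrite -memL mem_nth // szL /m; lia.
have rgt x : x \in r -> N < x.
  by move=> /mapP[d]; rewrite mem_iota => /andP[_ dm] ->; apply: fgt; rewrite /m in dm; lia.
pose b j := if j <= N then j else if j <= s then nth 0 L `|j - N|.-1 else 0.
have bP : is_row s b.
  split=> [j k jk ks||j sj].
  - have js := ltW (lt_le_trans jk ks); rewrite /b ks js.
    have [kN|Nk] := leP k N; first by rewrite (le_trans (ltW jk) kN).
    have [jN|Nj] := leP j N; first by apply: (le_lt_trans jN); apply: rgt; exact: inL.
    by rewrite (lt_sorted_ltn_nth 0 sL) ?inE ?szL ?ltEnat /= /m; lia.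
  - by exists N => j jN; rewrite /b jN.
  - by rewrite /b leNgt (le_lt_trans Ns sj) /= leNgt sj.
exists (Row bP) => x; split=> [[j js <-]|[j js <-]] /=; rewrite /b.
- have [jN|Nj] := leP j N; first by exists j => //; exact: f0.
  rewrite js; have /mapP[d] := inL j Nj js; rewrite mem_iota => /andP[_ dm] ->.
  by exists (N + d.+1%:Z) => //; rewrite /m in dm; lia.
- have [jN|Nj] := leP j N; first by exists j; rewrite //= /b jN f0.
  have : f j \in L.
    rewrite memL; apply/mapP; exists `|j - N|.-1; first by rewrite mem_iota /m; lia.
    by congr f; lia.
  move=> fL; have := index_mem (f j) L; rewrite fL szL /m => lt.
  exists (N + (index (f j) L).+1%:Z); first by lia.
  rewrite /= /b ifN; last by rewrite -ltNge; lia.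
  rewrite ifT; last by lia.
  by rewrite (_ : `|_ - _|.-1 = index (f j) L) ?nth_index //; lia.
Qed.

End RowOfFunction.

(** * The sum over admissible permutations *)

Section SpineSum.
Local Open Scope ring_scope.
Variables (l : nat) (v : 'I_l -> int).
Hypothesis hv : forall i j : 'I_l, (i <= j)%N -> v j <= v i.
Variables (N : int) (n : nat).
Hypothesis Nv : forall i, N <= v i.
Hypothesis vN : forall i, v i < N + n%:Z.
Variable Y : forall j : int, 'I_(height v j) -> int.
Hypothesis ZF : spine_family v N (spine_entry Y).
Implicit Types (sg w : spine_perm v) (T : symbol v).

Lemma Y_const j k : j < N -> Y (j := j) k = j.
Proof. by move=> jN; have [_ _ _ fr] := ZF; rewrite -spine_entryE fr. Qed.

Lemma Y_mono j (a b : 'I_(height v j)) : (a <= b)%N -> Y a <= Y b.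
Proof.
move=> ab; have [mono _ _ _] := ZF; rewrite -!spine_entryE.
by apply: mono => //; exact: le_height_row.
Qed.

Lemma height_row_inj j : injective (@height_row l v j).
Proof. by move=> a b /(congr1 val) /= e; apply: val_inj. Qed.

Lemma Y_disjoint j j' (k : 'I_(height v j)) (k' : 'I_(height v j')) : Y k = Y k' -> j = j'.
Proof.
rewrite -!spine_entryE; apply: (spine_disjoint hv ZF); exact: le_height_row.
Qed.

Definition permuted sg : int -> 'I_l -> int := spine_entry (fun j k => Y (sg j k)).

Lemma spine_count_entry (Y' : forall j : int, 'I_(height v j) -> int) j x :
  spine_count v (spine_entry Y') j x = #|[set k | Y' j k == x]|.
Proof.
rewrite -(card_imset _ (@height_row_inj j)); apply: eq_card => i; rewrite inE.
apply/andP/imsetP => [[/(height_rowP hv)[k <-]]|[k]].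
  by rewrite spine_entryE => e; exists k; rewrite ?inE.
by rewrite inE => e ->; rewrite spine_entryE (le_height_row hv).
Qed.

Lemma permuted_count sg j x :
  spine_count v (permuted sg) j x = spine_count v (spine_entry Y) j x.
Proof.
rewrite !spine_count_entry -[RHS](card_preimset _ (@perm_inj _ (sg j))).
by apply: eq_card => k; rewrite !inE.
Qed.

Lemma permuted_rearranges sg T :
  (forall i x, row_set (T i) x <-> permuted_row Y sg i x) ->
  rearranges (spine_entry Y) T (permuted sg).
Proof.
move=> H; split=> [i j ji|i x /entP/H|j x]; last exact: permuted_count.
  apply/entP/H; have [k <-] := height_rowP hv ji; exists j, k; split=> //.
  by rewrite /permuted spine_entryE.
move=> [j [k [<- ->]]]; exists j; first exact: le_height_row.
by rewrite /permuted spine_entryE.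
Qed.

Lemma rearranges_row_set sg T b : rearranges (spine_entry Y) T b ->
  (forall j i, j <= v i -> b j i = permuted sg j i) ->
  forall i x, row_set (T i) x <-> permuted_row Y sg i x.
Proof.
move=> [R1 R2 R3] E i x; split=> [/entP/R2[j ji <-]|[j [k [<- ->]]]].
  have [k ek] := height_rowP hv ji; exists j, k; split=> //.
  by rewrite E // -ek /permuted spine_entryE.
have jk := le_height_row hv k; apply/entP; have := R1 _ _ jk.
by rewrite E // /permuted spine_entryE.
Qed.

(** Different spines share no value in any rows, so an entry of [T] reveals its spine. *)
Lemma rearranges_unique T b b' j i : rearranges (spine_entry Y) T b ->
  rearranges (spine_entry Y) T b' -> j <= v i -> b j i = b' j i.
Proof.
move=> R R' ji; have [R1 _ _] := R; have [_ R2 _] := R'.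
have [j' ji' e] := R2 _ _ (R1 i j ji).
have [k jk ek] := rearranges_val R ji; have [k' jk' ek'] := rearranges_val R' ji'.
suff jj : j = j' by rewrite -e jj.
by apply: (spine_disjoint hv ZF jk jk'); rewrite ek ek' e.
Qed.

Lemma no_repetition_all sg : no_repetition Y sg.
Proof. by move=> j j' k k' _ e; apply: (@Y_disjoint j j' (sg j k) (sg j' k')). Qed.

Lemma permuted_symbolP sg : finite_length sg ->
  forall i x, row_set (permuted_symbol Y sg i) x <-> permuted_row Y sg i x.
Proof.
move=> fl.
have [M0 hM0] : exists M0, forall j, j <= M0 -> sg j = 1%g.
  have [r rE] := (finite_seqP _).1 fl.
  exists (- \sum_(j <- r) `|j| - 1) => j jM; apply/eqP; apply: contraT => sj.
  have : [set` r]%classic j by rewrite -rE.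
  move=> /= jr; have : `|j| <= \sum_(j <- r) `|j|.
    by rewrite (big_rem j) //= lerDl sumr_ge0.
  by lia.
have rows i : exists b : row (v i), forall x, row_set b x <-> permuted_row Y sg i x.
  pose N1 := Num.min (Num.min M0 (N - 1)) (v i).
  have [||j k ji ki|b hb] := @row_of_function (v i) N1 (fun j => permuted sg j i).
  - by rewrite /N1; lia.
  - move=> j; rewrite /N1 => jN; have ji : j <= v i by lia.
    have [k <-] := height_rowP hv ji; rewrite /permuted spine_entryE hM0; last by lia.
    by rewrite perm1 Y_const //; lia.
  - have [a ea] := height_rowP hv ji; have [b eb] := height_rowP hv ki.
    by rewrite -{1}ea -eb /permuted !spine_entryE; exact: Y_disjoint.
  exists b => x; rewrite hb; split=> [[j ji <-]|[j [k [<- ->]]]].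
    have [k <-] := height_rowP hv ji; exists j, k; split=> //.
    by rewrite /permuted spine_entryE.
  by exists j; rewrite ?(le_height_row hv) // /permuted spine_entryE.
pose T : symbol v := fun i => sval (cid (rows i)).
have := @xgetPex _ (empty_symbol v) [set T : symbol v | forall i, row_set (T i) = permuted_row Y sg i]%classic.
move=> H i x; have -> // : row_set (permuted_symbol Y sg i) = permuted_row Y sg i.
apply: H; exists T => i'; apply/seteqP; rewrite /T; case: cid => b hb /=.
by split=> y /hb.
Qed.

Lemma permuted_symbol_rearranges sg : finite_length sg ->
  rearranges (spine_entry Y) (permuted_symbol Y sg) (permuted sg).
Proof. by move=> fl; apply: permuted_rearranges; exact: permuted_symbolP. Qed.

Definition all_tie_free sg := forall j, tie_free (@Y j) (sg j).

Lemma height0 j : N + n%:Z <= j -> height v j = 0%N.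
Proof.
move=> nj; apply: eq_card0 => i; rewrite !inE.
by apply/negbTE; rewrite -ltNge (lt_le_trans (vN i)).
Qed.

(** To the left the spine is constant, and the identity is the only permutation that inverts no tie;
    to the right its height is 0. *)
Lemma all_tie_free_out sg j : all_tie_free sg -> ~ (N <= j < N + n%:Z) -> sg j = 1%g.
Proof.
move=> tf /negP; rewrite negb_and -ltNge -leNgt => /orP[jN|nj].
  apply: (tie_free_unique (@Y_mono j) (tf j)); first exact: tie_free1.
  by move=> k /=; rewrite !Y_const.
by apply/permP => k; exfalso; case: k => k; rewrite height0.
Qed.

Lemma all_tie_free_finite sg : all_tie_free sg -> finite_length sg.
Proof.
move=> tf; apply: (@sub_finite_set _ _ [set` [seq N + d%:Z | d <- iota 0 n]]%classic); last exact: finite_seq.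
move=> j /= /eqP sj; apply: contrapT => nj; apply: sj; apply: all_tie_free_out => // /andP[Nj jn].
apply: nj; apply/mapP; exists `|j - N|%N; last by lia.
by rewrite mem_iota; lia.
Qed.

(** Induction on the number of spines allowed to move: one more spine multiplies the set by a finite
    symmetric group. *)
Lemma finite_all_tie_free : finite_set [set sg | all_tie_free sg]%classic.
Proof.
pose F m := [set sg : spine_perm v | forall j, ~ (N <= j < N + m%:Z) -> sg j = 1%g]%classic.
suff Ffin m : finite_set (F m).
  by apply: sub_finite_set (Ffin n) => sg /= tf j; exact: all_tie_free_out.
elim: m => [|m IH].
  apply: sub_finite_set (finite_set1 (fun j => 1%g : 'S_(height v j))) => sg /= h.
  by apply: functional_extensionality_dep => j; apply: h; lia.
apply: sub_finite_set (finite_image2 (fun (sg : spine_perm v) (s : 'S_(height v (N + m%:Z))) =>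
   dfwith sg s : spine_perm v) IH (@finite_finset _ classical_sets.setT)).
move=> sg /= h; exists (dfwith sg (1%g : 'S_(height v (N + m%:Z)))).
  move=> j nj; case: dfwithP nj => // j' jj' nj; apply: h => hj.
  by apply: nj; move: jj' hj; lia.
exists (sg (N + m%:Z)) => //; apply: functional_extensionality_dep => j.
by case: dfwithP => // j' jj'; rewrite dfwith_out.
Qed.

Lemma coxeter_length1 m : coxeter_length (1%g : 'S_m) = 0%N.
Proof. by rewrite coxeter_lengthE perm_inv1. Qed.

Lemma spine_length_le sg w : finite_length sg -> finite_length w ->
  (forall j, (coxeter_length (sg j) <= coxeter_length (w j))%N) ->
  (spine_length sg <= spine_length w)%N /\
  ((exists j, (coxeter_length (sg j) < coxeter_length (w j))%N) ->
   (spine_length sg < spine_length w)%N).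
Proof.
move=> fs fw le; have fin : finite_set ([set j | sg j != 1%g] `|` [set j | w j != 1%g])%classic.
  by rewrite finite_setU.
pose A := fset_set ([set j | sg j != 1%g] `|` [set j | w j != 1%g])%classic.
have A0 j : j \notin A -> sg j = 1%g /\ w j = 1%g.
  rewrite /A in_fset_set // => /negP nj; split; apply/eqP; apply: contraT => h;
  by case: nj; apply: mem_set; (left + right); exact: h.
have E u : u = sg \/ u = w -> spine_length u = (\sum_(j <- A) coxeter_length (u j))%N.
  move=> hu; apply: fsbigTE => j /A0[h1 h2].
  by case: hu => ->; rewrite ?h1 ?h2 coxeter_length1.
rewrite (E sg) ?(E w); auto; split=> [|[j0 lt]]; first by apply: leq_sum => j _.
have j0A : j0 \in A.
  by apply: contraT => /A0[h1 h2]; move: lt; rewrite h1 h2 ltnn.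
rewrite (big_rem j0) // [in X in (_ < X)%N](big_rem j0) //= -addSn leq_add //.
by apply: leq_sum => j _.
Qed.

(** If one component inverts a tie, the tie-free permutation with the same word gives the same
    symbol and is shorter. Conversely, the symbol determines the word of every spine, and the
    inversions of a word bound the length of each permutation producing it. *)
Lemma heart_admissibleE sg : heart_admissible Y sg <-> all_tie_free sg.
Proof.
split=> [[_ fl hmin] j0|tf].
  apply: contrapT => ntf.
  have [s' tf' e'] := tie_free_ex (@Y j0) (sg j0).
  pose w : spine_perm v := dfwith sg s'.
  have fw : finite_length w.
    apply: (@sub_finite_set _ _ ([set j | sg j != 1%g] `|` [set j0])%classic).
      move=> j /=; rewrite /w; case: dfwithP; first by right.
      by move=> j' _ h; left.
    by rewrite finite_setU; split=> //; exact: finite_set1.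
  have eY j k : Y (w j k) = Y (sg j k).
    rewrite /w; case: (dfwithP sg s' j) k => [k|j' _ k] //; exact: e'.
  have : permuted_symbol Y w = permuted_symbol Y sg.
    rewrite /permuted_symbol; congr xget; apply/seteqP.
    have E i : permuted_row Y w i = permuted_row Y sg i.
      by apply/seteqP; split=> x [j [k [h1 h2]]]; exists j, k; split=> //;
        rewrite h2 /permuted_entry eY.
    by split=> T /= h i; rewrite h E.
  move=> /(hmin w (@no_repetition_all w) fw); rewrite leqNgt => /negP; apply.
  have clt : (coxeter_length (w j0) < coxeter_length (sg j0))%N.
    rewrite /w dfwith_in !coxeter_lengthE (tie_free_inv (@Y_mono j0) tf').
    rewrite (_ : word_inv _ = word_inv (@Y j0 \o sg j0)).
      exact: (not_tie_free_inv (@Y_mono j0) ntf).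
    by apply: eq_card => -[a b]; rewrite !inE /= -[Y (s' a)]/((@Y j0 \o s') a)
      -[Y (s' b)]/((@Y j0 \o s') b) !e'.
  have cle j : (coxeter_length (w j) <= coxeter_length (sg j))%N.
    have [->|jj] := eqVneq j j0; first exact: ltnW.
    by rewrite /w dfwith_out // eq_sym.
  by have [_] := spine_length_le fw fl cle; apply; exists j0.
have fl := all_tie_free_finite tf.
split=> //; first exact: no_repetition_all.
move=> w _ fw e; suff cle j : (coxeter_length (sg j) <= coxeter_length (w j))%N.
  by have [] := spine_length_le fl fw cle.
rewrite !coxeter_lengthE (tie_free_inv (@Y_mono j) (tf j)).
have -> : word_inv (@Y j \o sg j) = word_inv (@Y j \o w j).
  have R := permuted_symbol_rearranges fl; have Rw := permuted_symbol_rearranges fw.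
  rewrite e in Rw.
  have E k : Y (sg j k) = Y (w j k).
    have := rearranges_unique R Rw (le_height_row hv k).
    by rewrite /permuted !spine_entryE.
  by apply: eq_card => -[a b]; rewrite !inE /= !E.
exact: (word_inv_le (@Y_mono j) (w j)).
Qed.

Lemma spine_inv_entry (Y' : forall j : int, 'I_(height v j) -> int) j :
  spine_inv v (spine_entry Y') j = word_inv (@Y' j).
Proof.
pose f (p : 'I_(height v j) * 'I_(height v j)) := (height_row p.1, height_row p.2).
have finj : injective f.
  move=> [a b] [a' b'] e; congr pair; apply: (@height_row_inj j).
    exact: (congr1 fst e).
  exact: (congr1 snd e).
rewrite /word_inv -(card_imset _ finj); apply: eq_card => -[i k]; rewrite inE /=.
apply/and3P/imsetP => [[ik jk lt]|[[a b]]].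
  have ji : j <= v i by rewrite (le_trans jk) // hv // ltnW.
  have [a ea] := height_rowP hv ji; have [b eb] := height_rowP hv jk.
  exists (a, b); last by rewrite /f /= ea eb.
  by rewrite inE /=; move: ik lt; rewrite -ea -eb !spine_entryE /= => -> ->.
rewrite inE /= => /andP[ab lt] [-> ->]; rewrite !spine_entryE (le_height_row hv) lt.
by split.
Qed.

Lemma spine_length_total sg : all_tie_free sg ->
  spine_length sg = total_inv v N n (permuted sg).
Proof.
move=> tf; rewrite /spine_length /total_inv.
rewrite (@fsbigE _ _ _ _ _ [seq N + d%:Z | d <- index_iota 0 n]) //; last 2 first.
- by rewrite map_inj_uniq ?iota_uniq // => d d'; lia.
- move=> j _ nj; rewrite (all_tie_free_out tf) ?coxeter_length1 // => /andP[Nj jn].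
  move/negP: nj; apply; apply/mapP; exists `|j - N|%N; last by lia.
  by rewrite mem_index_iota; lia.
rewrite big_map big_mkord /=; apply: eq_big => [d|d _]; first exact: mem_set.
by rewrite coxeter_lengthE (tie_free_inv (@Y_mono _) (tf _)) /permuted spine_inv_entry.
Qed.

Lemma rearranges_perm T b : rearranges (spine_entry Y) T b ->
  exists2 sg, all_tie_free sg & forall j i, j <= v i -> b j i = permuted sg j i.
Proof.
move=> [_ _ R3].
have H j : exists2 s : 'S_(height v j), tie_free (@Y j) s &
    forall k, b j (height_row k) = Y (s k).
  have [s es] : exists s : 'S_(height v j), (fun k => b j (height_row k)) =1 @Y j \o s.
    apply: same_counts_perm => x; rewrite -spine_count_entry -R3.
    rewrite -(card_imset _ (@height_row_inj j)); apply: eq_card => i.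
    apply/imsetP/idP => [[k]|]; rewrite !inE; first by move=> e ->; rewrite e (le_height_row hv).
    by move=> /andP[/(height_rowP hv)[k <-] e]; exists k; rewrite ?inE.
  have [s' tf e'] := tie_free_ex (@Y j) s; exists s' => // k.
  by rewrite (es k); have /= -> := e' k.
exists (fun j => sval (cid2 (H j))) => [j|j i ji]; first by case: cid2.
have [k <-] := height_rowP hv ji; rewrite /permuted spine_entryE.
by case: cid2 => s /= _ ->.
Qed.

Lemma total_inv_ext b b' : (forall j i, j <= v i -> b j i = b' j i) ->
  total_inv v N n b = total_inv v N n b'.
Proof.
move=> E; apply: total_inv_eq => j; apply: eq_card => -[i k]; rewrite !inE /=.
case: ltnP => //= ik; case: (boolP (j <= v k)) => //= jk.
by rewrite !E // (le_trans jk) // hv // ltnW.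
Qed.

Lemma spine_sum_coefs : spine_coefs N n (spine_entry Y) (spine_sum Y).
Proof.
have fin := finite_all_tie_free.
have hset : [set sigma : spine_perm v | heart_admissible Y sigma]%classic =
            [set sg | all_tie_free sg]%classic.
  by apply/seteqP; split=> sg /heart_admissibleE.
have E T : (spine_sum Y)@_T =
    \sum_(sg <- fset_set [set sg | all_tie_free sg]%classic)
       (if permuted_symbol Y sg == T then q ^+ spine_length sg else 0).
  rewrite /spine_sum hset fsbig_finite // raddf_sum /=; apply: eq_bigr => sg _.
  rewrite mcoeffZ /basis_vector mcoeffU.
  by case: eqP => _; rewrite ?mulr1 ?mulr0.
move=> T; rewrite E; split=> [b R|nR].
  have [sg tf eb] := rearranges_perm R.
  have fl := all_tie_free_finite tf.
  have sgA : sg \in fset_set [set sg | all_tie_free sg]%classic.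
    by rewrite in_fset_set //; apply: mem_set.
  have eT : permuted_symbol Y sg = T.
    apply: ent_inj => i x; apply/entP/entP.
      by move=> /(permuted_symbolP fl)/(rearranges_row_set R eb).
    by move=> /(rearranges_row_set R eb)/(permuted_symbolP fl).
  rewrite (big_rem sg) //= eT eqxx big1_seq ?addr0.
    by rewrite spine_length_total // (total_inv_ext eb).
  move=> sg' /andP[_]; rewrite (rem_filter _ (fset_uniq _)) mem_filter /= => /andP[ne].
  rewrite in_fset_set // => /set_mem /= tf'; case: eqP => // eT'; case/eqP: ne.
  have fl' := all_tie_free_finite tf'.
  have R1 := permuted_symbol_rearranges fl; have R2 := permuted_symbol_rearranges fl'.
  rewrite eT in R1; rewrite eT' in R2.
  apply: functional_extensionality_dep => j.
  apply: (tie_free_unique (@Y_mono j) (tf' j) (tf j)) => k /=.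
  have := rearranges_unique R2 R1 (le_height_row hv k).
  by rewrite /permuted !spine_entryE.
rewrite big1_seq // => sg /andP[_]; rewrite in_fset_set // => /set_mem /= tf.
case: eqP => // eT; case: (nR (permuted sg)).
by rewrite -eT; exact: (permuted_symbol_rearranges (all_tie_free_finite tf)).
Qed.

End SpineSum.

(** * Scalars, modules and the bar involution *)

Section Scalars.
Local Open Scope ring_scope.
Local Open Scope quotient_scope.
Local Notation tf := (@FracField.tofrac {poly rat}).

Lemma frac_numden (f : Qq) : f = tf \n_(repr f) / tf \d_(repr f).
Proof.
have d0 : tf \d_(repr f) != 0 by rewrite tofrac_eq0 denom_ratioP.
apply: (mulIf d0); rewrite divfK // -{1}[f]reprK.
move: (repr f) => x {f d0}; rewrite !piE; apply/eqmodP => /=.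
rewrite /FracField.equivf /FracField.mulf !numden_Ratio ?mulf_neq0 ?oner_neq0 ?denom_ratioP //.
by rewrite !mulr1 mulrC.
Qed.

Lemma ratrE : @ratr Qq =1 tf \o polyC.
Proof. by move=> x; rewrite (fmorph_eq_rat (tf \o polyC : {rmorphism rat -> Qq})). Qed.

Lemma at_qinvE p : at_qinv p = (map_poly (tf \o polyC) p).[q^-1].
Proof. by rewrite /at_qinv (eq_map_poly ratrE). Qed.

Lemma at_qinvB p p' : at_qinv (p - p') = at_qinv p - at_qinv p'.
Proof. by rewrite !at_qinvE rmorphB hornerD hornerN. Qed.

Lemma at_qinvM p p' : at_qinv (p * p') = at_qinv p * at_qinv p'.
Proof. by rewrite !at_qinvE rmorphM hornerM. Qed.

Lemma at_qinv1 : at_qinv 1 = 1.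
Proof. by rewrite at_qinvE rmorph1 hornerC. Qed.

Lemma at_qinvX : at_qinv 'X = q^-1.
Proof. by rewrite at_qinvE map_polyX hornerX. Qed.

(** The reciprocal polynomial, which clears the denominator of p(1/q). *)
Definition revp (p : {poly rat}) : {poly rat} := \poly_(i < size p) p`_((size p).-1 - i).

Lemma at_qinv_rev p : at_qinv p = tf (revp p) / q ^+ (size p).-1.
Proof.
have [->|p0] := eqVneq p 0.
  rewrite /revp size_poly0 poly_def big_ord0 tofrac0 mul0r.
  by rewrite at_qinvE rmorph0 horner0.
have sp : (0 < size p)%N by rewrite size_poly_gt0.
apply: (canRL (mulfK (expf_neq0 _ q_neq0))).
rewrite at_qinvE (@horner_coef_wide _ (size p)) ?size_poly // big_distrl /=.
rewrite /revp poly_def raddf_sum [RHS](reindex_inj rev_ord_inj) /=.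
apply: eq_bigr => i _; rewrite coef_map /= -mul_polyC rmorphM rmorphXn /= -/q.
have ip : (i <= (size p).-1)%N by rewrite -ltnS prednK.
have e1 : (size p - i.+1 = (size p).-1 - i)%N by rewrite -{1}(prednK sp) subSS.
rewrite e1 subKn // -mulrA; congr (_ * _).
by rewrite exprVn -{1}(subnK ip) exprD mulrCA mulVf ?mulr1 // expf_neq0 // q_neq0.
Qed.

Lemma revp_neq0 p : p != 0 -> revp p != 0.
Proof.
move=> p0; have sp : (0 < size p)%N by rewrite size_poly_gt0.
apply/eqP => /(congr1 (fun u : {poly rat} => u`_0)).
rewrite coef_poly sp subn0 coef0 -/(lead_coef p) => /eqP.
by rewrite lead_coef_eq0 (negbTE p0).
Qed.

Lemma at_qinv_neq0 p : p != 0 -> at_qinv p != 0.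
Proof.
move=> p0; rewrite at_qinv_rev; apply: mulf_neq0.
  by rewrite tofrac_eq0 revp_neq0.
by rewrite invr_neq0 // expf_neq0 // q_neq0.
Qed.

(** Independence of the representative chosen by [repr]: [at_qinv] is multiplicative and kills no
    nonzero polynomial, so it respects cross multiplication. *)
Lemma subst_qinvE a b : b != 0 -> subst_qinv (tf a / tf b) = at_qinv a / at_qinv b.
Proof.
move=> b0; rewrite /subst_qinv; set f := repr _.
have d0 : \d_f != 0 := denom_ratioP f.
apply/eqP; rewrite eqr_div ?at_qinv_neq0 // -!at_qinvM; apply/eqP; congr at_qinv.
have := frac_numden (tf a / tf b); rewrite -/f => /eqP.
by rewrite eqr_div ?tofrac_eq0 // -!tofracM tofrac_eq => /eqP ->; rewrite mulrC.
Qed.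

Lemma frac_ex (f : Qq) : exists a b, b != 0 /\ f = tf a / tf b.
Proof. by exists \n_(repr f), \d_(repr f); split; [exact: denom_ratioP|exact: frac_numden]. Qed.

Lemma subst_qinvM f g : subst_qinv (f * g) = subst_qinv f * subst_qinv g.
Proof.
have [a [b [b0 ->]]] := frac_ex f; have [c [d [d0 ->]]] := frac_ex g.
rewrite mulf_div -!tofracM !subst_qinvE ?mulf_neq0 // !at_qinvM.
by rewrite mulf_div.
Qed.

Lemma subst_qinvB f g : subst_qinv (f - g) = subst_qinv f - subst_qinv g.
Proof.
have [a [b [b0 ->]]] := frac_ex f; have [c [d [d0 ->]]] := frac_ex g.
rewrite -mulNr addf_div ?tofrac_eq0 // mulNr -!tofracM -tofracB !subst_qinvE ?mulf_neq0 //.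
rewrite at_qinvB !at_qinvM -[in RHS]mulNr addf_div ?at_qinv_neq0 //.
by rewrite mulNr.
Qed.

Lemma subst_qinv_poly a : subst_qinv (tf a) = at_qinv a.
Proof. by rewrite -[tf a]divr1 -tofrac1 subst_qinvE ?oner_neq0 // at_qinv1 divr1. Qed.

Lemma subst_qinv1 : subst_qinv 1 = 1.
Proof. by rewrite -tofrac1 subst_qinv_poly at_qinv1. Qed.

Lemma subst_qinvV f : subst_qinv f^-1 = (subst_qinv f)^-1.
Proof.
have [->|f0] := eqVneq f 0.
  by rewrite invr0 -(subrr 1) subst_qinvB subrr invr0.
have e : subst_qinv f^-1 * subst_qinv f = 1 by rewrite -subst_qinvM mulVf // subst_qinv1.
have s0 : subst_qinv f != 0.
  by apply: contra_eq_neq e => ->; rewrite mulr0 eq_sym oner_neq0.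
by apply: (mulIf s0); rewrite e mulVf.
Qed.

Lemma subst_qinv_q : subst_qinv q = q^-1.
Proof. by rewrite subst_qinv_poly at_qinvX. Qed.

Lemma subst_qinvX f n : subst_qinv (f ^+ n) = subst_qinv f ^+ n.
Proof. by elim: n => [|n IH]; rewrite ?expr0 ?subst_qinv1 // !exprS subst_qinvM IH. Qed.

Lemma subst_qinv_qint r : subst_qinv (qint r) = qint r.
Proof.
rewrite /qint subst_qinvM subst_qinvV !subst_qinvB !subst_qinvV subst_qinvX subst_qinv_q.
by rewrite !invrK exprVn invrK -!(opprB (q ^+ r)) -(opprB q) invrN mulrNN.
Qed.

Lemma subst_qinv_qfact a : subst_qinv (qfact a)^-1 = (qfact a)^-1.
Proof.
rewrite subst_qinvV; congr (_^-1); elim: a => [|a IH]; first by rewrite qfact0 subst_qinv1.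
by rewrite qfactS subst_qinvM IH subst_qinv_qint.
Qed.

(** The denominator of [c] is prime to ['X], so [a] is [q] times a polynomial [g]. Invariance then
    equates [revp g] with [g] multiplied by a positive power of ['X], which is too large in degree
    unless [g] is 0. *)
Lemma bar_invariant_eq0 a c : int_laurent a -> regular_at0 c -> a = q * c ->
  subst_qinv a = a -> a = 0.
Proof.
move=> [P0 [n ->]] [r [s [s0 ->]]]; set P := map_poly _ P0.
have sn0 : s != 0 by apply: contraNneq s0 => ->; rewrite horner0.
move=> e.
have {}e : P * s = 'X^(n.+1) * r.
  apply/eqP; rewrite -tofrac_eq !tofracM tofracXn -/q; apply/eqP.
  have : tf P * tf s = q * tf r * q ^+ n.
    have := congr1 (fun z => z * q ^+ n * tf s) e.
    rewrite divfK ?expf_neq0 ?q_neq0 // => ->.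
    by rewrite mulrAC -!mulrA [X in q * X]mulrC !mulrA divfK ?tofrac_eq0 // mulrAC.
  by rewrite exprS => ->; rewrite mulrAC.
have cop : coprimep 'X^(n.+1) s.
  apply: coprimep_expl; rewrite coprimep_sym.
  by have := coprimep_XsubC s 0; rewrite polyC0 subr0 => ->.
have : 'X^(n.+1) %| P by rewrite -(Gauss_dvdpl _ cop) e dvdp_mulr.
move=> /dvdpP[g ->]; rewrite tofracM tofracXn -/q exprS mulrA.
rewrite mulfK ?expf_neq0 ?q_neq0 // [_ * q]mulrC.
have [->|g0] := eqVneq g 0; first by rewrite tofrac0 mulr0.
rewrite subst_qinvM subst_qinv_q subst_qinv_poly at_qinv_rev => e'.
exfalso; have : 'X^((size g).-1 + 2) * g = revp g.
  apply/eqP; rewrite -tofrac_eq tofracM tofracXn -/q; apply/eqP.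
  have := congr1 (fun z => q * z * q ^+ (size g).-1) e'.
  rewrite !mulrA mulfV ?q_neq0 // mul1r divfK ?expf_neq0 ?q_neq0 // => ->.
  by rewrite addnC exprD expr2 mulrAC.
move=> /(congr1 (fun u : {poly rat} => size u)); rewrite size_monicM ?monicXn // size_polyXn.
have := size_poly (size g) (fun i => g`_((size g).-1 - i)); rewrite -/(revp g).
have : (0 < size g)%N by rewrite size_poly_gt0.
move=> h1 h2 h3; move: h1 h2; rewrite -h3; move: (size g) => k; lia.
Qed.

Lemma int_laurent_intX (a : {poly int}) (k : int) :
  int_laurent (tf (map_poly intr a) * q ^ k).
Proof.
case: k => k.
  exists (a * 'X^k), 0%N; rewrite expr0 divr1 rmorphM /= map_polyXn tofracM tofracXn.
  by [].
exists a, k.+1; by rewrite NegzE exprnN.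
Qed.

Lemma int_laurentX k : int_laurent (q ^ k).
Proof. by have := int_laurent_intX 1 k; rewrite rmorph1 tofrac1 mul1r. Qed.

Lemma int_laurent0 : int_laurent 0.
Proof. by have := int_laurent_intX 0 0; rewrite rmorph0 tofrac0 mul0r. Qed.

Lemma int_laurent1 : int_laurent 1.
Proof. exact: (int_laurentX 0). Qed.

Lemma int_laurentD f g : int_laurent f -> int_laurent g -> int_laurent (f + g).
Proof.
move=> [a [n ->]] [b [m ->]]; exists (a * 'X^m + b * 'X^n), (n + m)%N.
rewrite rmorphD !rmorphM /= !map_polyXn tofracD !tofracM !tofracXn -/q exprD.
exact: (addf_div _ _ (expf_neq0 n q_neq0) (expf_neq0 m q_neq0)).
Qed.

Lemma int_laurentM f g : int_laurent f -> int_laurent g -> int_laurent (f * g).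
Proof.
move=> [a [n ->]] [b [m ->]]; exists (a * b), (n + m)%N.
by rewrite rmorphM tofracM exprD mulf_div.
Qed.

Lemma int_laurent_sum (I : finType) (P : pred I) (F : I -> Qq) :
  (forall i, P i -> int_laurent (F i)) -> int_laurent (\sum_(i | P i) F i).
Proof.
move=> H; apply: big_ind => //; [exact: int_laurent0|exact: int_laurentD].
Qed.

Lemma regular_poly a : regular_at0 (tf a).
Proof. by exists a, 1; rewrite hornerC oner_neq0 tofrac1 divr1. Qed.

Lemma regularB f g : regular_at0 f -> regular_at0 g -> regular_at0 (f - g).
Proof.
move=> [a [b [b0 ->]]] [c [d [d0 ->]]].
have bn0 : b != 0 by apply: contraNneq b0 => ->; rewrite horner0.
have dn0 : d != 0 by apply: contraNneq d0 => ->; rewrite horner0.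
exists (a * d - c * b), (b * d); rewrite hornerM mulf_neq0 //; split=> //.
by rewrite -mulNr addf_div ?tofrac_eq0 // mulNr -!tofracM -tofracB.
Qed.

Lemma regularM f g : regular_at0 f -> regular_at0 g -> regular_at0 (f * g).
Proof.
move=> [a [b [b0 ->]]] [c [d [d0 ->]]].
exists (a * c), (b * d); rewrite hornerM mulf_neq0 //; split=> //.
by rewrite mulf_div !tofracM.
Qed.

Lemma regular0 : regular_at0 0.
Proof. by rewrite -tofrac0; exact: regular_poly. Qed.

Lemma regularD f g : regular_at0 f -> regular_at0 g -> regular_at0 (f + g).
Proof.
move=> hf hg; rewrite -[g]opprK; apply: regularB => //.
by rewrite -sub0r; apply: regularB => //; exact: regular0.
Qed.

End Scalars.

Section Span.
Local Open Scope ring_scope.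
Variables (M : lmodType Qq) (A : set Qq) (B : set M).
Implicit Types (u w : M).
Hypothesis A1 : A 1.
Hypothesis AM : forall c d, A c -> A d -> A (c * d).

Lemma span_overD u w : span_over A B u -> span_over A B w -> span_over A B (u + w).
Proof.
move=> [n [c [b [h ->]]]] [m [d [e [k ->]]]].
exists (n + m)%N, (fun i => match split i with inl a => c a | inr a => d a end),
  (fun i => match split i with inl a => b a | inr a => e a end); split.
  by move=> i; case: (split i) => a; [exact: h|exact: k].
rewrite big_split_ord; congr (_ + _); apply: eq_bigr => i _.
  by rewrite -[lshift _ _]/(unsplit (inl i)) unsplitK.
by rewrite -[rshift _ _]/(unsplit (inr i)) unsplitK.
Qed.

Lemma span_overZ (c : Qq) u : A c -> span_over A B u -> span_over A B (c *: u).
Proof.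
move=> Ac [n [d [b [h ->]]]]; exists n, (fun i => c * d i), b; split.
  by move=> i; have [h1 h2] := h i; split=> //; exact: AM.
by rewrite scaler_sumr; apply: eq_bigr => i _; rewrite scalerA.
Qed.

Lemma span_over_base u : B u -> span_over A B u.
Proof.
move=> Bu; exists 1%N, (fun=> 1), (fun=> u); split=> //.
by rewrite big_ord1 scale1r.
Qed.

Lemma span_over0 : span_over A B 0.
Proof.
exists 0%N, (fun=> 0), (fun=> 0); split; first by case.
by rewrite big_ord0.
Qed.

Lemma span_over_sum (I : Type) (r : seq I) (P : pred I) (G : I -> M) :
  (forall i, P i -> span_over A B (G i)) -> span_over A B (\sum_(i <- r | P i) G i).
Proof. by move=> H; apply: big_ind => //; [exact: span_over0|exact: span_overD]. Qed.

End Span.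

(** * The module V, its integral form and the regular lattice *)

Section FockModule.
Local Open Scope ring_scope.
Variables (l : nat) (v : 'I_l -> int).
Implicit Types (u w : fock v) (T : symbol v) (x : int).

Lemma FopZ x (c : Qq) u : Fop x (c *: u) = c *: Fop x u.
Proof.
have F0 : Fop x (0 : fock v) = 0.
  by apply/malgP => T; rewrite mcoeff_Fop mcoeff0 big1 // => j _; rewrite mcoeff0 mulr0.
by rewrite -[c *: u]addr0 Fop_linear F0 addr0.
Qed.

Lemma FopD x u w : Fop x (u + w) = Fop x u + Fop x w.
Proof. by rewrite -[u]scale1r Fop_linear !scale1r. Qed.

Lemma Fop_sum x (I : Type) (r : seq I) (P : pred I) (G : I -> fock v) :
  Fop x (\sum_(i <- r | P i) G i) = \sum_(i <- r | P i) Fop x (G i).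
Proof.
apply: (big_morph (Fop x)) => [u w|]; first exact: FopD.
by rewrite -[X in Fop x X](scale0r (0 : fock v)) FopZ scale0r.
Qed.

Local Notation V := (@V_module l v).

Lemma V_moduleD u w : V u -> V w -> V (u + w).
Proof. exact: span_overD. Qed.

Lemma V_moduleZ (c : Qq) u : V u -> V (c *: u).
Proof. exact: span_overZ. Qed.

Lemma V_moduleB u w : V u -> V w -> V (u - w).
Proof. by move=> hu hw; rewrite -scaleN1r; apply: V_moduleD => //; exact: V_moduleZ. Qed.

Lemma V_module_empty : V (basis_vector (empty_symbol v)).
Proof. by apply: span_over_base => //; exists [::]. Qed.

Lemma V_module_Fop x u : V u -> V (Fop x u).
Proof.
move=> [n [c [b [h ->]]]]; rewrite Fop_sum; apply: span_over_sum => i _.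
rewrite FopZ; apply: V_moduleZ; apply: span_over_base => //.
by have [_ [w _ <-]] := h i; exists (x :: w).
Qed.

Lemma V_module_Fdiv x a u : V u -> V (Fdiv x a u).
Proof.
move=> Vu; rewrite /Fdiv; apply: V_moduleZ; elim: a => //= a IH; exact: V_module_Fop.
Qed.

Lemma V_module_Fdiv_word (w : seq (int * nat)) : V (Fdiv_word v w).
Proof.
by elim: w => [|p w IH] /=; [exact: V_module_empty|exact: V_module_Fdiv].
Qed.

Lemma V_integral_module u : @V_integral l v u -> V u.
Proof.
move=> [n [c [b [h ->]]]]; apply: span_over_sum => i _; apply: V_moduleZ.
by have [_ [w _ <-]] := h i; exact: V_module_Fdiv_word.
Qed.

(** The formula [mcoeff_Fdiv] is free of denominators. *)
Lemma Fdiv_word_integral (w : seq (int * nat)) T : int_laurent (Fdiv_word v w)@_T.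
Proof.
elim: w T => [|[x a] w IH] T /=.
  rewrite mcoeffU; case: eqP => _; [exact: int_laurent1|exact: int_laurent0].
rewrite mcoeff_Fdiv; apply: int_laurent_sum => A _; apply: int_laurentM; last exact: IH.
exact: int_laurentX.
Qed.

Lemma V_integral_coef u T : @V_integral l v u -> int_laurent u@_T.
Proof.
move=> [n [c [b [h ->]]]]; rewrite raddf_sum /=; apply: int_laurent_sum => i _.
rewrite mcoeffZ; have [h1 [w _ <-]] := h i.
by apply: int_laurentM => //; exact: Fdiv_word_integral.
Qed.

Lemma V_integral_Fdiv_word (w : seq (int * nat)) : @V_integral l v (Fdiv_word v w).
Proof. by apply: span_over_base; [exact: int_laurent1|exists w]. Qed.

Lemma fock_regularP u : @fock_regular l v u <-> forall T, regular_at0 u@_T.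
Proof.
split=> [[n [c [b [h ->]]]] T|H].
  rewrite raddf_sum /=; apply: big_ind => [||i _].
  - exact: regular0.
  - exact: regularD.
  - rewrite mcoeffZ; have [h1 [S _ <-]] := h i; apply: regularM => //.
    rewrite mcoeffU; case: eqP => _; last exact: regular0.
    by rewrite -[1%R *+ _]tofrac1; exact: regular_poly.
rewrite (monalgE u); apply: span_over_sum => S _.
rewrite (_ : << u@_S *g S >> = u@_S *: basis_vector S); last first.
  by apply/malgP => T; rewrite mcoeffZ !mcoeffU; case: eqP => _; rewrite ?mulr1 ?mulr0.
exists 1%N, (fun=> u@_S), (fun=> basis_vector S); split; last by rewrite big_ord1.
by move=> i; split=> //; exists S.
Qed.

Section Bar.
Variable bar : fock v -> fock v.
Hypothesis hbar : bar_involution bar.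

Lemma bar_Fdiv_word (w : seq (int * nat)) : bar (Fdiv_word v w) = Fdiv_word v w.
Proof.
have [_ _ bZ bF b0] := hbar; elim: w => [|[x a] w IH] //=.
rewrite /Fdiv.
have E m : V (iter m (Fop x) (Fdiv_word v w)) /\
    bar (iter m (Fop x) (Fdiv_word v w)) = iter m (Fop x) (Fdiv_word v w).
  elim: m => [|m [Vm em]] /=; first by split=> //; exact: V_module_Fdiv_word.
  split; first exact: (V_module_Fop x Vm).
  exact: (etrans (bF x _ Vm) (congr1 (Fop x) em)).
have [Va ea] := E a.
exact: (etrans (bZ _ _ Va) (congr2 *:%R (subst_qinv_qfact a) ea)).
Qed.

End Bar.

Section WindowedVectors.
Variables (N : int) (n : nat).

Definition windowed_vector u : Prop := forall T, u@_T != 0 -> windowed N n T.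

Lemma windowed_vectorB (c : Qq) u w : windowed_vector u -> windowed_vector w ->
  windowed_vector (u - c *: w).
Proof.
move=> hu hw T; have [e|/hu//] := eqVneq u@_T 0.
have [e'|/hw//] := eqVneq w@_T 0.
by rewrite mcoeffB mcoeffZ e e' mulr0 subrr eqxx.
Qed.

Lemma windowed_Fdiv x a u : N <= x -> x + 1 < N + n%:Z -> windowed_vector u ->
  windowed_vector (Fdiv x a u).
Proof.
move=> Nx xn hu T; rewrite mcoeff_Fdiv => h.
have [A _ hA] : exists2 A : {set 'I_l}, true & u@_(swapS x A T) != 0.
  apply: contrapT => nA; move/eqP: h; apply; apply: big1 => A _.
  have [->|e] := eqVneq u@_(swapS x A T) 0; first by rewrite mulr0.
  by case: nA; exists A.
by rewrite -[T](swapSK x A); apply: windowed_swap => //; exact: hu.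
Qed.

Lemma windowed_empty : (forall i, N <= v i) -> (forall i, v i < N + n%:Z) ->
  windowed N n (empty_symbol v).
Proof.
move=> Nv vN; split=> i y yN.
  apply/entP; exists y; first by have := Nv i; lia.
  by rewrite /= ifT //; have := Nv i; lia.
apply/entP => -[j ji] /=; rewrite ji => e; have := vN i; lia.
Qed.

Definition letters_in (w : seq (int * nat)) : Prop :=
  forall p, p \in w -> N <= p.1 /\ p.1 + 1 < N + n%:Z.

Lemma windowed_Fdiv_word (w : seq (int * nat)) : (forall i, N <= v i) -> (forall i, v i < N + n%:Z) ->
  letters_in w -> windowed_vector (Fdiv_word v w).
Proof.
move=> Nv vN; elim: w => [|p w IH] hw /=.
  move=> T; rewrite mcoeffU; have [<- _|_] := eqVneq (empty_symbol v) T.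
    exact: windowed_empty.
  by rewrite mulr0n eqxx.
have [h1 h2] := hw p (mem_head _ _).
by apply: windowed_Fdiv => //; apply: IH => r rw; apply: hw; rewrite inE rw orbT.
Qed.

End WindowedVectors.

End FockModule.

(** * Monomials with a prescribed standard leading symbol *)

Section BinaryWeights.

Lemma sum_pow2_injective_lt (I : finType) (r : I -> nat) (P : pred I) m :
  injective r -> (forall p, P p -> r p < m) -> \sum_(p | P p) 2 ^ r p < 2 ^ m.
Proof.
move=> rinj; elim: m P => [|m IH] P Pm.
  by rewrite big_pred0 // => p; apply/negbTE/negP => /Pm.
case: (pickP (fun p => P p && (r p == m))) => [p0 /andP[Pp0 /eqP e0]|no].
  rewrite (bigD1 p0) //= e0 expnS mul2n -addnn ltn_add2l; apply: IH => p /andP[Pp pp].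
  have := Pm p Pp; rewrite ltnS leq_eqVlt => /orP[/eqP e|//].
  by case/eqP: pp; apply: rinj; rewrite e e0.
apply: leq_trans (IH P _) _; last by rewrite leq_exp2l.
move=> p Pp; have := Pm p Pp; rewrite ltnS leq_eqVlt => /orP[e|//].
by have := no p; rewrite Pp e.
Qed.

Lemma binary_lt (I : finType) (r : I -> nat) (f g : I -> bool) p0 :
  injective r -> ~~ f p0 -> g p0 -> (forall p, r p0 < r p -> f p = g p) ->
  \sum_p 2 ^ r p * f p < \sum_p 2 ^ r p * g p.
Proof.
move=> rinj f0 g0 hi.
have E (h : I -> bool) : \sum_p 2 ^ r p * h p =
    \sum_(p | r p < r p0) 2 ^ r p * h p + 2 ^ r p0 * h p0 + \sum_(p | r p0 < r p) 2 ^ r p * h p.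
  rewrite (bigID (fun p => r p < r p0)) /= -addnA; congr addn.
  rewrite (bigD1 p0) /=; last by rewrite ltnn.
  congr addn; apply: eq_bigl => p; rewrite -leqNgt ltn_neqAle andbC; congr andb.
  by apply/idP/idP; apply: contra => /eqP; [move/rinj => ->|move=> ->].
rewrite !E g0 (negbTE f0) muln0 muln1 addn0.
have -> : \sum_(p | r p0 < r p) 2 ^ r p * f p = \sum_(p | r p0 < r p) 2 ^ r p * g p.
  by apply: eq_bigr => p /hi ->.
rewrite ltn_add2r; apply: leq_trans (leq_addl _ _).
apply: leq_ltn_trans (@sum_pow2_injective_lt I r (fun p => r p < r p0) _ rinj _) => //.
by apply: leq_sum => p _; case: (f p); rewrite ?muln1 ?muln0.
Qed.

Lemma binary_inj (I : finType) (r : I -> nat) (f g : I -> bool) :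
  injective r -> \sum_p 2 ^ r p * f p = \sum_p 2 ^ r p * g p -> f =1 g.
Proof.
move=> rinj e p; apply/eqP; apply: contraT => np.
case: (@arg_maxnP I p (fun p => f p != g p) r np) => p0 np0 pmax.
have hi p' : r p0 < r p' -> f p' = g p'.
  by move=> lt; apply/eqP; apply: contraT => /pmax /=; rewrite leqNgt lt.
have [fp|fp] := boolP (f p0); have [gp|gp] := boolP (g p0).
- by rewrite fp gp in np0.
- by have := binary_lt rinj gp fp (fun p' h => esym (hi p' h)); rewrite e ltnn.
- by have := binary_lt rinj fp gp hi; rewrite e ltnn.
- by rewrite (negbTE fp) (negbTE gp) in np0.
Qed.

(** Exchange argument: with [m] of least weight in [A :\: C], all elements of [C] precede [m], so
    each element of [C :\: A] weighs at most [w m] and each of [A :\: C] at least [w m]. *)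
Lemma initial_segment_weight (l : nat) (w : 'I_l -> nat) (A C : {set 'I_l}) :
  (forall i j : 'I_l, i <= j -> w i <= w j) -> #|A| = #|C| ->
  (forall i j : 'I_l, i <= j -> j \in C -> i \in C) ->
  \sum_(i in C) w i <= \sum_(i in A) w i.
Proof.
move=> wmono cAC Cdown.
rewrite (big_setID A) [X in _ <= X](big_setID C) /= setIC leq_add2l.
have cD : #|C :\: A| = #|A :\: C|.
  by have := cardsID A C; have := cardsID C A; rewrite setIC cAC; lia.
have [D0|[i0 i0D]] := set_0Vmem (A :\: C).
  by move: cD; rewrite D0 cards0 => /eqP; rewrite cards_eq0 => /eqP ->; rewrite !big_set0.
case: (arg_minnP w i0D) => m /= mD mmin.
apply: (@leq_trans (#|C :\: A| * w m)).
  rewrite -sum_nat_const; apply: leq_sum => i; rewrite inE => /andP[_ iC].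
  apply: wmono; rewrite leqNgt; apply/negP => mi.
  have : m \in A :\: C := mD.
  by rewrite inE => /andP[/negP mC _]; apply: mC; exact: (Cdown _ _ (ltnW mi) iC).
rewrite cD -sum_nat_const; apply: leq_sum => i iD; exact: mmin.
Qed.

End BinaryWeights.

Section StandardMonomials.
Local Open Scope ring_scope.
Variables (l : nat) (v : 'I_l -> int).
Hypothesis hv : forall i j : 'I_l, (i <= j)%N -> v j <= v i.
Variables (N : int) (n : nat).
Implicit Types (S T : symbol v) (x y : int) (A B : {set 'I_l}).

Lemma row_ge (s : int) (b : row s) j : j <= s -> j <= b j.
Proof.
case: (rowP b) => _ [N0 h0] _; elim/(@row_ind N0): j => [j jN js|j IH js].
  by rewrite h0.
have j1 : j - 1 <= s by lia.
have lt : j - 1 < j by lia.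
by have := IH _ lt j1; have := row_lt b lt js; lia.
Qed.

Lemma row_prefix (s : int) (b : row s) y : (forall z, z <= y -> row_set b z) ->
  forall z, z <= y -> z <= s /\ b z = z.
Proof.
move=> H; case: (rowP b) => _ [N0 h0] _.
elim/(@row_ind (Num.min N0 s)) => [z zN zy|z IH zy].
  by split; [|apply: h0]; lia.
have [m ms bm] := H z zy.
have mz : m <= z by rewrite -bm row_ge.
have [e|mz'] := eqVneq m z; first by split; rewrite -e // bm e.
have lt : m < z by lia.
have [_ e] := IH m lt ltac:(lia).
by move: lt; rewrite -bm e ltxx.
Qed.

(** The tail sums can be followed through F_x: moving entries between the columns e and e + 1
    affects only the tail that starts at e + 1. *)
Definition tail_weight (d : nat) (i : 'I_l) (e : nat) : nat := ((d <= e) * 2 ^ i)%N.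
Definition tail_sum d T : nat := weight_sum N n (tail_weight d) T.
(* The entries are read as binary digits, so that the key compares the columns from
   right to left, and within a column from the bottom row up. *)
Definition key_weight (i : 'I_l) (d : nat) : nat := (2 ^ (l * d + i))%N.
Definition key T : nat := weight_sum N n key_weight T.
Definition col_size T y : nat := #|[set i | ent T i y]|.

Lemma windowed_ext S T : windowed N n S -> windowed N n T ->
  (forall i (d : 'I_n), ent S i (N + d%:Z) = ent T i (N + d%:Z)) -> S = T.
Proof.
move=> [S1 S2] [T1 T2] H; apply: ent_inj => i y.
have [yN|Ny] := ltP y N; first by rewrite S1 // T1.
have [ny|yn] := leP (N + n%:Z) y; first by rewrite (negbTE (S2 _ _ ny)) (negbTE (T2 _ _ ny)).
have dn : (absz (y - N)%R < n)%N by lia.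
by have := H i (Ordinal dn); rewrite /= (_ : N + _ = y) //; lia.
Qed.

Lemma key_rank_inj : injective (fun p : 'I_l * 'I_n => (l * p.2 + p.1)%N).
Proof.
move=> [i d] [i' d'] /= e.
have l0 : (0 < l)%N by apply: leq_ltn_trans (ltn_ord i).
have ed : d = d'.
  apply: val_inj => /=; have := congr1 (fun m => m %/ l)%N e.
  by rewrite ![(l * _)%N]mulnC !divnMDl // !divn_small // !addn0.
by move: e; rewrite ed => /addnI e; rewrite (val_inj e).
Qed.

Lemma keyE T : key T =
  (\sum_(p : 'I_l * 'I_n) 2 ^ (l * p.2 + p.1) * ent T p.1 (N + (p.2 : nat)%:Z)%R)%N.
Proof. by rewrite /key /weight_sum pair_bigA. Qed.

Lemma key_inj S T : windowed N n S -> windowed N n T -> key S = key T -> S = T.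
Proof.
move=> wS wT; rewrite !keyE => e; apply: windowed_ext => // i d.
exact: (binary_inj key_rank_inj e (i, d)).
Qed.

Lemma key_lt S T (i0 : 'I_l) (d0 : 'I_n) : ~~ ent S i0 (N + (d0 : nat)%:Z) -> ent T i0 (N + (d0 : nat)%:Z) ->
  (forall (i : 'I_l) (d : 'I_n), (l * d0 + i0 < l * d + i)%N ->
     ent S i (N + (d : nat)%:Z) = ent T i (N + (d : nat)%:Z)) ->
  (key S < key T)%N.
Proof.
move=> h1 h2 h3; rewrite !keyE.
apply: (@binary_lt _ _ (fun p : 'I_l * 'I_n => ent S p.1 (N + (p.2 : nat)%:Z))
  (fun p : 'I_l * 'I_n => ent T p.1 (N + (p.2 : nat)%:Z)) (i0, d0) key_rank_inj) => // -[i d] /=.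
exact: h3.
Qed.

(** Abel summation: the column weights of [key] are partial sums of these nonnegative numbers, so
    [key] is monotone in the tail sums. *)
Definition abel_coef (d : nat) : nat :=
  if d is d'.+1 then (2 ^ (l * d) - 2 ^ (l * d'))%N else 1%N.

Lemma sum_abel_coef e : (\sum_(d < e.+1) abel_coef d)%N = (2 ^ (l * e))%N.
Proof.
elim: e => [|e IH]; first by rewrite big_ord1 muln0.
rewrite big_ord_recr /= IH addnC subnK // leq_exp2l // leq_mul2l leqnSn orbT.
by [].
Qed.

Lemma key_abel T : key T = (\sum_(d < n) abel_coef d * tail_sum d T)%N.
Proof.
rewrite /tail_sum /key /weight_sum.
rewrite [RHS](eq_bigr (fun d : 'I_n => \sum_(i < l) \sum_(e < n)
    abel_coef d * (tail_weight d i e * ent T i (N + (e : nat)%:Z)%R))%N); last first.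
  by move=> d _; rewrite big_distrr; apply: eq_bigr => i _; rewrite big_distrr.
rewrite [RHS]exchange_big; apply: eq_bigr => i _.
rewrite [RHS]exchange_big; apply: eq_bigr => e _.
rewrite /key_weight expnD -sum_abel_coef (big_ord_widen n) // big_distrl /=.
rewrite big_distrl big_mkcond /=; apply: eq_bigr => d _.
rewrite ltnS /tail_weight; case: (d <= e)%N; rewrite ?mul0n ?muln0 //.
by rewrite mul1n mulnA.
Qed.

Lemma key_tail_le S T : (forall d, (tail_sum d S <= tail_sum d T)%N) -> (key S <= key T)%N.
Proof. by move=> H; rewrite !key_abel; apply: leq_sum => d _; rewrite leq_mul2l H orbT. Qed.

Lemma tail_split d T : (d <= n)%N -> (tail_sum 0 T =
  tail_sum d T + \sum_(e < n | (e < d)%N) \sum_(i in [set i | ent T i (N + (e : nat)%:Z)%R]) 2 ^ i)%N.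
Proof.
move=> dn; rewrite /tail_sum /weight_sum.
have -> : (\sum_(e < n | (e < d)%N) \sum_(i in [set i | ent T i (N + (e : nat)%:Z)%R]) 2 ^ i =
   \sum_(i < l) \sum_(e < n) (e < d) * 2 ^ i * ent T i (N + (e : nat)%:Z)%R)%N.
  rewrite exchange_big /= big_mkcond /=; apply: eq_bigr => e _.
  case: ifP => ed; last by rewrite big1 // => i _; rewrite mul0n.
  rewrite big_mkcond /=; apply: eq_bigr => i _; rewrite inE mul1n.
  by case: (ent T i _); rewrite ?muln1 ?muln0.
rewrite -big_split /=; apply: eq_bigr => i _; rewrite -big_split /=; apply: eq_bigr => e _.
by rewrite /tail_weight leq0n mul1n -!mulnDl; case: ltnP; rewrite ?mul1n ?mul0n ?addn0.
Qed.

(** Equal column sizes and equal total weight turn a lower bound on the weight of the first columns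
    into an upper bound on the remaining tail. *)
Definition dominated S T : Prop :=
  [/\ windowed N n S, forall y, col_size S y = col_size T y,
      tail_sum 0 S = tail_sum 0 T & forall d, (tail_sum d S <= tail_sum d T)%N].

Lemma tail_sum_swap d e T A : (e.+1 < n)%N -> A \subset Dset T (N + e%:Z) ->
  d != e.+1 -> tail_sum d (swapS (N + e%:Z) A T) = tail_sum d T.
Proof.
move=> en sA de; have := weight_sum_swap (tail_weight d) en sA; rewrite -!/(tail_sum d _).
rewrite [X in (_ + X = _)%N](_ : _ = \sum_(i in A) tail_weight d i e.+1)%N; first by lia.
apply: eq_bigr => i _; rewrite /tail_weight; congr (_ * _)%N.
by rewrite [(d <= e.+1)%N]leq_eqVlt (negbTE de) ltnS.
Qed.

Lemma col_size_swap x T A : A \subset Dset T x ->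
  [/\ (col_size (swapS x A T) x = col_size T x + #|A|)%N,
      (col_size T (x + 1)%R = col_size (swapS x A T) (x + 1)%R + #|A|)%N
    & forall y, y != x -> y != x + 1 -> col_size (swapS x A T) y = col_size T y].
Proof.
move=> /subsetP sA; split=> [||y y1 y2]; rewrite /col_size.
- rewrite card_disjointU => [|i]; last first.
    by rewrite inE => e /sA; rewrite inE e andbF.
  apply: eq_card => i; rewrite !inE ent_swap; case: ifP => iA; last by rewrite orbF.
  by rewrite tauL orbT; have := sA i iA; rewrite inE => /andP[->].
- rewrite card_disjointU => [|i]; last first.
    by rewrite inE ent_swap => e iA; move: e; rewrite iA tauR; have := sA i iA; rewrite inE => /andP[_ /negbTE ->].
  apply: eq_card => i; rewrite !inE ent_swap; case: ifP => iA; last by rewrite orbF.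
  by rewrite orbT; have := sA i iA; rewrite inE => /andP[->].
- apply: eq_card => i; rewrite !inE ent_swap tau_neq //.
  by case: ifP.
Qed.

Section Step.
Variables (T : symbol v) (x : int).
Hypothesis stT : standard T.
Hypothesis xmin : forall y, y < x -> Dset T y = set0.

Lemma min_column_prefix i y : y <= x -> ent T i y -> forall z, z <= y -> ent T i z.
Proof.
move=> yx ey z zy; have [m ->] : exists m : nat, z = y - m%:Z by exists (absz (y - z)%R); lia.
elim: m => [|m IH]; first by rewrite subr0.
apply: contraT => nz; have lt : y - m.+1%:Z < x by lia.
have := in_set0 i; rewrite -(xmin lt) inE nz andbT.
by rewrite (_ : y - m.+1%:Z + 1 = y - m%:Z) ?IH //; lia.
Qed.

(** Row [i] has no gap up to [y], so its entry of index [y] is [y]. Standardness bounds the entry of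
    the same index in row [i'] by [y], and an entry is never smaller than its index. *)
Lemma min_column_top (i i' : 'I_l) y : y <= x -> (i' <= i)%N -> ent T i y -> ent T i' y.
Proof.
move=> yx ii ey.
have H z : z <= y -> row_set (T i) z.
  by move=> zy; apply/entP; exact: (min_column_prefix yx ey zy).
have [ys e] := row_prefix H (lexx y).
apply/entP; exists y; first exact: le_trans ys (hv ii).
have := standard_le hv stT ii ys; rewrite e => le; apply/eqP; rewrite eq_le le /=.
by apply: row_ge; exact: le_trans ys (hv ii).
Qed.

Lemma min_column_swap_exp : swap_exp T x (Dset T x) = 0.
Proof.
apply: big1 => j jD; apply: big1 => k /andP[jk kD]; rewrite /ent_diff.
move: jD kD; rewrite !inE => /andP[_ jx] kD.
have kx : ent T k x = false.
  by apply/negbTE; apply: contra jx; exact: min_column_top (lexx _) (ltnW jk).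
by move: kD; rewrite kx andbT => /negbTE ->.
Qed.

Lemma row_swapE (s : int) (b : row s) j : j <= s ->
  row_swap x b j = if has_one b x then tau x (b j) else b j.
Proof.
move=> js; rewrite /row_swap; case: pselect => [h|h] /=; first by rewrite h js.
by case: ifP.
Qed.

Lemma lowered_rowE i j : j <= v i -> swapS x (Dset T x) T i j =
  if (i \in Dset T x) && (T i j == x + 1) then x else T i j.
Proof.
move=> ji; rewrite /swapS; case: ifP => //= iD; rewrite row_swapE //.
move: (iD); rewrite inE /ent => /andP[h1 h2]; rewrite /has_one h1 (negbTE h2) /=.
case: (tauP x (T i j)) => [e|e|n1 n2]; last by rewrite (negbTE n2).
- by case/negP: h2; apply/asboolP; exists j.
- by rewrite e eqxx.
Qed.

Lemma lowered_standard : standard (swapS x (Dset T x) T).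
Proof.
move=> i i' ii j ji'.
have le_ii : (i <= i')%N by rewrite ii.
have ji : j <= v i := le_trans ji' (hv le_ii).
have le := stT ii ji'.
rewrite !lowered_rowE //; case: ifP => [/andP[iD /eqP e]|niD].
  by case: ifP; lia.
case: ifP => // /andP[i'D /eqP e'].
rewrite e' in le; rewrite leNgt; apply/negP => lt.
have e : T i j = x + 1 by lia.
move: niD; rewrite e eqxx andbT inE => /negbT.
have -> : ent T i (x + 1) by apply/entP; exists j.
rewrite negbK => ix.
have H z : z <= x -> row_set (T i) z.
  by move=> zx; apply/entP; exact: (min_column_prefix (lexx x) ix zx).
have [xs ex] := row_prefix H (lexx x).
have xj : x < j by rewrite -(row_ltE (T i)) // ex e; lia.
have x1s : x + 1 <= v i' by lia.
have h1 := row_ge (T i') (_ : x <= v i').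
have {}h1 := h1 ltac:(lia).
have h2 : T i' x < x + 1 by rewrite -e'; apply: row_lt.
have e2 : T i' x = x by lia.
move: i'D; rewrite inE => /andP[_ /negP]; apply; apply/entP; exists x => //.
by lia.
Qed.

End Step.

(** The leftmost possible column is lowered. Up to it, each column of [T] occupies the topmost rows,
    so its row weight is minimal for its size. A symbol with the same column sizes and total weight
    therefore has at most the tail of [T] beyond this column; all other tails are unchanged by the
    step. *)
Lemma standard_monomial T : windowed N n T -> standard T ->
  exists w : seq (int * nat), [/\ letters_in N n w, (Fdiv_word v w)@_T = 1
    & forall S, (Fdiv_word v w)@_S != 0 -> dominated S T].
Proof.
move: T; apply: lowering_ind => T wT IH stT.
case: (pselect (forall x, Dset T x = set0)) => [D0|].
  exists [::]; split=> //=.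
    by rewrite -(no_lowering_empty D0) mcoeffUU.
  move=> S; rewrite -(no_lowering_empty D0) mcoeffU.
  by have [<- _|_] := eqVneq T S; rewrite ?mulr0n ?eqxx.
move=> /existsNP[x0 /eqP x0D].
have win y : Dset T y != set0 -> N <= y /\ y + 1 < N + n%:Z.
  by move=> /set0Pn[i iD]; exact: Dset_window wT iD.
have exd : exists d : nat, Dset T (N + d%:Z) != set0.
  exists (absz (x0 - N)%R); rewrite (_ : N + _ = x0) //.
  by have := win _ x0D; lia.
case: (ex_minnP exd) => d dD dmin.
have xmin y : y < N + d%:Z -> Dset T y = set0.
  move=> yd; apply/eqP; apply: contraT => yD; have [Ny yn] := win y yD.
  have := dmin (absz (y - N)%R); rewrite (_ : N + _ = y); last by lia.
  by move=> /(_ yD); lia.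
have [Nx xn] := win _ dD; have dn : (d.+1 < n)%N by lia.
set x := N + d%:Z in dD Nx xn xmin *.
have [w [w1 w2 w3]] := IH x dD (lowered_standard stT xmin).
set T' := swapS x (Dset T x) T in w2 w3.
exists ((x, #|Dset T x|) :: w); split=> /=.
- by move=> p; rewrite inE => /orP[/eqP ->//|]; exact: w1.
- rewrite mcoeff_Fdiv (bigD1 (Dset T x)) /=; last by rewrite subxx eqxx.
  rewrite big1 ?addr0; last first.
    move=> A /andP[/andP[sA /eqP cA]] /eqP nA; case: nA.
    by apply/eqP; rewrite eqEcard sA cA leqnn.
  rewrite (min_column_swap_exp stT xmin) expr0z mul1r.
  exact: w2.
move=> S; rewrite mcoeff_Fdiv => h.
have [A /andP[sA /eqP cA] hA] : exists2 A : {set 'I_l},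
    (A \subset Dset S x) && (#|A| == #|Dset T x|) & (Fdiv_word v w)@_(swapS x A S) != 0.
  apply: contrapT => nA; move/eqP: h; apply; apply: big1 => A hA.
  have [->|e] := eqVneq (Fdiv_word v w)@_(swapS x A S) 0; first by rewrite mulr0.
  by case: nA; exists A.
have [wS' cS' t0S' tS'] := w3 _ hA.
have wS : windowed N n S by rewrite -[S](swapSK x A); exact: windowed_swap.
have [a1 a2 a3] := col_size_swap sA.
have [b1 b2 b3] := @col_size_swap x T _ (subxx _).
have cS y : col_size S y = col_size T y.
  have [->|yx] := eqVneq y x; first by have := cS' x; rewrite a1 b1 cA; lia.
  have [->|yx1] := eqVneq y (x + 1); first by rewrite a2 b2 cS' cA.
  by rewrite -(a3 y yx yx1) -(b3 y yx yx1) cS'.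
have t0S : tail_sum 0 S = tail_sum 0 T.
  by rewrite -(tail_sum_swap dn sA) // -(tail_sum_swap dn (subxx (Dset T x))).
split=> // e; have [->|ed] := eqVneq e d.+1; last first.
  by rewrite -(tail_sum_swap dn sA) // -(tail_sum_swap dn (subxx (Dset T x))).
have := tail_split S (ltnW dn); have := tail_split T (ltnW dn); rewrite t0S => ->.
set sT := (\sum_(_ < _ | _) _)%N; set sS := (\sum_(_ < _ | _) _)%N.
suff : (sT <= sS)%N by lia.
apply: leq_sum => e' ed'; apply: initial_segment_weight => [i j ij||i j ij].
- by rewrite leq_exp2l.
- exact: cS.
- by rewrite !inE; apply: (min_column_top stT xmin) => //; rewrite /x; lia.
Qed.

End StandardMonomials.

(** * Leading symbols *)

(* The operator [raise_row], which moves one entry of row i + 1 up to row i with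
   the weight (-q)^(...), is dual to a Chevalley generator of the quantum group
   acting on the rows; it commutes with the F_x. *)
Section RowOperator.
Local Open Scope ring_scope.
Variables (F : fieldType) (t : F).
Hypothesis t0 : t != 0.
Variables (l : nat) (N : int) (n : nat).
Variables (i i' : 'I_l).
Hypothesis ii' : i' = i.+1 :> nat.
Implicit Types (c : 'I_l -> int -> bool) (g : ('I_l -> int -> bool) -> F) (x y z : int).

Definition cswap x (j : 'I_l) c : 'I_l -> int -> bool :=
  fun k z => if k == j then c k (tau x z) else c k z.

Definition cmove y c : 'I_l -> int -> bool := fun k z =>
  if z == y then (if k == i then false else if k == i' then true else c k z) else c k z.

Definition cdiff c x (k : 'I_l) : int := (c k x : nat)%:Z - (c k (x + 1) : nat)%:Z.
Definition ckap c x (j : 'I_l) : int := \sum_(k < l | (j < k)%N) cdiff c x k.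
Definition rdiff c (e : 'I_n) : int :=
  (c i' (N + (e : nat)%:Z) : nat)%:Z - (c i (N + (e : nat)%:Z) : nat)%:Z.
Definition crow c (d : nat) : int := \sum_(e < n | (d < e)%N) rdiff c e.

Definition lower_col x g c : F := \sum_(j < l)
  if c j (x + 1) && ~~ c j x then t ^ ckap c x j * g (cswap x j c) else 0.

Definition raise_row g c : F := \sum_(d < n)
  let y := N + (d : nat)%:Z in
  if c i y && ~~ c i' y then (- t) ^ crow c d * g (cmove y c) else 0.

Let i_neq : i' == i = false.
Proof. by apply/negbTE/eqP => /(congr1 val) /=; rewrite ii'; lia. Qed.

Let i_neq' : i == i' = false.
Proof. by rewrite eq_sym. Qed.

Section Commute.
Variables (d0 : nat).
Hypothesis d0n : (d0.+1 < n)%N.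
Let x := N + d0%:Z.
Let o0 : 'I_n := Ordinal (ltnW d0n).
Let o1 : 'I_n := Ordinal d0n.

Let x1E : N + d0.+1%:Z = x + 1.
Proof. by rewrite /x; lia. Qed.

Lemma cmove_swap y j c : y != x -> y != x + 1 ->
  cswap x j (cmove y c) = cmove y (cswap x j c).
Proof.
move=> y1 y2; apply: funext => k; apply: funext => z; rewrite /cswap /cmove.
have e : (tau x z == y) = (z == y) by taulia.
case: (k == j) => //; rewrite e; case: (eqVneq z y) => [->|//].
by rewrite tau_neq.
Qed.

Lemma cmove_swap' y j c : j != i -> j != i' -> cswap x j (cmove y c) = cmove y (cswap x j c).
Proof.
move=> ji ji'; apply: funext => k; apply: funext => z; rewrite /cswap /cmove.
have [->|kj] := eqVneq k j; last by [].
rewrite (negbTE ji) (negbTE ji').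
by case: ifP; case: ifP.
Qed.

Lemma ckap_move_other y j c : y != x -> y != x + 1 -> ckap (cmove y c) x j = ckap c x j.
Proof.
move=> y1 y2; apply: eq_bigr => k _; rewrite /cdiff /cmove.
by rewrite ![_ == y]eq_sym (negbTE y1) (negbTE y2).
Qed.

Lemma cmove_tperm y k c : c i y -> ~~ c i' y -> cmove y c k y = c (tperm i i' k) y.
Proof.
move=> h1 /negbTE h2; rewrite /cmove eqxx.
case: tpermP => [->|->|/eqP/negbTE -> /eqP/negbTE ->] //; first by rewrite eqxx h2.
by rewrite i_neq eqxx h1.
Qed.

Lemma ckap_move_row y j c : j != i -> j != i' -> c i y -> ~~ c i' y ->
  ckap (cmove y c) x j = ckap c x j.
Proof.
move=> ji ji' h1 h2; rewrite /ckap /cdiff !sumrB.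
have E z : \sum_(k < l | (j < k)%N) (cmove y c k z : nat)%:Z =
           \sum_(k < l | (j < k)%N) (c k z : nat)%:Z.
  have [->|zy] := eqVneq z y; last first.
    by apply: eq_bigr => k _; rewrite /cmove (negbTE zy).
  rewrite [RHS](reindex_inj (@perm_inj _ (tperm i i'))) /=.
  apply: eq_big => [k|k _]; last by rewrite cmove_tperm.
  by case: tpermP => [->|->|//]; move: ji ji'; rewrite -!val_eqE /= ii'; lia.
by rewrite !E.
Qed.

Lemma crow_swap_other j c (d : nat) : d != d0 -> d != d0.+1 ->
  crow (cswap x j c) d = crow c d.
Proof.
move=> dd0 dd1; rewrite /crow /rdiff !sumrB.
have E (k : 'I_l) : \sum_(e < n | (d < e)%N) (cswap x j c k (N + (e : nat)%:Z) : nat)%:Z =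
           \sum_(e < n | (d < e)%N) (c k (N + (e : nat)%:Z) : nat)%:Z.
  rewrite /cswap; case: (k == j) => //.
  rewrite [RHS](reindex_inj (@perm_inj _ (tperm o0 o1))) /=.
  have te (e : 'I_n) : tau x (N + (e : nat)%:Z) = N + (tperm o0 o1 e : nat)%:Z.
    case: tpermP => [->|->|/eqP e0 /eqP e1] /=.
    - by rewrite tauL x1E.
    - by rewrite x1E tauR.
    - move: e0 e1; rewrite -!val_eqE /= => e0 e1; rewrite tau_neq //; rewrite /x; lia.
  apply: eq_big => [e|e _]; last by rewrite te.
  case: tpermP => [->|->|//] /=; lia.
by rewrite !E.
Qed.

Lemma crow_swap_row j c d : j != i -> j != i' -> crow (cswap x j c) d = crow c d.
Proof.
move=> ji ji'; apply: eq_bigr => e _; rewrite /rdiff /cswap.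
by rewrite [i' == j]eq_sym [i == j]eq_sym (negbTE ji) (negbTE ji').
Qed.

Variable c : 'I_l -> int -> bool.

(** Overwriting [c] at the two rows and the two columns reduces the local identity to boolean
    cases. *)
Definition cloc (a0 a1 b0 b1 : bool) : 'I_l -> int -> bool := fun k z =>
  if k == i then (if z == x then a0 else if z == x + 1 then a1 else c k z)
  else if k == i' then (if z == x then b0 else if z == x + 1 then b1 else c k z)
  else c k z.

Let x1x : (x + 1 == x) = false. Proof. by lia. Qed.

Lemma clocE : c = cloc (c i x) (c i (x + 1)) (c i' x) (c i' (x + 1)).
Proof.
apply: funext => k; apply: funext => z; rewrite /cloc.
have [->|_] := eqVneq k i.
  by have [->|_] := eqVneq z x => //; have [->|_] := eqVneq z (x + 1).
have [->|//] := eqVneq k i'.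
by have [->|_] := eqVneq z x => //; have [->|_] := eqVneq z (x + 1).
Qed.

Lemma cloc_i0 a0 a1 b0 b1 : cloc a0 a1 b0 b1 i x = a0.
Proof. by rewrite /cloc !eqxx. Qed.
Lemma cloc_i1 a0 a1 b0 b1 : cloc a0 a1 b0 b1 i (x + 1) = a1.
Proof. by rewrite /cloc eqxx x1x eqxx. Qed.
Lemma cloc_i'0 a0 a1 b0 b1 : cloc a0 a1 b0 b1 i' x = b0.
Proof. by rewrite /cloc i_neq !eqxx. Qed.
Lemma cloc_i'1 a0 a1 b0 b1 : cloc a0 a1 b0 b1 i' (x + 1) = b1.
Proof. by rewrite /cloc i_neq x1x !eqxx. Qed.

Lemma cloc_move0 a0 a1 b0 b1 : cmove x (cloc a0 a1 b0 b1) = cloc false a1 true b1.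
Proof.
apply: funext => k; apply: funext => z; rewrite /cloc /cmove.
by case: (k == i); case: (k == i'); case: (z == x).
Qed.

Lemma cloc_move1 a0 a1 b0 b1 : cmove (x + 1) (cloc a0 a1 b0 b1) = cloc a0 false b0 true.
Proof.
apply: funext => k; apply: funext => z; rewrite /cloc /cmove.
by have [->|_] := eqVneq z (x + 1); rewrite ?x1x; case: (k == i); case: (k == i').
Qed.

Lemma cloc_swap a0 a1 b0 b1 : cswap x i (cloc a0 a1 b0 b1) = cloc a1 a0 b0 b1.
Proof.
apply: funext => k; apply: funext => z; rewrite /cloc /cswap.
have [->|_] // := eqVneq k i.
by case: tauP => [->|->|z0 z1]; rewrite ?eqxx ?x1x ?(negbTE z0) ?(negbTE z1).
Qed.

Lemma cloc_swap' a0 a1 b0 b1 : cswap x i' (cloc a0 a1 b0 b1) = cloc a0 a1 b1 b0.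
Proof.
apply: funext => k; apply: funext => z; rewrite /cloc /cswap.
have [->|_] := eqVneq k i; first by rewrite i_neq'.
have [->|_] // := eqVneq k i'.
by case: tauP => [->|->|z0 z1]; rewrite ?eqxx ?x1x ?(negbTE z0) ?(negbTE z1).
Qed.

Lemma cloc_kap' a0 a1 b0 b1 : ckap (cloc a0 a1 b0 b1) x i' = ckap c x i'.
Proof.
apply: eq_bigr => k ik; rewrite /cdiff /cloc.
have -> : k == i = false by apply/negbTE/eqP => e; move: ik; rewrite e ii'; lia.
by have -> : k == i' = false by apply/negbTE/eqP => e; move: ik; rewrite e ltnn.
Qed.

Lemma cloc_kap a0 a1 b0 b1 : ckap (cloc a0 a1 b0 b1) x i =
  ckap c x i' + ((b0 : nat)%:Z - (b1 : nat)%:Z).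
Proof.
rewrite -(cloc_kap' a0 a1 b0 b1) /ckap (bigD1 i') /=; last by rewrite ii'.
rewrite addrC {2}/cdiff cloc_i'0 cloc_i'1; congr (_ + _); apply: eq_bigl => k.
by rewrite -val_eqE /= ii'; lia.
Qed.

Lemma cloc_row1 a0 a1 b0 b1 : crow (cloc a0 a1 b0 b1) d0.+1 = crow c d0.+1.
Proof.
apply: eq_bigr => e de; rewrite /rdiff /cloc !eqxx i_neq.
have -> : (N + (e : nat)%:Z == x) = false by rewrite /x; lia.
by have -> : (N + (e : nat)%:Z == x + 1) = false by rewrite /x; lia.
Qed.

Lemma cloc_row0 a0 a1 b0 b1 : crow (cloc a0 a1 b0 b1) d0 =
  crow c d0.+1 + ((b1 : nat)%:Z - (a1 : nat)%:Z).
Proof.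
rewrite -(cloc_row1 a0 a1 b0 b1) /crow (bigD1 o1) /=; last by [].
rewrite addrC {2}/rdiff /= x1E cloc_i'1 cloc_i1; congr (_ + _); apply: eq_bigl => e.
by rewrite -val_eqE /=; lia.
Qed.

Definition lower_raise_term g (d : 'I_n) (j : 'I_l) : F :=
  let y := N + (d : nat)%:Z in
  if (c i y && ~~ c i' y) && (cmove y c j (x + 1) && ~~ cmove y c j x)
  then (- t) ^ crow c d * (t ^ ckap (cmove y c) x j * g (cswap x j (cmove y c))) else 0.

Definition raise_lower_term g (d : 'I_n) (j : 'I_l) : F :=
  let y := N + (d : nat)%:Z in let cs := cswap x j c in
  if (c j (x + 1) && ~~ c j x) && (cs i y && ~~ cs i' y)
  then t ^ ckap c x j * ((- t) ^ crow cs d * g (cmove y cs)) else 0.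

Lemma raise_lower_far g d j : d != o0 -> d != o1 ->
  lower_raise_term g d j = raise_lower_term g d j.
Proof.
rewrite -!val_eqE /= => dd0 dd1; rewrite /lower_raise_term /raise_lower_term.
set y := N + _; have y0 : y != x by rewrite /y /x; lia.
have y1 : y != x + 1 by rewrite /y /x; lia.
rewrite (cmove_swap j c y0 y1) (ckap_move_other j c y0 y1) (crow_swap_other j c dd0 dd1).
have -> : cmove y c j (x + 1) = c j (x + 1) by rewrite /cmove eq_sym (negbTE y1).
have -> : cmove y c j x = c j x by rewrite /cmove eq_sym (negbTE y0).
have E k : cswap x j c k y = c k y by rewrite /cswap tau_neq //; case: ifP.
by rewrite !E [X in if X then _ else _]andbC mulrCA.
Qed.

Lemma raise_lower_row g d j : j != i -> j != i' ->
  lower_raise_term g d j = raise_lower_term g d j.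
Proof.
move=> ji ji'; rewrite /lower_raise_term /raise_lower_term; set y := N + _.
rewrite (cmove_swap' y c ji ji') (crow_swap_row c d ji ji').
have E k : cswap x j c k y = if k == j then c k (tau x y) else c k y by [].
rewrite !E [i == j]eq_sym [i' == j]eq_sym (negbTE ji) (negbTE ji').
have E' z : cmove y c j z = c j z.
  by rewrite /cmove (negbTE ji) (negbTE ji'); case: ifP.
rewrite !E' [X in _ = if X then _ else _]andbC; case: ifP => // /andP[/andP[h1 h2] _].
by rewrite ckap_move_row // mulrCA.
Qed.

(** Sixteen cases. When row [i] has both columns and row [i'] has neither, two paths lead to the
    same configuration while the other side is 0; they cancel because the weight is a power of
    [- t]. *)
Lemma raise_lower_local g :
  lower_raise_term g o0 i + lower_raise_term g o0 i' +
  (lower_raise_term g o1 i + lower_raise_term g o1 i') =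
  raise_lower_term g o0 i + raise_lower_term g o0 i' +
  (raise_lower_term g o1 i + raise_lower_term g o1 i').
Proof.
rewrite /lower_raise_term /raise_lower_term /= -/x x1E.
have := cloc_kap'; have := cloc_kap; have := cloc_row0; have := cloc_row1.
move: (ckap c x i') (crow c d0.+1) => K W rE1 rE0 kE kE'.
rewrite clocE; move: (c i x) (c i (x + 1)) (c i' x) (c i' (x + 1)) => a0 a1 b0 b1.
rewrite !(cloc_move0, cloc_move1, cloc_swap, cloc_swap').
rewrite !(cloc_i0, cloc_i1, cloc_i'0, cloc_i'1) !rE1 !rE0 !kE !kE'.
have nt0 : - t != 0 by rewrite oppr_eq0.

case: a0; case: a1; case: b0; case: b1 => //=;
  rewrite ?subrr ?subr0 ?sub0r ?addr0 ?add0r ?expfzDr // ?expr1z ?exprN1 //.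
all: try by rewrite ?mulr0 ?addr0 ?add0r.
all: move: (g _) (t ^ K) ((- t) ^ W) => u1 u2 u3; try exact: mulrCA.
all: by field.
Qed.

(** Moves in another column or in another row commute term by term, which leaves the block of two
    columns and two rows. *)
Lemma raise_lower_comm g : raise_row (lower_col x g) c = lower_col x (raise_row g) c.
Proof.
have -> : raise_row (lower_col x g) c = \sum_(d < n) \sum_(j < l) lower_raise_term g d j.
  apply: eq_bigr => d _; rewrite /lower_raise_term /=; case: ifP => h /=; last by rewrite big1.
  by rewrite /lower_col big_distrr /=; apply: eq_bigr => j _; case: ifP => _; rewrite ?mulr0.
have -> : lower_col x (raise_row g) c = \sum_(d < n) \sum_(j < l) raise_lower_term g d j.
  rewrite exchange_big; apply: eq_bigr => j _; rewrite /raise_lower_term /=.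
  case: ifP => h /=; last by rewrite big1.
  by rewrite /raise_row big_distrr /=; apply: eq_bigr => d _; case: ifP => _; rewrite ?mulr0.
have o01 : o1 != o0 by rewrite -val_eqE /=; lia.
have ji : i' != i by rewrite i_neq.
rewrite (bigD1 o0) // (bigD1 o1) //= [RHS](bigD1 o0) // (bigD1 o1) //=.
rewrite !addrA; congr (_ + _); last first.
  by apply: eq_bigr => d /andP[h1 h2]; apply: eq_bigr => j _; exact: raise_lower_far.
have E T d : \sum_(j < l) T g d j = T g d i + T g d i' +
    \sum_(j < l | (j != i) && (j != i')) T g d j :> F.
  by rewrite (bigD1 i) // (bigD1 i') //= addrA.
rewrite !(E _ lower_raise_term) !(E _ raise_lower_term).
rewrite !(addrACA _ (\sum_(_ < _ | _) _)) raise_lower_local; congr (_ + (_ + _));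
  by apply: eq_bigr => j /andP[h1 h2]; exact: raise_lower_row.
Qed.

End Commute.
End RowOperator.

(** * Injectivity of the raising operator on large subsets *)

Section SubsetOperators.
Local Open Scope ring_scope.
Variables (I : finType) (K : realFieldType).
Implicit Types (u w : {set I} -> K) (A B C : {set I}).

Definition up_sum u B : K := \sum_(p | p \notin B) u (p |: B).
Definition down_sum u C : K := \sum_(p in C) u (C :\ p).

Lemma up_down_adjoint u w : \sum_A u A * up_sum w A = \sum_C down_sum u C * w C.
Proof.
rewrite (eq_bigr (fun A => \sum_(p | p \notin A) u A * w (p |: A))); last first.
  by move=> A _; rewrite big_distrr.
rewrite [RHS](eq_bigr (fun C => \sum_(p in C) u (C :\ p) * w C)); last first.
  by move=> C _; rewrite big_distrl.
rewrite !pair_big_dep /=.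
rewrite (reindex_onto (fun q : {set I} * I => (q.1 :\ q.2, q.2)) (fun q => (q.2 |: q.1, q.2))) /=.
  apply: eq_big => [[C p]|[C p]] /=.
    rewrite setD11 /= xpair_eqE eqxx andbT.
    apply/eqP/idP => [<-|pC]; [exact: setU11|exact: setD1K].
  by move=> /andP[_]; rewrite xpair_eqE eqxx andbT => /eqP ->.
by move=> [A p] /= pA; rewrite setU1K.
Qed.

(** Both compositions contain the exchanges of an element outside [A] for one inside. They differ in
    the returns to [A], whose numbers are the sizes of the complement and of [A]. *)
Lemma up_down_comm u A : up_sum (down_sum u) A =
  down_sum (up_sum u) A + (#|I|%:R - (#|A| + #|A|)%:R) * u A.
Proof.
pose X := \sum_(p | p \notin A) \sum_(r in A) u (p |: (A :\ r)).
have E1 : up_sum (down_sum u) A = #|~: A|%:R * u A + X.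
  rewrite /X mulr_natl -sumr_const (eq_bigl (fun p => p \notin A)); last by move=> p; rewrite inE.
  rewrite -big_split /=; apply: eq_bigr => p pA.
  rewrite /down_sum (big_setU1 p pA) setU1K //; congr (_ + _); apply: eq_bigr => r rA.
  congr u; apply/setP => z; rewrite !inE; case: (eqVneq z r) => [->|//] /=.
  by rewrite orbF; apply/esym/negbTE; apply: contraNneq pA => <-.
have E2 : down_sum (up_sum u) A = #|A|%:R * u A + X.
  rewrite /X exchange_big mulr_natl -sumr_const -big_split /=; apply: eq_bigr => r rA.
  rewrite /up_sum (bigD1 r) /=; last by rewrite !inE eqxx.
  rewrite setD1K //; congr (_ + _); apply: eq_bigl => p; rewrite !inE negb_and negbK.
  by case: (eqVneq p r) => [->|_] /=; rewrite ?rA ?andbF ?andbT.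
rewrite E1 E2 -(cardsC A) !natrD; ring.
Qed.

(* The commutator of [up_sum] and its adjoint [down_sum] is a negative scalar on the
   subsets with more than half of the elements of I. *)
Lemma up_sum_inj u k : (0 < k)%N -> (#|I| < k + k)%N -> (forall A, #|A| != k -> u A = 0) ->
  (forall B, #|B| = k.-1 -> up_sum u B = 0) -> forall A, u A = 0.
Proof.
move=> k0 kI usupp uker.
have E : \sum_C down_sum u C * down_sum u C = \sum_A (#|I|%:R - (k + k)%:R) * (u A * u A).
  rewrite -up_down_adjoint; apply: eq_bigr => A _; rewrite up_down_comm.
  have [Ak|nAk] := eqVneq #|A| k; last by rewrite usupp // !(mul0r, mulr0).
  rewrite [down_sum _ _]big1 ?add0r ?Ak; first by rewrite mulrCA.
  move=> r rA; apply: uker; have := cardsD1 r A; rewrite rA Ak; lia.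
have neg : #|I|%:R - (k + k)%:R < 0 :> K by rewrite subr_lt0 ltr_nat.
have s0 : 0 <= \sum_C down_sum u C * down_sum u C.
  by apply: sumr_ge0 => C _; rewrite -expr2 sqr_ge0.
have s1 : \sum_A u A * u A <= 0.
  by move: s0; rewrite E -big_distrr /= (nmulr_rge0 _ neg).
have s2 : \sum_A u A * u A = 0.
  by apply/eqP; rewrite eq_le s1 sumr_ge0 // => A _; rewrite -expr2 sqr_ge0.
move=> A; have /eqP := s2; rewrite psumr_eq0 => [|B _]; last by rewrite -expr2 sqr_ge0.
move=> /allP/(_ A (mem_index_enum _)) /=.
by rewrite mulf_eq0 orbb => /eqP.
Qed.

End SubsetOperators.

Section Specialization.
Local Open Scope ring_scope.
Local Notation tf := (@FracField.tofrac {poly rat}).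

Lemma common_denominator (J : finType) (U : J -> Qq) :
  exists (d : {poly rat}) (P : J -> {poly rat}), d != 0 /\ forall j, U j * tf d = tf (P j).
Proof.
have H j : exists ab : {poly rat} * {poly rat}, ab.2 != 0 /\ U j = tf ab.1 / tf ab.2.
  by have [a [b [b0 ->]]] := frac_ex (U j); exists (a, b).
pose ab j := sval (cid (H j)).
have abP j : (ab j).2 != 0 /\ U j = tf (ab j).1 / tf (ab j).2 by rewrite /ab; case: cid.
exists (\prod_j (ab j).2), (fun j => (ab j).1 * \prod_(j' | j' != j) (ab j').2); split.
  by apply/prodf_neq0 => j _; have [] := abP j.
move=> j; have [b0 ->] := abP j; rewrite (bigD1 j) //= !tofracM mulrA divfK //.
by rewrite tofrac_eq0.
Qed.

(** Without this division a nonzero family could specialize to 0 at [a]. *)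
Lemma primitive_at (J : finType) (P : J -> {poly rat}) (a : rat) j0 : P j0 != 0 ->
  exists (s : nat) (Q : J -> {poly rat}),
    (forall j, P j = Q j * ('X - a%:P) ^+ s) /\ exists j, (Q j).[a] != 0.
Proof.
have [m] : exists m, (size (P j0) < m)%N by eexists; exact: ltnSn.
elim: m P => // m IH P Pm P0.
case: (pselect (exists j, (P j).[a] != 0)) => [nz|nz].
  by exists 0%N, P; split=> // j; rewrite expr0 mulr1.
have H j : exists Q, P j = Q * ('X - a%:P).
  apply/factor_theorem; rewrite /root; apply: contraT => h; case: nz; exists j; exact: h.
pose P1 j := sval (cid (H j)).
have P1E j : P j = P1 j * ('X - a%:P) by rewrite /P1; case: cid.
have P10 : P1 j0 != 0 by apply: contraNneq P0 => e; rewrite P1E e mul0r.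
have [|s [Q [hQ nzQ]]] := IH P1 _ P10.
  have sz : size (P j0) = (size (P1 j0)).+1.
    by rewrite P1E size_mul ?polyXsubC_eq0 // size_XsubC addn2.
  by move: Pm; rewrite sz ltnS.
by exists s.+1, Q; split=> // j; rewrite P1E hQ exprSr mulrA.
Qed.

(* After clearing denominators and the common powers of q + 1, the specialization
   q = -1 replaces every power of -q by 1. *)
Lemma twisted_up_inj (I : finType) (k : nat) (U : {set I} -> Qq) (a : {set I} -> I -> int) :
  (#|I| < k + k)%N ->
  (forall B : {set I}, #|B| = k.-1 -> \sum_(p | p \notin B) (- q) ^ a B p * U (p |: B) = 0) ->
  forall A : {set I}, #|A| = k -> U A = 0.
Proof.
move=> kI ker A0 A0k; apply/eqP; apply: contraT => UA0.
have k0 : (0 < k)%N by case: k kI {ker A0k}.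
pose U' (A : {set I}) := if #|A| == k then U A else 0.
have [d [P [d0 hP]]] := common_denominator U'.
have td0 : tf d != 0 by rewrite tofrac_eq0.
have PA0 : P A0 != 0.
  rewrite -tofrac_eq0 -hP (_ : U' A0 = U A0); last by rewrite /U' A0k eqxx.
  exact: (mulf_neq0 UA0 td0).
have [s [Q [hQ [A1 QA1]]]] := primitive_at (-1) PA0.
have ts0 : tf (('X - (-1)%:P) ^+ s) != 0 by rewrite tofrac_eq0 expf_neq0 // polyXsubC_eq0.
have Q0 (A : {set I}) : #|A| != k -> Q A = 0.
  move=> Ak; have := hP A; rewrite /U' (negbTE Ak) mul0r hQ => /esym/eqP.
  by rewrite tofrac_eq0 mulf_eq0 expf_eq0 polyXsubC_eq0 andbF orbF => /eqP.
have nq0 : - q != 0 by rewrite oppr_eq0 q_neq0.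
move: QA1; rewrite (@up_sum_inj I _ (fun A => (Q A).[-1]) k) ?eqxx // => [A Ak|B Bk].
  by rewrite Q0 // horner0.
(* Multiplication by [(- q) ^ M] makes all exponents nonnegative, so the equation lives among
   polynomials and can be evaluated at -1. *)
pose M := (\sum_(p | p \notin B) absz (a B p))%N.
have Ma p : p \notin B -> 0 <= M%:Z + a B p.
  by move=> pB; rewrite /M (bigD1 p) //=; lia.
have E : \sum_(p | p \notin B) (- 'X) ^+ absz (M%:Z + a B p)%R * Q (p |: B) = 0.
  apply/eqP; rewrite -tofrac_eq0 raddf_sum /=.
  apply/eqP; apply: (mulIf ts0); rewrite mul0r big_distrl /=.
  have e : \sum_(p | p \notin B) (- q) ^ a B p * U (p |: B) * ((- q) ^ M%:Z * tf d) = 0.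
    by rewrite -big_distrl /= ker // mul0r.
  rewrite -[RHS]e; apply: eq_bigr => p pB.
  have pBk : #|p |: B| = k by rewrite cardsU1 pB Bk; lia.
  have := hP (p |: B); rewrite /U' pBk eqxx hQ => e'.
  rewrite tofracM -[LHS]mulrA -[X in _ * X = _]tofracM -e' tofracXn tofracN -/q.
  rewrite -[X in X * _ = _]/((- q) ^ (absz (M%:Z + a B p))%:Z) gez0_abs ?Ma //.
  rewrite expfzDr //; move: (U _) (tf d) ((- q) ^ M%:Z) ((- q) ^ a B p) => u1 u2 u3 u4.
  by rewrite -!mulrA mulrCA; congr (_ * _); rewrite mulrCA.
have := congr1 (fun r : {poly rat} => r.[-1]) E; rewrite horner0 horner_sum => <-.
apply: eq_bigr => p _; rewrite hornerM horner_exp hornerN hornerX opprK expr1n mul1r.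
by [].
Qed.

End Specialization.

(** * Vectors annihilated by the row operators *)

Section Kernel.
Local Open Scope ring_scope.
Variables (l : nat) (v : 'I_l -> int).
Hypothesis hv : forall i j : 'I_l, (i <= j)%N -> v j <= v i.
Variables (N : int) (n : nat).
Implicit Types (u w : fock v) (S T : symbol v) (c : 'I_l -> int -> bool) (x y : int).

(* Moving an entry to another row changes the multicharge, so the coefficient of
   [u] is extended by 0 to arbitrary configurations of entries. *)
Definition ccoef u c : Qq :=
  match pselect (exists T, ent T = c) with
  | left h => u@_(sval (cid h))
  | right _ => 0
  end.

Lemma ent_fun_inj S T : ent S = ent T -> S = T.
Proof. by move=> e; apply: ent_inj => i x; rewrite e. Qed.

Lemma ccoef_ent u T : ccoef u (ent T) = u@_T.
Proof.
rewrite /ccoef; case: pselect => [h|[]]; last by exists T.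
by case: cid => S /= e; rewrite (ent_fun_inj e).
Qed.

Lemma ccoef_none u c : (forall T, ent T <> c) -> ccoef u c = 0.
Proof. by move=> H; rewrite /ccoef; case: pselect => // -[T e]; case: (H T). Qed.

Lemma ent_swap1 x j T : ent (swapS x [set j] T) = cswap x j (ent T).
Proof.
by apply: funext => i; apply: funext => y; rewrite ent_swap /cswap inE.
Qed.

Lemma cswapK x j c : cswap x j (cswap x j c) = c.
Proof.
by apply: funext => k; apply: funext => z; rewrite /cswap; case: (k == j); rewrite ?tauK.
Qed.

Lemma ccoef_Fop x u : ccoef (Fop x u) = lower_col q x (ccoef u).
Proof.
apply: funext => c; case: (pselect (exists T, ent T = c)) => [[T eT]|nT].
  rewrite -eT ccoef_ent mcoeff_Fop /lower_col [LHS]big_mkcond; apply: eq_bigr => j _.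
  by rewrite inE; case: ifP => // _; rewrite -ent_swap1 ccoef_ent.
rewrite ccoef_none => [|T e]; last by apply: nT; exists T.
rewrite /lower_col big1 // => j _; case: ifP => // _.
rewrite ccoef_none ?mulr0 // => T e; apply: nT; exists (swapS x [set j] T).
by rewrite ent_swap1 e cswapK.
Qed.

Lemma ccoefD u w c : ccoef (u + w) c = ccoef u c + ccoef w c.
Proof.
rewrite /ccoef; case: pselect => [h|_]; last by rewrite addr0.
by rewrite mcoeffD.
Qed.

Lemma ccoefZ (a : Qq) u c : ccoef (a *: u) c = a * ccoef u c.
Proof.
rewrite /ccoef; case: pselect => [h|_]; last by rewrite mulr0.
by rewrite mcoeffZ.
Qed.

Definition row_killed u : Prop := forall i i' : 'I_l, i' = i.+1 :> nat ->
  forall c, raise_row q N n i i' (ccoef u) c = 0.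

Lemma row_killedD u w : row_killed u -> row_killed w -> row_killed (u + w).
Proof.
move=> hu hw i i' ii c.
transitivity (raise_row q N n i i' (ccoef u) c + raise_row q N n i i' (ccoef w) c).
  rewrite /raise_row -big_split; apply: eq_bigr => d _ /=.
  case: ifP => _; last exact: (esym (addr0 _)).
  by rewrite ccoefD mulrDr.
by rewrite (hu i i' ii c) (hw i i' ii c) addr0.
Qed.

Lemma row_killedZ (a : Qq) u : row_killed u -> row_killed (a *: u).
Proof.
move=> hu i i' ii c.
transitivity (a * raise_row q N n i i' (ccoef u) c).
  rewrite /raise_row big_distrr; apply: eq_bigr => d _ /=.
  case: ifP => _; last exact: (esym (mulr0 _)).
  by rewrite ccoefZ mulrCA.
by rewrite (hu i i' ii c) mulr0.
Qed.

Lemma row_killedB (a : Qq) u w : row_killed u -> row_killed w -> row_killed (u - a *: w).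
Proof.
by move=> hu hw; rewrite -scaleNr; apply: row_killedD => //; exact: row_killedZ.
Qed.

Lemma row_killed_Fop x u : N <= x -> x + 1 < N + n%:Z -> row_killed u -> row_killed (Fop x u).
Proof.
move=> Nx xn hu i i' ii c.
have dn : ((absz (x - N)%R).+1 < n)%N by lia.
have xE : N + (absz (x - N)%R)%:Z = x by lia.
have := raise_lower_comm q_neq0 N ii dn c (ccoef u); rewrite xE ccoef_Fop => ->.
rewrite /lower_col big1 // => j _; case: ifP => // _.
by rewrite hu // mulr0.
Qed.

(** Each entry of a row of the empty symbol occurs in the previous row too, whereas a move leaves
    its column occupied in row [i'] and free in row [i]. *)
Lemma row_killed_empty : row_killed (basis_vector (empty_symbol v)).
Proof.
move=> i i' ii c; rewrite /raise_row big1 // => d _ /=; case: ifP => // _.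
set y := N + _; case: (pselect (exists T, ent T = cmove i i' y c)) => [[T e]|nT]; last first.
  by rewrite ccoef_none ?mulr0 // => T e; apply: nT; exists T.
rewrite -e ccoef_ent mcoeffU; have [eT|_] := eqVneq (empty_symbol v) T; last by rewrite mulr0n mulr0.
have ii' : (i' == i) = false by apply/negbTE/eqP => /(congr1 val) /=; rewrite ii; lia.
have e1 : ent T i y = false by rewrite e /cmove !eqxx.
have e2 : ent T i' y by rewrite e /cmove eqxx ii' eqxx.
exfalso; move/negP: (negbT e1); apply; move/entP: e2; rewrite -eT => -[j ji' /=].
rewrite ji' => <-; apply/entP; have ji : j <= v i by rewrite (le_trans ji') // hv // ii.
by exists j; rewrite //= ji.
Qed.

Lemma row_killed_Fdiv_word (w : seq (int * nat)) : letters_in N n w -> row_killed (Fdiv_word v w).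
Proof.
elim: w => [|[x a] w IH] hw /=; first exact: row_killed_empty.
have [/= h1 h2] := hw (x, a) (mem_head _ _).
have {}IH : row_killed (Fdiv_word v w) by apply: IH => r rw; apply: hw; rewrite inE rw orbT.
rewrite /Fdiv; apply: row_killedZ; elim: a {hw h1 h2} (h1) (h2) => [|a IHa] // h1 h2; apply: row_killed_Fop => //; exact: IHa.
Qed.

Definition low_entries S (k : 'I_l) y : {set 'I_n} :=
  [set d : 'I_n | (N + (d : nat)%:Z <= y) && ent S k (N + (d : nat)%:Z)].

(** Up to the value [S i' j], row [i'] contains its entries of indices from [N] to [j], while those
    of row [i] have index less than [j]. *)
Lemma window_count_lt S (i i' : 'I_l) j : windowed N n S -> i' = i.+1 :> nat ->
  j <= v i' -> S i' j < S i j -> N <= j /\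
  (#|low_entries S i (S i' j)| < #|low_entries S i' (S i' j)|)%N.
Proof.
move=> [w1 w2] ii ji' lt.
have ji : j <= v i by rewrite (le_trans ji') // hv // ii.
have pre k z : z < N -> z <= v k /\ S k z = z.
  move=> zN; apply: (@row_prefix _ (S k) z _ z (lexx z)) => z' zz.
  by apply/entP; apply: w1; exact: le_lt_trans zz zN.
have Nj : N <= j.
  rewrite leNgt; apply/negP => jN; have [_ e1] := pre i j jN; have [_ e2] := pre i' j jN.
  by move: lt; rewrite e1 e2 ltxx.
split=> //.
have ge k z : N <= z -> z <= v k -> N <= S k z.
  by move=> Nz zk; exact: le_trans Nz (row_ge (S k) zk).
have up k z : z <= v k -> S k z < N + n%:Z.
  by move=> zk; rewrite ltNge; apply/negP => h; move/negP: (w2 k _ h); case; apply/entP; exists z.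
pose m := absz (j - N)%R.
have n0 : (0 < n)%N.
  by have := ge i' j Nj ji'; have := up i' j ji'; lia.
pose f k (e : nat) : 'I_n := insubd (Ordinal n0) (absz (S k (N + e%:Z) - N)%R).
have fE k (e : nat) : N + e%:Z <= v k -> N + (f k e : nat)%:Z = S k (N + e%:Z).
  move=> ek; have h1 := ge k _ (_ : N <= N + e%:Z) ek.
  have {}h1 := h1 ltac:(lia); have h2 := up k _ ek.
  by rewrite val_insubd ifT; lia.
apply: (@leq_ltn_trans m).
  rewrite -[X in (_ <= X)%N](card_ord m) -[X in (_ <= X)%N]cardsT.
  apply: leq_trans (leq_imset_card (fun e : 'I_m => f i e) _).
  apply: subset_leq_card; apply/subsetP => d; rewrite inE => /andP[le /entP[z zi e]].
  have zj : z < j by rewrite -(row_ltE (S i)) // e (le_lt_trans le).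
  have Nz : N <= z.
    rewrite leNgt; apply/negP => zN; have [_ e'] := pre i z zN.
    by move: e; rewrite e'; lia.
  have zm : (absz (z - N)%R < m)%N by rewrite /m; lia.
  apply/imsetP; exists (Ordinal zm) => //; apply: val_inj => /=.
  have zE : N + (absz (z - N)%R)%:Z = z by lia.
  have := fE i (absz (z - N)%R); rewrite zE e => /(_ zi); lia.
rewrite -[X in (X < _)%N](card_ord m).
have finj : injective (fun e : 'I_m.+1 => f i' e).
  move=> e e' /(congr1 val) h; apply: val_inj.
  have em (a : 'I_m.+1) : N + (a : nat)%:Z <= v i'.
    by have := ltn_ord a; rewrite ltnS /m => h'; apply: le_trans ji'; lia.
  have h1 := fE i' e (em e); have h2 := fE i' e' (em e'); rewrite h h2 in h1.
  have [lt'|lt'|//] := ltngtP (e : nat) (e' : nat).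
  - have := row_lt (S i') (_ : N + (e : nat)%:Z < N + (e' : nat)%:Z) (em e').
    by rewrite h1 => /(_ ltac:(lia)); rewrite ltxx.
  - have := row_lt (S i') (_ : N + (e' : nat)%:Z < N + (e : nat)%:Z) (em e).
    by rewrite h1 => /(_ ltac:(lia)); rewrite ltxx.
rewrite card_ord -[X in (X <= _)%N](card_ord m.+1) -[X in (X <= _)%N]cardsT -(card_imset _ finj).
apply: subset_leq_card; apply/subsetP => d /imsetP[e _ ->].
have ej : N + (e : nat)%:Z <= j by have := ltn_ord e; rewrite ltnS /m; lia.
have ev : N + (e : nat)%:Z <= v i' := le_trans ej ji'.
rewrite inE fE //; apply/andP; split; last by apply/entP; exists (N + (e : nat)%:Z).
by have := @row_ltE _ (S i') j (N + (e : nat)%:Z) ji' ev; rewrite [RHS]ltNge ej /= leNgt => ->.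
Qed.

Section Leading.
Variables (u : fock v) (S : symbol v).
Hypothesis uK : row_killed u.
Hypothesis uW : windowed_vector N n u.
Hypothesis uS : u@_S != 0.
Hypothesis Smax : forall T, u@_T != 0 -> (key N n T <= key N n S)%N.
Variables (i i' : 'I_l) (y : int).
Hypothesis ii : i' = i.+1 :> nat.

(* Among the columns up to y with an entry in exactly one of the rows i and i', the
   configuration [cfg A] has the entry in row i' for the columns of A and in row i
   for the others; elsewhere it agrees with S. *)
Let single (d : 'I_n) : bool :=
  (N + (d : nat)%:Z <= y) && (ent S i (N + (d : nat)%:Z) != ent S i' (N + (d : nat)%:Z)).
Let I : finType := {d : 'I_n | single d}.

Let cfg (A : {set I}) : 'I_l -> int -> bool := fun k z =>
  if [pick d : I | z == N + (val d : nat)%:Z] is Some d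
  then (if k == i then d \notin A else if k == i' then d \in A else ent S k z)
  else ent S k z.

Let i_neq : (i' == i) = false.
Proof. by apply/negbTE/eqP => /(congr1 val) /=; rewrite ii; lia. Qed.

Let cfg_in (A : {set I}) k (d : I) : cfg A k (N + (val d : nat)%:Z) =
  if k == i then d \notin A else if k == i' then d \in A else ent S k (N + (val d : nat)%:Z).
Proof.
rewrite /cfg; case: pickP => [d' /eqP e|/(_ d)]; last by rewrite eqxx.
by have -> : d' = d by apply: val_inj; apply: val_inj => /=; move/addrI: e => [].
Qed.

Let cfg_out (A : {set I}) k z : (forall d : I, z != N + (val d : nat)%:Z) -> cfg A k z = ent S k z.
Proof. by move=> h; rewrite /cfg; case: pickP => // d; rewrite (negbTE (h d)). Qed.

Let cfg0 : cfg [set d : I | ent S i' (N + (val d : nat)%:Z)] = ent S.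
Proof.
apply: funext => k; apply: funext => z.
case: (pselect (exists d : I, z = N + (val d : nat)%:Z)) => [[d ->]|nd]; last first.
  by apply: cfg_out => d; apply/eqP => e; apply: nd; exists d.
rewrite cfg_in !inE; have [->|_] := eqVneq k i; last by case: eqP => [->|].
by have := valP d; rewrite /single => /andP[_]; case: (ent S i _); case: (ent S i' _).
Qed.

Let cfg_move (B : {set I}) (p : I) : cmove i i' (N + (val p : nat)%:Z) (cfg B) = cfg (p |: B).
Proof.
apply: funext => k; apply: funext => z; rewrite /cmove.
have [->|zp] := eqVneq z (N + (val p : nat)%:Z).
  by rewrite !cfg_in !inE !eqxx /=; case: (k == i); case: (k == i').
rewrite /cfg; case: pickP => // d /eqP e; rewrite !inE.
by have -> : (d == p) = false by apply/negbTE/eqP => e'; move: zp; rewrite e e' eqxx.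
Qed.

(** The new entry in row [i'] is the highest binary digit in which the keys differ: [cfg B] agrees
    with [S] beyond [y], and the entry removed from row [i] has a lower rank. *)
Let key_move (B : {set I}) (d : 'I_n) T : y < N + (d : nat)%:Z ->
  ent S i' (N + (d : nat)%:Z) = false ->
  ent T = cmove i i' (N + (d : nat)%:Z) (cfg B) -> (key N n S < key N n T)%N.
Proof.
move=> yd h e; apply: (@key_lt _ _ _ _ S T i' d); first by rewrite h.
  by rewrite e /cmove eqxx i_neq eqxx.
move=> k d' lt; rewrite e /cmove.
have out (d1 : 'I_n) : y < N + (d1 : nat)%:Z -> forall p : I, N + (d1 : nat)%:Z != N + (val p : nat)%:Z.
  by move=> yd1 p; apply/eqP => e1; have := valP p; rewrite /single -e1 leNgt yd1.
have [e1|ne] := eqVneq (N + (d' : nat)%:Z) (N + (d : nat)%:Z).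
  have dd : (d' : nat) = d by lia.
  have ki' : (k > i')%N by move: lt; rewrite dd ltn_add2l.
  have -> : k == i = false by apply/negbTE/eqP => ek; move: ki'; rewrite ek ii; lia.
  have -> : k == i' = false by apply/negbTE/eqP => ek; move: ki'; rewrite ek ltnn.
  by rewrite cfg_out // e1; exact: out.
have dd : (d < d')%N.
  rewrite ltn_neqAle; apply/andP; split; first by apply: contra ne => /eqP ->.
  rewrite leqNgt; apply/negP => d'd.
  have : (l * d' + k < l * d'.+1)%N by rewrite mulnS addnC ltn_add2r.
  have : (l * d'.+1 <= l * d)%N by rewrite leq_mul2l d'd orbT.
  lia.
by rewrite cfg_out //; apply: out; lia.
Qed.

(** Otherwise [A0] has more than half of the elements of [I]. In the raising equation at [cfg B],
    the columns beyond [y] lead to symbols of larger key, where [u] vanishes; the rest is a weighted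
    sum over the sets [p |: B]. By [twisted_up_inj] the coefficient at [A0], which is that of [S],
    would be 0. *)
Lemma leading_count : (#|low_entries S i' y| <= #|low_entries S i y|)%N.
Proof.
rewrite leqNgt; apply/negP => lt.
pose A0 : {set I} := [set d : I | ent S i' (N + (val d : nat)%:Z)].
have cI : (#|I| < #|A0| + #|A0|)%N.
  pose b := #|[set d : 'I_n | (N + (d : nat)%:Z <= y) && (ent S i (N + (d : nat)%:Z) && ent S i' (N + (d : nat)%:Z))]|.
  have vinj : injective (val : I -> 'I_n) := val_inj.
  have E1 : #|low_entries S i' y| = (#|A0| + b)%N.
    rewrite -(card_imset _ vinj) card_disjointU => [|d]; last first.
      by move=> /imsetP[p _ ->]; rewrite inE => /and3P[_ h1 h2]; have := valP p; rewrite /single h1 h2 andbF.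
    apply: eq_card => d; rewrite !inE; apply/idP/orP => [/andP[h1 h2]|].
      case h3: (ent S i (N + (d : nat)%:Z)); first by right; rewrite h1 h2.
      have sd : single d by rewrite /single h1 h2 h3.
      by left; apply/imsetP; exists (Sub d sd : I); rewrite ?inE SubK.
    move=> [/imsetP[p]|/and3P[-> _ ->]//].
    by rewrite inE => h ->; rewrite h andbT; have := valP p; rewrite /single => /andP[].
  have E2 : #|low_entries S i y| = (#|~: A0| + b)%N.
    rewrite -(card_imset _ vinj) card_disjointU => [|d]; last first.
      by move=> /imsetP[p _ ->]; rewrite inE => /and3P[_ h1 h2]; have := valP p; rewrite /single h1 h2 andbF.
    apply: eq_card => d; rewrite !inE; apply/idP/orP => [/andP[h1 h2]|].
      case h3: (ent S i' (N + (d : nat)%:Z)); first by right; rewrite h1 h2.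
      have sd : single d by rewrite /single h1 h2 h3.
      by left; apply/imsetP; exists (Sub d sd : I); rewrite ?inE SubK ?h3.
    move=> [/imsetP[p]|/and3P[-> -> _]//].
    rewrite !inE => h ->; have := valP p; rewrite /single => /andP[-> h'].
    by move: h h'; case: (ent S i _); case: (ent S i' _).
  by move: lt; rewrite E1 E2 ltn_add2r -(cardsC A0) ltn_add2l.
have : ccoef u (cfg A0) = 0.
  apply: (@twisted_up_inj I #|A0| (fun A => ccoef u (cfg A))
    (fun B p => crow N n i i' (cfg B) (val p : 'I_n)) cI) => // B Bk.
  refine (etrans _ (uK ii (cfg B))); rewrite /raise_row /=.
  rewrite [RHS](bigID single) /= [X in _ + X]big1 ?addr0; last first.
    move=> d nd; case: ifP => // /andP.
    have nI (p : I) : N + (d : nat)%:Z != N + (val p : nat)%:Z.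
      apply/eqP => e; move: nd; have -> : d = val p by apply: val_inj; move/addrI: e => [].
      by rewrite (valP p).
    rewrite !cfg_out // => -[h1 h2].
    have yd : y < N + (d : nat)%:Z.
      by rewrite ltNge; apply: contra nd => dy; rewrite /single dy h1 (negbTE h2).
    case: (pselect (exists T, ent T = cmove i i' (N + (d : nat)%:Z) (cfg B))) => [[T e]|nT]; last first.
      by rewrite ccoef_none ?mulr0 // => T e; apply: nT; exists T.
    have kT := key_move yd (negbTE h2) e; rewrite -e ccoef_ent.
    have [->|/Smax] := eqVneq u@_T 0; first by rewrite mulr0.
    by rewrite leqNgt kT.
  rewrite [RHS](reindex_omap (val : I -> 'I_n) insub) /=; last first.
    by move=> d sd; rewrite insubT /=.
  rewrite big_mkcond [RHS]big_mkcond /=. apply: eq_bigr => p _.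
  rewrite (valP p) valK eqxx /= !cfg_in eqxx i_neq eqxx andbb.
  by case: ifP => // _; rewrite cfg_move.
rewrite /A0 cfg0 ccoef_ent => /eqP; apply/negP; exact: uS.
Qed.

End Leading.

Lemma leading_standard u S : row_killed u -> windowed_vector N n u -> u@_S != 0 ->
  (forall T, u@_T != 0 -> (key N n T <= key N n S)%N) -> standard S.
Proof.
move=> uK uW uS Smax i i' ii j ji'; rewrite leNgt; apply/negP => lt.
have [_] := window_count_lt (uW _ uS) ii ji' lt.
by rewrite ltnNge (leading_count uK uS Smax _ ii).
Qed.

End Kernel.

(** * The canonical element *)

Section IncreasingRearrangements.
Local Open Scope ring_scope.
Variables (l : nat) (v : 'I_l -> int).
Hypothesis hv : forall i j : 'I_l, (i <= j)%N -> v j <= v i.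
Variables (N : int) (n : nat).
Hypothesis vN : forall i, v i < N + n%:Z.
Implicit Types (T S : symbol v) (x y : int) (Z b : int -> 'I_l -> int).

Lemma increasing_count_eq b Z j :
  (forall i k : 'I_l, (i <= k)%N -> j <= v k -> b j i <= b j k) ->
  (forall i k : 'I_l, (i <= k)%N -> j <= v k -> Z j i <= Z j k) ->
  (forall x, spine_count v b j x = spine_count v Z j x) ->
  forall i, j <= v i -> b j i = Z j i.
Proof.
move=> mb mZ cnt.
pose s := [seq i <- enum 'I_l | j <= v i].
have ss : sorted (relpre (@nat_of_ord l) leq) s.
  apply: sorted_filter; first by move=> y x z; exact: leq_trans.
  by rewrite -sorted_map val_enum_ord iota_sorted.
have all_s : all (fun i => j <= v i) s by exact: filter_all.
have sorted_row (c : int -> 'I_l -> int) :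
    (forall i k : 'I_l, (i <= k)%N -> j <= v k -> c j i <= c j k) ->
    sorted <=%O [seq c j i | i <- s].
  move=> mc; apply: (homo_sorted_in _ all_s ss) => i k _ jk ik; exact: mc.
have countE (c : int -> 'I_l -> int) x : count_mem x [seq c j i | i <- s] = spine_count v c j x.
  rewrite /spine_count cardE /enum_mem size_filter -enumT count_map count_filter.
  by apply: eq_count => i; rewrite /= inE andbC.
have perm : perm_eq [seq b j i | i <- s] [seq Z j i | i <- s].
  by apply/allP => x _ /=; rewrite !countE cnt.
have := sorted_eq le_trans le_anti (sorted_row _ mb) (sorted_row _ mZ) perm.
move=> /eq_in_map H i ji; apply: H.
by rewrite mem_filter ji mem_enum.
Qed.

Lemma total_inv_sorted Z : spine_family v N Z -> total_inv v N n Z = 0%N.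
Proof.
move=> [Z1 _ _ _]; apply: big1 => d _; apply/eqP; rewrite cards_eq0; apply/eqP/setP => -[i k].
rewrite !inE /=; apply/negbTE/negP => /and3P[ik jk]; rewrite ltNge.
by move/negP; apply; apply: Z1 => //; exact: ltnW.
Qed.

(** Without inversions each spine is the increasing arrangement of its values, which is [Z]. *)
Lemma total_inv_eq0 Z S T b : spine_family v N Z -> rearranges Z S Z ->
  rearranges Z T b -> total_inv v N n b = 0%N -> T = S.
Proof.
move=> ZF [S1 S2 _] R inv0; have [R1 R2 R3] := R; have [Z1 _ _ Z4] := ZF.
have bZ i j : j <= v i -> b j i = Z j i.
  have [jN|Nj] := ltP j N.
    by move=> ji; have [k jk <-] := rearranges_val R ji; rewrite !Z4.
  apply: increasing_count_eq => [i1 i2 ik jk|i1 i2 ik jk|x]; [|exact: Z1|exact: R3].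
  rewrite leNgt; apply/negP => lt.
  have ik' : (i1 < i2)%N.
    by rewrite ltn_neqAle ik andbT; apply/negP => /eqP/val_inj e; move: lt; rewrite e ltxx.
  have jd : (absz (j - N)%R < n)%N by have := vN i2; lia.
  move/eqP: inv0; rewrite /total_inv sum_nat_eq0 => /forallP/(_ (Ordinal jd)) /=.
  rewrite (_ : N + _ = j); last by lia.
  rewrite cards_eq0 => /eqP/setP/(_ (i1, i2)); rewrite !inE /= ik' jk lt.
  by [].
apply: ent_inj => i x; apply/idP/idP => [/R2|/S2] [j ji <-].
- by rewrite bZ // S1.
- by rewrite -bZ // R1.
Qed.

Lemma spine_coefs_unique Z (G G' : fock v) :
  spine_coefs N n Z G -> spine_coefs N n Z G' -> G = G'.
Proof.
move=> hG hG'; apply/malgP => T; have [h1 h2] := hG T; have [h1' h2'] := hG' T.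
case: (pselect (exists b, rearranges Z T b)) => [[b R]|nb].
  exact: etrans (h1 b R) (esym (h1' b R)).
have nR b : ~ rearranges Z T b by move=> R; apply: nb; exists b.
exact: etrans (h2 nR) (esym (h2' nR)).
Qed.

End IncreasingRearrangements.

Section Bounds.
Local Open Scope ring_scope.
Variables (l : nat) (v : 'I_l -> int).
Implicit Types (T : symbol v).

Lemma int_seq_bound (s : seq int) : exists B : nat, forall x, x \in s -> (absz x <= B)%N.
Proof.
exists (\sum_(x <- s) absz x)%N => x xs.
by rewrite (big_rem x) //= leq_addr.
Qed.

Lemma symbol_window T (M : int) : exists N n,
  [/\ N <= M, windowed N n T, forall i, N <= v i & forall i, v i < N + n%:Z].
Proof.
have /boolp.choice[b hb] : forall i, exists b : int, forall j, j <= b -> T i j = j.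
  by move=> i; case: (rowP (T i)) => _ [N0 h] _; exists N0.
have [B hB] := int_seq_bound (M :: [seq b i | i : 'I_l] ++
  [seq v i | i : 'I_l] ++ [seq T i (v i) | i : 'I_l]).
have hM : (absz M <= B)%N by apply: hB; rewrite inE eqxx.
have bB i : (absz (b i) <= B)%N by apply: hB; rewrite inE mem_cat map_f ?orbT ?mem_enum.
have vB i : (absz (v i) <= B)%N.
  by apply: hB; rewrite inE !mem_cat (map_f v) ?orbT ?mem_enum.
have tB i : (absz (T i (v i)) <= B)%N.
  by apply: hB; rewrite inE !mem_cat (map_f (fun i => T i (v i))) ?orbT ?mem_enum.
exists (- B%:Z), (B + B).+1; split=> [||i|i]; [lia| |have := vB i; lia|have := vB i; lia].
split=> i y hy.
  apply/entP; exists y; first by have := vB i; lia.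
  by apply: hb; have := bB i; lia.
apply/entP => -[j ji e].
have : T i j <= T i (v i).
  by move: ji; rewrite le_eqVlt => /orP[/eqP-> //|lt]; apply/ltW/row_lt.
by rewrite e; have := tB i; lia.
Qed.

Lemma words_window (s : seq (seq (int * nat))) : exists N n,
  [/\ forall i, N <= v i, forall i, v i < N + n%:Z & forall w, w \in s -> letters_in N n w].
Proof.
have [B hB] := int_seq_bound ([seq v i | i : 'I_l] ++ [seq p.1 | p <- flatten s]).
have vB i : (absz (v i) <= B)%N by apply: hB; rewrite mem_cat map_f ?mem_enum.
exists (- B%:Z), (B + B).+2; split=> [i|i|w ws p pw]; [have := vB i; lia|have := vB i; lia|].
have : (absz p.1 <= B)%N.
  by apply: hB; rewrite mem_cat (map_f fst) ?orbT //; apply/flattenP; exists w.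
by lia.
Qed.

End Bounds.

Lemma subst_qinv0 : subst_qinv 0%R = 0%R.
Proof. have := subst_qinvB 0%R 0%R; rewrite subrr => ->; exact: subrr. Qed.

(** * Triangularity of the bar involution and uniqueness *)

Section Uniqueness.
Local Open Scope ring_scope.
Variables (l : nat) (v : 'I_l -> int).
Hypothesis hv : forall i j : 'I_l, (i <= j)%N -> v j <= v i.
Variable bar : fock v -> fock v.
Hypothesis hbar : bar_involution bar.
Implicit Types (u w : fock v) (S T : symbol v).

Section Window.
Variables (N : int) (n : nat).
Hypothesis Nv : forall i, N <= v i.
Hypothesis vN : forall i, v i < N + n%:Z.

Definition confined u : Prop := [/\ V_module u, row_killed N n u & windowed_vector N n u].

Lemma confinedB (c : Qq) u w : confined u -> confined w -> confined (u - c *: w).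
Proof.
move=> [u1 u2 u3] [w1 w2 w3]; split.
- apply: V_moduleB => //; exact: V_moduleZ.
- exact: row_killedB.
- exact: windowed_vectorB.
Qed.

Lemma confined_Fdiv_word (w : seq (int * nat)) : letters_in N n w -> confined (Fdiv_word v w).
Proof.
move=> hw; split.
- exact: V_module_Fdiv_word.
- exact: row_killed_Fdiv_word.
- exact: windowed_Fdiv_word.
Qed.

Lemma confined_sum (I : finType) (c : I -> Qq) (b : I -> seq (int * nat)) :
  (forall i, letters_in N n (b i)) -> confined (\sum_i c i *: Fdiv_word v (b i)).
Proof.
move=> hb; apply: big_rec => [|i u _ hu].
  have h0 : confined (Fdiv_word v [::]) by apply: confined_Fdiv_word.
  have := confinedB 1 h0 h0; rewrite scale1r.
  by rewrite (subrr (Fdiv_word v [::])).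
have := confinedB (- c i) hu (confined_Fdiv_word (hb i)).
by rewrite scaleNr opprK addrC.
Qed.

Lemma bar_shift (c : Qq) u w : V_module u -> V_module w -> bar w = w ->
  bar u = bar (u - c *: w) + subst_qinv c *: w.
Proof.
move=> Vu Vw bw; have [_ bD bZ _ _] := hbar; have Vc := V_moduleZ c Vw.
have := bD _ _ (V_moduleB Vu Vc) Vc; rewrite subrK => ->.
by rewrite (bZ c w Vw) bw.
Qed.

(** Induction on a strict bound for the keys, which need not be sharp. Subtracting a multiple of a
    bar-invariant monomial vector with the same leading symbol lowers the bound, and [bar]
    conjugates only the scalar. *)
Lemma bar_leading m u : confined u -> (forall T, u@_T != 0 -> (key N n T < m)%N) ->
  (forall T, (bar u)@_T != 0 -> windowed N n T /\ (key N n T < m)%N) /\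
  (forall T, windowed N n T -> m = (key N n T).+1 -> (bar u)@_T = subst_qinv u@_T).
Proof.
have [_ bD bZ _ _] := hbar.
elim: m u => [|m IH] u hu um.
  have u0 : u = 0.
    by apply/malgP => T; rewrite mcoeff0; apply/eqP; apply: contraT => /um.
  have b0 : bar u = 0.
    have [Vu _ _] := hu; have := bZ 0 u Vu; rewrite subst_qinv0 (scale0r (bar u)) => <-.
    by rewrite scale0r u0.
  by split=> T //; rewrite b0 mcoeff0 eqxx.
case: (pselect (exists2 T, u@_T != 0 & key N n T = m)) => [[T uT kT]|nT]; last first.
  have um' T : u@_T != 0 -> (key N n T < m)%N.
    move=> uT; rewrite ltn_neqAle -ltnS um // andbT.
    by apply/eqP => e; apply: nT; exists T.
  have [h1 _] := IH u hu um'; split=> [T /h1[h2 h3]|T wT [kT]].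
    by split=> //; exact: ltnW.
  have -> : u@_T = 0 by apply/eqP; apply: contraT => /um'; rewrite -kT ltnn.
  by rewrite subst_qinv0; apply/eqP; apply: contraT => /h1[_]; rewrite -kT ltnn.
have [Vu Ku Wu] := hu; have wT := Wu T uT.
have stT : standard T.
  by apply: (leading_standard hv Ku Wu uT) => S /um; rewrite kT ltnS.
have [A [hA bA w2 w3]] : exists A, [/\ confined A, bar A = A, A@_T = 1 &
    forall S, A@_S != 0 -> dominated N n S T].
  have [w [w1 w2 w3]] := standard_monomial hv wT stT; exists (Fdiv_word v w).
  exact: (And4 (confined_Fdiv_word w1) (bar_Fdiv_word hbar w) w2 w3).
have [VA _ _] := hA.
set c := u@_T in uT; set u' := u - c *: A.
have keyA S : A@_S != 0 -> windowed N n S /\ (key N n S <= m)%N.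
  by move=> /w3[wS _ _ tS]; split=> //; rewrite -kT; exact: key_tail_le tS.
have hu' : confined u' := confinedB c hu hA.
have u'm S : u'@_S != 0 -> (key N n S < m)%N.
  move=> u'S; have [wS kS] : windowed N n S /\ (key N n S <= m)%N.
    have [uS|/[dup] /Wu wS /um kS] := eqVneq u@_S 0; last by split.
    apply: keyA; apply: contra u'S => /eqP e.
    by rewrite /u' mcoeffB mcoeffZ uS e mulr0 subrr.
  rewrite ltn_neqAle kS andbT; apply: contra u'S => /eqP e.
  have -> : S = T by apply: (key_inj wS wT); rewrite e.
  by rewrite /u' mcoeffB mcoeffZ w2 mulr1 subrr.
have [h1 _] := IH u' hu' u'm; have [Vu' _ _] := hu'.
have bE : bar u = bar u' + subst_qinv c *: A := bar_shift c Vu VA bA.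
split=> [S|S wS [kS]].
  have [e|/h1[h2 h3] _] := eqVneq (bar u')@_S 0; last by split=> //; exact: ltnW.
  rewrite bE mcoeffD mcoeffZ e add0r => h.
  by apply: keyA; apply: contra h => /eqP ->; rewrite mulr0.
have -> : S = T by apply: (key_inj wS wT); rewrite kT.
rewrite bE mcoeffD mcoeffZ w2 mulr1.
have -> : (bar u')@_T = 0 by apply/eqP; apply: contraT => /h1[_]; rewrite kT ltnn.
by rewrite add0r.
Qed.

Lemma confined_eq0 u : confined u -> (forall T, int_laurent u@_T) -> bar u = u ->
  (forall T, exists2 c, regular_at0 c & u@_T = q * c) -> u = 0.
Proof.
move=> hu hint bu hq.
have bound m : (forall T, u@_T != 0 -> (key N n T < m)%N) -> u = 0.
  elim: m => [|m IH] um.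
    by apply/malgP => T; rewrite mcoeff0; apply/eqP; apply: contraT => /um.
  apply: IH => T uT; rewrite ltn_neqAle -ltnS um // andbT; apply/eqP => kT.
  have [_ _ Wu] := hu; have [_ h] := bar_leading hu um.
  have [c cr cE] := hq T.
  have := h T (Wu T uT) (congr1 succn (esym kT)); rewrite bu => e.
  by have := bar_invariant_eq0 (hint T) cr cE (esym e); apply/eqP.
apply: (bound (\sum_(T <- msupp u) (key N n T)).+1)%N => T uT.
have Tu : T \in (msupp u : seq _) by rewrite -mcoeff_neq0 in uT *.
by rewrite ltnS (big_rem T) //= leq_addr.
Qed.

End Window.

Lemma V_integralB u w : V_integral u -> V_integral w -> V_integral (u - w).
Proof.
move=> hu hw; rewrite -scaleN1r; apply: span_overD => //.
apply: span_overZ => //; first exact: int_laurentM.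
by exists (- 1), 0%N; rewrite expr0 divr1 rmorphN1 tofracN tofrac1.
Qed.

Lemma bar_invariant_unique u w : V_integral u -> V_integral w -> bar u = u -> bar w = w ->
  (forall T, exists2 c, regular_at0 c & u@_T - w@_T = q * c) -> u = w.
Proof.
move=> hu hw bu bw hq; have [_ bD bZ _ _] := hbar.
have Vu := V_integral_module hu; have Vw := V_integral_module hw.
have hd := V_integralB hu hw.
have bd : bar (u - w) = u - w.
  rewrite -scaleN1r (bD _ _ Vu (V_moduleZ _ Vw)) (bZ _ _ Vw) bu bw.
  have -> : subst_qinv (- 1) = - 1 by rewrite -(sub0r 1) subst_qinvB subst_qinv0 subst_qinv1.
  exact: erefl.
suff d0 : u - w = 0 by rewrite -[u](subrK w) d0 add0r.
have hint T := V_integral_coef T hd.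
have hq' T : exists2 c, regular_at0 c & (u - w)@_T = q * c by rewrite mcoeffB; exact: hq.
move: hd bd hint hq'; set d := u - w => -[m [c [b [h dE]]]] bd hint hq'.
have /boolp.choice[f fE] : forall i, exists f : seq (int * nat), b i = Fdiv_word v f.
  by move=> i; have [_ [x _ <-]] := h i; exists x.
(* The window is chosen after the difference has been written with finitely many monomials, so as to
   contain all their letters. *)
have [N [n [Nv vN hL]]] := words_window v [seq f i | i : 'I_m].
apply: (@confined_eq0 N n Nv vN) => //.
have -> : d = \sum_i c i *: Fdiv_word v (f i).
  by rewrite dE; apply: eq_bigr => i _; rewrite fE.
by apply: confined_sum => // i; apply: hL; rewrite map_f ?mem_enum.
Qed.

End Uniqueness.

Lemma spine_sum_regular (l : nat) (v : 'I_l -> int) (S : symbol v) (u : fock v) :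
  u@_S = 1%R -> (forall T, T <> S -> u@_T = 0%R \/ exists m, u@_T = (q ^+ m.+1)%R) ->
  exists2 w : fock v, fock_regular w & u = (basis_vector S + q *: w)%R.
Proof.
move=> uS uT.
have wE T : ((q^-1 *: (u - basis_vector S))%R : fock v)@_T = (q^-1 * (u@_T - (basis_vector S)@_T))%R.
  by rewrite mcoeffZ mcoeffB.
exists (q^-1 *: (u - basis_vector S))%R.
  apply/fock_regularP => T; rewrite wE mcoeffU.
  have [<-|/eqP ne] := eqVneq S T.
    by rewrite uS mulr1n subrr mulr0; exact: regular0.
  rewrite mulr0n subr0; have [->|[m ->]] := uT T (nesym ne).
    by rewrite mulr0; exact: regular0.
  rewrite exprS mulrA mulVf ?q_neq0 // mul1r -tofracXn.
  exact: regular_poly.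
by rewrite scalerA divff ?q_neq0 // scale1r addrC subrK.
Qed.

Lemma sub_congruent (A : pzRingType) (b p y x : A) :
  ((b + p * y) - (b + p * x) = p * (y - x))%R.
Proof. by rewrite mulrBr opprD addrACA subrr add0r. Qed.

Lemma mcoeff_congruent (l : nat) (v : 'I_l -> int) (b y x G u : fock v) T :
  G = (b + q *: y)%R -> u = (b + q *: x)%R -> (G@_T - u@_T = q * (y@_T - x@_T))%R.
Proof.
move=> -> ->.
have h (z : fock v) : (b + q *: z)@_T = (b@_T + q * z@_T)%R.
  by rewrite mcoeffD mcoeffZ.
exact: (etrans (congr2 (fun a c => a - c)%R (h y) (h x)) (sub_congruent _ _ _ _)).

Qed.

Local Open Scope ring_scope.

Theorem theorem4p12 (l : nat) (hl : (1 <= l)%N) (v : 'I_l -> int)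
    (hv : forall i j : 'I_l, (i <= j)%N -> v j <= v i)
    (S : symbol v) (hS : standard S) (hpsi : compatible S)
    (Y : forall j : int, 'I_(height v j) -> int) (hY : spine_indexing S Y)
    (bar : fock v -> fock v) (hbar : bar_involution bar) :
  (forall G : fock v, canonical_element bar S G <-> G = spine_sum Y) /\
  monomial (spine_sum Y).
Proof.
have [M hM] := spine_entry_family hv hS hY.
(* The window starts below [M], so the spines form a family with this [N]. *)
have [N [n [NM wS Nv vN]]] := symbol_window S M.
have ZF := hM N NM; have R := spine_entry_rearranges hv hY.
have [w [w_sorted _ w_coefs]] := spine_monomial hv vN wS ZF R.
have coefs := spine_sum_coefs hv vN ZF.
have E : spine_sum Y = Fdiv_word v w := spine_coefs_unique coefs w_coefs.
move: coefs; rewrite E => coefs.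
have int_w := V_integral_Fdiv_word v w; have bar_w := bar_Fdiv_word hbar w.
set u := Fdiv_word v w in coefs int_w bar_w *.
have uS : u@_S = 1.
  have [h _] := coefs S; rewrite (h _ R) (total_inv_sorted n ZF).
  exact: expr0.
(* Only [S] itself comes from a rearrangement without inversions, so every other coefficient is
   divisible by q. *)
have uT T : T <> S -> u@_T = 0 \/ exists m, u@_T = q ^+ m.+1.
  move=> TS; case: (pselect (exists b, rearranges (spine_entry Y) T b)) => [[b Rb]|nb].
    right; case: (posnP (total_inv v N n b)) => [i0|ipos].
      by case: TS; exact: (total_inv_eq0 vN ZF R Rb i0).
    exists (total_inv v N n b).-1; rewrite prednK //; exact: ((coefs T).1 b Rb).
  by left; apply: (coefs T).2 => b Rb; apply: nb; exists b.
have [x x_reg xE] := spine_sum_regular uS uT.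
split; last exact: (ex_intro _ w (conj w_sorted erefl)).
move=> G; split=> [[G_int G_bar [y y_reg yE]]|->]; last exact: (And3 int_w bar_w (ex_intro2 _ _ x x_reg xE)).
apply: (bar_invariant_unique hv hbar) => [//|//|||T]; [exact: G_bar|exact: bar_w|].
exists (y@_T - x@_T); first by apply: regularB; apply/fock_regularP: T.
exact: (mcoeff_congruent T yE xE).
Qed.
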